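(* Let $k$ be an algebraically closed field of characteristic zero, let $n\in\mathbb{N}$, let $A=\mathbf{A}_n(k)$ be the $n$-th Weyl algebra over $k$, and let $H$ be a finite dimensional Hopf algebra over $k$ which acts on $A$. Assume that this action gives rise to an $H^*$-Hopf-Galois extension $A^H\subset A$. Then the action of $H$ on $A$ factors through a group action.
   Context: For a commutative ring $R$, the Weyl algebra $\mathbf{A}_n(R)$ is the $R$-algebra generated by $x_i,y_i$ ($i=1,\dots,n$) subject to the relations $[x_i,x_j]=[y_i,y_j]=0$ and $[y_i,x_j]=\delta_{ij}$. An action of a Hopf algebra $H$ on an algebra $A$ means that $A$ is a (left) $H$-module algebra: $A$ is an $H$-module with $h\cdot(ab)=\sum (h_{(1)}\cdot a)(h_{(2)}\cdot b)$ and $h\cdot 1=\varepsilon(h)1$. The subalgebra of invariants is $A^H=\{a\in A: h\cdot a=\varepsilon(h)a \text{ for all } h\in H\}$. Since $H$ is finite dimensional, the action corresponds to a coaction $\rho:A\to A\otimes H^*$, $\rho(a)=\sum_i (h_i\cdot a)\otimes h_i^*$, where $\{h_i\}$ is a basis of $H$ and $\{h_i^*\}$ its dual basis. The extension $A^H\subset A$ is $H^*$-Hopf-Galois if the map $\mathrm{can}:A\otimes_{A^H}A\to A\otimes H^*$, $b\otimes b'\mapsto (b\otimes 1)\rho(b')$, is bijective. The action of $H$ on $A$ factors through a group action if there is a Hopf ideal $I\subset H$ with $I\cdot A=0$ such that $H/I$ is isomorphic, as a Hopf algebra, to a group algebra $kG$ of a (finite) group $G$. *)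

(* Defs.v *)
From HB Require Import structures.
From mathcomp Require Import all_fingroup.
From mathcomp Require Import all_boot all_algebra all_field.
From mathcomp Require Import boolp.

Set Implicit Arguments.
Unset Strict Implicit.
Unset Printing Implicit Defensive.

Import GRing.Theory.
Local Open Scope ring_scope.
Local Open Scope quotient_scope.

(* M (x)_S N, for a right action ra of S on M and a left action la of S on N.
   An element is a formal sum of pairs (m, n); two formal sums are identified
   when every biadditive S-balanced map to an abelian group agrees on them. *)
Section Tensor.
Variables (S : Type) (M N : zmodType) (ra : M -> S -> M) (la : S -> N -> N).

Definition balanced (V : zmodType) (f : M -> N -> V) : Prop :=
  [/\ forall n, {morph f^~ n : x y / x + y},
      forall m, {morph f m : x y / x + y} &
      forall m s n, f (ra m s) n = f m (la s n)].

Definition formal_eval (V : zmodType) (f : M -> N -> V) (s : seq (M * N)) : V :=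
  \sum_(p <- s) f p.1 p.2.

Definition tensor_rel : rel (seq (M * N)) := fun s t =>
  `[< forall (V : zmodType) (f : M -> N -> V),
        balanced f -> formal_eval f s = formal_eval f t >].

Lemma tensor_rel_equiv : equiv_class_of tensor_rel.
Proof.
split.
- by move=> s; apply/asboolP.
- by move=> s t; apply/asboolP/asboolP => h V f bf; rewrite h.
- by move=> s t u /asboolP h1 /asboolP h2; apply/asboolP => V f bf; rewrite h1 ?h2.
Qed.

Canonical tensor_equiv := EquivRelPack tensor_rel_equiv.

Definition tensor : Type := {eq_quot tensor_equiv}.
HB.instance Definition _ := Choice.on tensor.
HB.instance Definition _ := EqQuotient.on tensor.

Definition formal (s : seq (M * N)) : tensor := \pi_tensor s.
Definition tens (m : M) (n : N) : tensor := formal [:: (m, n)].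

(* Meaningful only when f is balanced (see lift_tens). *)
Definition lift (V : zmodType) (f : M -> N -> V) (t : tensor) : V :=
  formal_eval f (repr t).

Lemma formalP s t : reflect
  (forall (V : zmodType) (f : M -> N -> V),
     balanced f -> formal_eval f s = formal_eval f t)
  (formal s == formal t).
Proof. by rewrite /formal eqmodE; apply: asboolP. Qed.

Lemma lift_formal (V : zmodType) (f : M -> N -> V) s :
  balanced f -> lift f (formal s) = formal_eval f s.
Proof.
move=> bf; rewrite /lift.
have /eqP/formalP -> // : formal (repr (formal s)) = formal s by rewrite /formal reprK.
Qed.

Lemma formal_repr (t : tensor) : formal (repr t) = t. Proof. exact: reprK. Qed.

Definition formal_opp (s : seq (M * N)) := [seq (- p.1, p.2) | p <- s].
Definition tensor_zero := formal [::].
Definition tensor_add (t u : tensor) := formal (repr t ++ repr u).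
Definition tensor_opp (t : tensor) := formal (formal_opp (repr t)).

Lemma balancedNl (V : zmodType) (f : M -> N -> V) m n :
  balanced f -> f (- m) n = - f m n.
Proof.
case=> fl _ _; have f0: f 0 n = 0.
  by apply: (addrI (f 0 n)); rewrite -fl addr0 addr0.
by apply: (addrI (f m n)); rewrite -fl !subrr.
Qed.

Lemma formal_eval_cat (V : zmodType) (f : M -> N -> V) s t :
  formal_eval f (s ++ t) = formal_eval f s + formal_eval f t.
Proof. by rewrite /formal_eval big_cat. Qed.

Lemma formal_eval_opp (V : zmodType) (f : M -> N -> V) s :
  balanced f -> formal_eval f (formal_opp s) = - formal_eval f s.
Proof.
move=> bf; rewrite /formal_eval big_map /= raddf_sum.
by apply: eq_bigr => p _; rewrite balancedNl.
Qed.

Lemma tensor_eqP (t u : tensor) :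
  (forall (V : zmodType) (f : M -> N -> V), balanced f -> lift f t = lift f u) ->
  t = u.
Proof.
move=> h; rewrite -[t]formal_repr -[u]formal_repr; apply/eqP/formalP => V f bf.
by have := h V f bf.
Qed.

Lemma lift_addE (V : zmodType) (f : M -> N -> V) (t u : tensor) :
  balanced f -> lift f (tensor_add t u) = lift f t + lift f u.
Proof. by move=> bf; rewrite lift_formal // formal_eval_cat. Qed.

Lemma lift_oppE (V : zmodType) (f : M -> N -> V) t :
  balanced f -> lift f (tensor_opp t) = - lift f t.
Proof. by move=> bf; rewrite lift_formal // formal_eval_opp. Qed.

Lemma lift_zeroE (V : zmodType) (f : M -> N -> V) :
  balanced f -> lift f tensor_zero = 0.
Proof. by move=> bf; rewrite lift_formal // /formal_eval big_nil. Qed.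

Fact tensor_addA : associative tensor_add.
Proof. by move=> t u v; apply: tensor_eqP => V f bf; rewrite !lift_addE // addrA. Qed.
Fact tensor_addC : commutative tensor_add.
Proof. by move=> t u; apply: tensor_eqP => V f bf; rewrite !lift_addE // addrC. Qed.
Fact tensor_add0 : left_id tensor_zero tensor_add.
Proof.
by move=> t; apply: tensor_eqP => V f bf; rewrite !lift_addE // lift_zeroE // add0r.
Qed.
Fact tensor_addN : left_inverse tensor_zero tensor_opp tensor_add.
Proof.
move=> t; apply: tensor_eqP => V f bf.
by rewrite !lift_addE // lift_oppE // lift_zeroE // addNr.
Qed.

HB.instance Definition _ :=
  GRing.isZmodule.Build tensor tensor_addA tensor_addC tensor_add0 tensor_addN.

Lemma lift_tens (V : zmodType) (f : M -> N -> V) m n :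
  balanced f -> lift f (tens m n) = f m n.
Proof. by move=> bf; rewrite lift_formal // /formal_eval big_seq1. Qed.

Lemma liftD (V : zmodType) (f : M -> N -> V) :
  balanced f -> {morph lift f : t u / t + u}.
Proof. by move=> bf t u; exact: lift_addE. Qed.

Lemma lift0 (V : zmodType) (f : M -> N -> V) : balanced f -> lift f 0 = 0.
Proof. exact: lift_zeroE. Qed.

Lemma tens_balanced : balanced tens.
Proof.
split.
- move=> n x y; apply: tensor_eqP => V f bf; rewrite liftD // !lift_tens //.
  by case: bf => h _ _; exact: h.
- move=> m x y; apply: tensor_eqP => V f bf; rewrite liftD // !lift_tens //.
  by case: bf => _ h _; exact: h.
- move=> m s n; apply: tensor_eqP => V f bf; rewrite !lift_tens //.
  by case: bf => _ _ h; exact: h.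
Qed.

Lemma formal_tens s : formal s = \sum_(p <- s) tens p.1 p.2.
Proof.
apply: tensor_eqP => V f bf; rewrite lift_formal // (big_morph _ (liftD bf) (lift0 bf)).
by apply: eq_bigr => p _; rewrite lift_tens.
Qed.

Lemma tensor_ind (P : tensor -> Prop) :
  P 0 -> (forall t u, P t -> P u -> P (t + u)) ->
  (forall m n, P (tens m n)) -> forall t, P t.
Proof.
move=> P0 PD Pt t; rewrite -[t]formal_repr formal_tens.
by apply: (big_ind P).
Qed.

Lemma lift_unique (V : zmodType) (f : M -> N -> V) (g : tensor -> V) :
  balanced f -> {morph g : t u / t + u} -> (forall m n, g (tens m n) = f m n) ->
  g =1 lift f.
Proof.
move=> bf gD gf; apply: tensor_ind.
- by rewrite lift0 //; apply: (addrI (g 0)); rewrite -gD !addr0.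
- by move=> t u ht hu; rewrite gD liftD // ht hu.
- by move=> m n; rewrite lift_tens.
Qed.

End Tensor.

Arguments tens {S M N ra la} m n.
Arguments lift {S M N ra la V} f t.

Definition ktensor (k : fieldType) (M N : lmodType k) : Type :=
  @tensor k M N (fun m a => a *: m) (fun a n => a *: n).
HB.instance Definition _ (k : fieldType) (M N : lmodType k) :=
  GRing.Zmodule.on (ktensor M N).

Definition ktens (k : fieldType) (M N : lmodType k) (m : M) (n : N) :
  ktensor M N := tens m n.
Notation "m \ox n" := (ktens m n) (at level 40, left associativity) : ring_scope.

Definition klift (k : fieldType) (M N : lmodType k) (V : zmodType)
  (f : M -> N -> V) (t : ktensor M N) : V := lift f t.

Section KTensor.
Variable (k : fieldType).
Implicit Types M N V W : lmodType k.

Definition bilin M N V (f : M -> N -> V) : Prop :=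
  (forall n, linear (f^~ n)) /\ (forall m, linear (f m)).

Lemma linD V W (g : V -> W) : linear g -> {morph g : x y / x + y}.
Proof. by move=> gl x y; have := gl 1 x y; rewrite !scale1r. Qed.
Lemma lin0 V W (g : V -> W) : linear g -> g 0 = 0.
Proof. by move=> gl; apply: (addrI (g 0)); rewrite -linD // !addr0. Qed.
Lemma linZ V W (g : V -> W) : linear g -> forall a, {morph g : x / a *: x}.
Proof. by move=> gl a x; have := gl a x 0; rewrite !addr0 lin0 // addr0. Qed.

Lemma bilin_balanced M N V (f : M -> N -> V) :
  bilin f -> balanced (fun m (a : k) => a *: m) (fun a n => a *: n) f.
Proof.
case=> fl fr; split.
- by move=> n; apply: linD.
- by move=> m; apply: linD.
- by move=> m s n; rewrite (linZ (fl n)) (linZ (fr m)).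
Qed.

Section Scale.
Variables M N : lmodType k.
Implicit Types t u : ktensor M N.

Lemma ktensD (m : M) (x y : N) : m \ox (x + y) = m \ox x + m \ox y.
Proof.
by case: (tens_balanced (fun (m : M) (a : k) => a *: m) (fun a (n : N) => a *: n))
  => _ h _; exact: h.
Qed.
Lemma ktensDl (n : N) (x y : M) : (x + y) \ox n = x \ox n + y \ox n.
Proof.
by case: (tens_balanced (fun (m : M) (a : k) => a *: m) (fun a (n : N) => a *: n))
  => h _ _; exact: h.
Qed.
Lemma ktensZlr a (m : M) (n : N) : (a *: m) \ox n = m \ox (a *: n).
Proof.
by case: (tens_balanced (fun (m : M) (a : k) => a *: m) (fun a (n : N) => a *: n))
  => _ _ h; exact: h.
Qed.

Definition ktensor_scale (a : k) (t : ktensor M N) : ktensor M N :=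
  klift (fun m n => (a *: m) \ox n) t.

Fact kscale_balanced a :
  balanced (fun m (b : k) => b *: m) (fun b n => b *: n)
           (fun (m : M) (n : N) => (a *: m) \ox n).
Proof.
split.
- by move=> n x y; rewrite scalerDr ktensDl.
- by move=> m x y; rewrite ktensD.
- by move=> m s n; rewrite scalerA mulrC -scalerA ktensZlr.
Qed.

Fact kscale_tens a m n : ktensor_scale a (m \ox n) = (a *: m) \ox n.
Proof. by rewrite /ktensor_scale /klift lift_tens //; apply: kscale_balanced. Qed.
Fact kscaleDr : right_distributive ktensor_scale +%R.
Proof. by move=> a t u; rewrite /ktensor_scale /klift liftD //; apply: kscale_balanced. Qed.
Fact kscale0 a : ktensor_scale a 0 = 0.
Proof. by rewrite /ktensor_scale /klift lift0 //; apply: kscale_balanced. Qed.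

Fact kscaleA a b t : ktensor_scale a (ktensor_scale b t) = ktensor_scale (a * b) t.
Proof.
move: t; apply: tensor_ind => [|t u ht hu|m n]; first by rewrite !kscale0.
  by rewrite !kscaleDr ht hu.
by rewrite !kscale_tens scalerA.
Qed.
Fact kscale1 : left_id 1 ktensor_scale.
Proof.
move=> t; move: t; apply: tensor_ind => [|t u ht hu|m n]; first by rewrite !kscale0.
  by rewrite !kscaleDr ht hu.
by rewrite !kscale_tens scale1r.
Qed.
Fact kscaleDl t : {morph ktensor_scale^~ t : a b / a + b}.
Proof.
move=> a b; move: t; apply: tensor_ind => [|t u ht hu|m n]; first by rewrite !kscale0 addr0.
  by rewrite !kscaleDr ht hu addrACA.
by rewrite !kscale_tens scalerDl ktensDl.
Qed.

HB.instance Definition _ := GRing.Zmodule_isLmodule.Build k (ktensor M N)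
  kscaleA kscale1 kscaleDr kscaleDl.

Lemma ktensZl a (m : M) (n : N) : (a *: m) \ox n = a *: (m \ox n).
Proof. by rewrite -kscale_tens. Qed.
Lemma ktensZr a (m : M) (n : N) : m \ox (a *: n) = a *: (m \ox n).
Proof. by rewrite -ktensZlr ktensZl. Qed.

Lemma ktens_bilin : bilin (@ktens k M N).
Proof.
split=> [n|m] a x y; first by rewrite ktensDl ktensZl.
by rewrite ktensD ktensZr.
Qed.

Lemma klift_tens V (f : M -> N -> V) m n : bilin f -> klift f (m \ox n) = f m n.
Proof. by move=> bf; apply: lift_tens; apply: bilin_balanced. Qed.

Lemma klift_linear V (f : M -> N -> V) : bilin f -> linear (klift f).
Proof.
move=> bf a t u; have bf' := bilin_balanced bf; rewrite /klift liftD //; congr (_ + _).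
move: t; apply: tensor_ind => [|t v ht hv|m n].
- by rewrite scaler0 lift0 // scaler0.
- by rewrite scalerDr !liftD // ht hv scalerDr.
- by rewrite -[tens _ _]/(m \ox n) -ktensZl !lift_tens // (linZ (bf.1 _)).
Qed.

Lemma ktensor_ind (P : ktensor M N -> Prop) :
  P 0 -> (forall t u, P t -> P u -> P (t + u)) ->
  (forall m n, P (m \ox n)) -> forall t, P t.
Proof. exact: tensor_ind. Qed.

Lemma ktensor_ext V (f g : ktensor M N -> V) :
  linear f -> linear g -> (forall m n, f (m \ox n) = g (m \ox n)) -> f =1 g.
Proof.
move=> lf lg h; apply: ktensor_ind => [|t u ht hu|m n //]; first by rewrite !lin0.
by rewrite !linD // ht hu.
Qed.

Lemma klift_unique V (f : M -> N -> V) (g : ktensor M N -> V) :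
  bilin f -> linear g -> (forall m n, g (m \ox n) = f m n) -> g =1 klift f.
Proof.
move=> bf lg h; apply: ktensor_ext => //; first exact: klift_linear.
by move=> m n; rewrite klift_tens.
Qed.

End Scale.

Lemma lin_comp V W (X : lmodType k) (f : V -> W) (g : W -> X) : linear f -> linear g -> linear (g \o f).
Proof. by move=> lf lg a x y /=; rewrite lf lg. Qed.

Definition tmap M N (M' N' : lmodType k) (f : M -> M') (g : N -> N') (t : ktensor M N) :
  ktensor M' N' := klift (fun m n => f m \ox g n) t.

Lemma tmap_bilin M N (M' N' : lmodType k) (f : M -> M') (g : N -> N') :
  linear f -> linear g -> bilin (fun m n => f m \ox g n).
Proof.
move=> lf lg; split=> [n|m] a x y; first by rewrite lf (ktens_bilin _ _).1.
by rewrite lg (ktens_bilin _ _).2.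
Qed.

Lemma tmap_tens M N (M' N' : lmodType k) (f : M -> M') (g : N -> N') m n :
  linear f -> linear g -> tmap f g (m \ox n) = f m \ox g n.
Proof. by move=> lf lg; rewrite /tmap klift_tens //; apply: tmap_bilin. Qed.

Lemma tmap_linear M N (M' N' : lmodType k) (f : M -> M') (g : N -> N') :
  linear f -> linear g -> linear (tmap f g).
Proof. by move=> lf lg; apply: klift_linear; apply: tmap_bilin. Qed.

Definition tassoc M N (P : lmodType k) (t : ktensor (ktensor M N) P) : ktensor M (ktensor N P) :=
  klift (fun u p => klift (fun m n => m \ox (n \ox p)) u) t.

Lemma tassoc_bilin_in M N (P : lmodType k) (p : P) :
  bilin (fun (m : M) (n : N) => m \ox (n \ox p)).
Proof.
split=> [n|m] a x y; first by rewrite (ktens_bilin _ _).1.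
by rewrite (ktens_bilin _ _).1 (ktens_bilin _ _).2.
Qed.

Lemma tassoc_bilin M N (P : lmodType k) :
  bilin (fun (u : ktensor M N) (p : P) => klift (fun m n => m \ox (n \ox p)) u).
Proof.
split=> [p|u]; first by apply: klift_linear; apply: tassoc_bilin_in.
move=> a x y; move: u; apply: ktensor_ind => [|t u ht hu|m n].
- by rewrite !(lin0 (klift_linear (@tassoc_bilin_in M N P _))) scaler0 addr0.
- rewrite !(linD (klift_linear (@tassoc_bilin_in M N P _))) ht hu.
  by rewrite addrACA scalerDr.
- rewrite !klift_tens; try exact: tassoc_bilin_in.
  by rewrite (ktens_bilin _ _).2 (ktens_bilin _ _).2.
Qed.

Lemma tassoc_tens M N (P : lmodType k) (m : M) (n : N) (p : P) :
  tassoc ((m \ox n) \ox p) = m \ox (n \ox p).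
Proof.
rewrite /tassoc klift_tens; last exact: tassoc_bilin.
by rewrite klift_tens //; apply: tassoc_bilin_in.
Qed.

Lemma tassoc_linear M N (P : lmodType k) : linear (@tassoc M N P).
Proof. by apply: klift_linear; apply: tassoc_bilin. Qed.

End KTensor.

(* The ring structure (a (x) b)(a' (x) b') = aa' (x) bb'. *)
Section TensorRing.
Variables (k : fieldType) (A B : algType k).
Implicit Types t u v : ktensor A B.

Definition ktensor_mul (t u : ktensor A B) : ktensor A B :=
  klift (fun a b => tmap ( *%R a) ( *%R b) u) t.
Definition ktensor_one : ktensor A B := 1 \ox 1.

Lemma mulr_lin (C : algType k) (a : C) : linear ( *%R a).
Proof. by move=> s x y; rewrite mulrDr scalerAr. Qed.

Lemma kmul_bilin u : bilin (fun a b => tmap ( *%R a) ( *%R b) u).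
Proof.
split=> [b|a] s x y; move: u; apply: ktensor_ind => [|t u ht hu|m n].
- by rewrite !(lin0 (tmap_linear (mulr_lin _) (mulr_lin _))) scaler0 addr0.
- rewrite !(linD (tmap_linear (mulr_lin _) (mulr_lin _))) ht hu.
  by rewrite addrACA scalerDr.
- rewrite !tmap_tens; try exact: mulr_lin.
  by rewrite mulrDl -scalerAl (ktens_bilin _ _).1.
- by rewrite !(lin0 (tmap_linear (mulr_lin _) (mulr_lin _))) scaler0 addr0.
- rewrite !(linD (tmap_linear (mulr_lin _) (mulr_lin _))) ht hu.
  by rewrite addrACA scalerDr.
- rewrite !tmap_tens; try exact: mulr_lin.
  by rewrite mulrDl -scalerAl (ktens_bilin _ _).2.
Qed.

Fact kmul_tens a b a' b' :
  ktensor_mul (a \ox b) (a' \ox b') = (a * a') \ox (b * b').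
Proof.
rewrite /ktensor_mul klift_tens; last exact: kmul_bilin.
by rewrite tmap_tens //; apply: mulr_lin.
Qed.

Fact kmul_linl u : linear (ktensor_mul^~ u).
Proof. by apply: klift_linear; apply: kmul_bilin. Qed.
Fact kmul_linr t : linear (ktensor_mul t).
Proof.
move=> s x y; move: t; apply: ktensor_ind => [|t u ht hu|m n].
- by rewrite !(lin0 (kmul_linl _)) scaler0 addr0.
- by rewrite !(linD (kmul_linl _)) ht hu addrACA scalerDr.
- rewrite /ktensor_mul !klift_tens; try exact: kmul_bilin.
  exact: (tmap_linear (mulr_lin _) (mulr_lin _)).
Qed.

Fact kmulDl : left_distributive ktensor_mul +%R.
Proof. by move=> t u v; rewrite (linD (kmul_linl _)). Qed.
Fact kmulDr : right_distributive ktensor_mul +%R.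
Proof. by move=> t u v; rewrite (linD (kmul_linr _)). Qed.

Fact kmulA : associative ktensor_mul.
Proof.
move=> t u v.
move: t; apply: ktensor_ind => [|t t' ht ht'|a b].
- by rewrite !(lin0 (kmul_linl _)).
- by rewrite !kmulDl ht ht'.
move: u; apply: ktensor_ind => [|t t' ht ht'|a' b'].
- by rewrite (lin0 (kmul_linr _)) !(lin0 (kmul_linl _)) (lin0 (kmul_linr _)).
- by rewrite !(kmulDl, kmulDr) ht ht'.
move: v; apply: ktensor_ind => [|t t' ht ht'|a'' b''].
- by rewrite !(lin0 (kmul_linr _)).
- by rewrite !kmulDr ht ht'.
by rewrite !kmul_tens !mulrA.
Qed.

Fact kmul1l : left_id ktensor_one ktensor_mul.
Proof.
apply: ktensor_ind => [|t u ht hu|a b]; first exact: (lin0 (kmul_linr _)).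
  by rewrite kmulDr ht hu.
by rewrite kmul_tens !mul1r.
Qed.
Fact kmul1r : right_id ktensor_one ktensor_mul.
Proof.
apply: ktensor_ind => [|t u ht hu|a b]; first exact: (lin0 (kmul_linl _)).
  by rewrite kmulDl ht hu.
by rewrite kmul_tens !mulr1.
Qed.

HB.instance Definition _ := GRing.Zmodule_isPzRing.Build (ktensor A B)
  kmulA kmul1l kmul1r kmulDl kmulDr.

Lemma ktensM a b a' b' :
  (a \ox b : ktensor A B) * (a' \ox b') = (a * a') \ox (b * b').
Proof. exact: kmul_tens. Qed.

Lemma ktensor_mul_linl u : linear (fun t => t * u).
Proof. exact: kmul_linl. Qed.
Lemma ktensor_mul_linr t : linear (fun u => t * u).
Proof. exact: kmul_linr. Qed.
Lemma ktensor_1E : (1 : ktensor A B) = 1 \ox 1.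
Proof. by []. Qed.

End TensorRing.

HB.mixin Record isHopfAlgebra (k : fieldType) H of GRing.Algebra k H := {
  comul : H -> ktensor H H;
  counit : H -> k;
  antipode : H -> H;
  comul_linear : linear comul;
  comul_monoid : monoid_morphism comul;
  counit_scalar : scalar counit;
  counit_monoid : monoid_morphism counit;
  antipode_linear : linear antipode;
  comulA : forall h, tassoc (tmap comul id (comul h)) = tmap id comul (comul h);
  counitL : forall h, klift (fun x y => counit x *: y) (comul h) = h;
  counitR : forall h, klift (fun x y => counit y *: x) (comul h) = h;
  antipodeL : forall h, klift (fun x y => antipode x * y) (comul h) = (counit h)%:A;
  antipodeR : forall h, klift (fun x y => x * antipode y) (comul h) = (counit h)%:A
}.

#[short(type="hopfAlgType")]
HB.structure Definition HopfAlgebra (k : fieldType) :=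
  { H of isHopfAlgebra k H & GRing.Algebra k H }.

#[short(type="finHopfAlgType")]
HB.structure Definition FinHopfAlgebra (k : fieldType) :=
  { H of HopfAlgebra k H & Falgebra k H }.


Definition hopf_morphism (k : fieldType) (H K : hopfAlgType k) (f : H -> K) : Prop :=
  [/\ linear f, monoid_morphism f,
      forall h, comul (f h) = tmap f f (comul h),
      forall h, counit (f h) = counit h &
      forall h, antipode (f h) = f (antipode h)].

(* The dual algebra of H: convolution product, with the counit as unit. *)
Section Dual.
Variables (k : fieldType) (H : finHopfAlgType k).

Definition dual : Type := 'Hom(H, k^o).
HB.instance Definition _ := Vector.on dual.
Definition dual_eval (f : dual) (h : H) : k^o := fun_of_lfun f h.
Coercion dual_eval : dual >-> Funclass.

Definition conv_fun (f g : dual) (h : H) : k^o :=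
  klift (fun x y => f x * g y : k^o) (comul h).
Definition dual_mul (f g : dual) : dual := linfun (conv_fun f g).
Definition dual_one : dual := linfun (@counit k H : H -> k^o).

Lemma linfunE (V : vectType k) (h : H -> V) : linear h -> linfun h =1 h.
Proof.
move=> lh; pose hl : {linear H -> V} := HB.pack h (GRing.isLinear.Build k H V _ h lh).
by move=> x; rewrite -[h]/(hl : H -> V) lfunE.
Qed.

Lemma dual_linear (f : dual) : linear f.
Proof. by move=> a x y; rewrite /dual_eval linearP. Qed.

Lemma dual_prod_bilin (f g : dual) : bilin (fun x y => f x * g y : k^o).
Proof.
split=> [y|x] a u v; rewrite dual_linear.
  by rewrite mulrDl -scalerAl.
by rewrite mulrDr -scalerAr.
Qed.

Lemma conv_fun_linear f g : linear (conv_fun f g).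
Proof.
exact: (lin_comp (@comul_linear k H) (klift_linear (dual_prod_bilin f g))).
Qed.

Fact dual_mulE f g h : dual_mul f g h = klift (fun x y => f x * g y : k^o) (comul h).
Proof. by rewrite /dual_mul /dual_eval linfunE //; apply: conv_fun_linear. Qed.
Fact dual_oneE h : dual_one h = counit h.
Proof. by rewrite /dual_one /dual_eval linfunE //; apply: counit_scalar. Qed.

Lemma dualP (f g : dual) : (forall h, f h = g h) -> f = g.
Proof. by move=> fg; apply/lfunP. Qed.

Fact dualDE (f g : dual) h : dual_eval (f + g) h = f h + g h.
Proof. by rewrite /dual_eval; exact: lfunE. Qed.
Fact dualZE a (f : dual) h : dual_eval (a *: f) h = a * f h.
Proof. by rewrite /dual_eval; exact: lfunE. Qed.

Lemma klift_eq (M N V : lmodType k) (f g : M -> N -> V) t :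
  (forall m n, f m n = g m n) -> klift f t = klift g t.
Proof. by move=> fg; rewrite /klift /lift; apply: eq_bigr => p _. Qed.

Lemma lin_klift (M N V W : lmodType k) (f : M -> N -> V) (g : V -> W) t :
  bilin f -> linear g -> g (klift f t) = klift (fun m n => g (f m n)) t.
Proof.
move=> bf lg; apply: (klift_unique (g := g \o klift f)).
- by split=> [n|m]; [exact: (lin_comp (bf.1 n) lg)|exact: (lin_comp (bf.2 m) lg)].
- exact: (lin_comp (klift_linear bf) lg).
- by move=> m n /=; rewrite klift_tens.
Qed.

Lemma klift_tmap (M N M' N' V : lmodType k) (f : M -> M') (g : N -> N')
  (h : M' -> N' -> V) t : linear f -> linear g -> bilin h ->
  klift h (tmap f g t) = klift (fun m n => h (f m) (g n)) t.
Proof.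
move=> lf lg bh; rewrite [LHS]lin_klift; last exact: klift_linear.
  by apply: klift_eq => m n; rewrite klift_tens.
exact: tmap_bilin.
Qed.

Fact dual_mulA : associative dual_mul.
Proof.
move=> f g e; apply: dualP => h; rewrite !dual_mulE.
have lid : linear (@id H) by [].
have lc := @comul_linear k H.
have bfg := dual_prod_bilin f g; have bge := dual_prod_bilin g e.
have bF : bilin (fun x (u : ktensor H H) =>
    f x * klift (fun y z => g y * e z : k^o) u : k^o).
  split=> [u|x] a p q; first by rewrite dual_linear mulrDl -scalerAl.
  by rewrite klift_linear // mulrDr -scalerAr.
have bG : bilin (fun (u : ktensor H H) z =>
    klift (fun x y => f x * g y : k^o) u * e z : k^o).
  split=> [z|u] a p q; first by rewrite klift_linear // mulrDl -scalerAl.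
  by rewrite dual_linear mulrDr -scalerAr.
transitivity (klift (fun x (u : ktensor H H) =>
    f x * klift (fun y z => g y * e z : k^o) u : k^o) (tmap id comul (comul h))).
  by rewrite klift_tmap //; apply: klift_eq => x y; rewrite dual_mulE.
transitivity (klift (fun (u : ktensor H H) z =>
    klift (fun x y => f x * g y : k^o) u * e z : k^o) (tmap comul id (comul h))).
  rewrite -comulA; set t := tmap comul id _.
  apply: (ktensor_ext (f := klift _ \o @tassoc k H H H)).
  - exact: (lin_comp (@tassoc_linear k H H H) (klift_linear bF)).
  - exact: klift_linear.
  - move=> u z /=; rewrite [RHS]klift_tens //.
    have lr : linear (fun u => klift (fun x y => f x * g y : k^o) u * e z : k^o).
      exact: (bG.1 z).
    have l1 : linear (fun u : ktensor H H => u \ox z) by exact: (ktens_bilin _ _).1.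
    have l2 := lin_comp (lin_comp l1 (@tassoc_linear k H H H)) (klift_linear bF).
    apply: (ktensor_ext l2 lr).
    by move=> x y /=; rewrite tassoc_tens !klift_tens // mulrA.
by rewrite klift_tmap //; apply: klift_eq => x y; rewrite dual_mulE.
Qed.

Fact dual_mul1l : left_id dual_one dual_mul.
Proof.
move=> f; apply: dualP => h; rewrite dual_mulE -[in RHS](counitL h).
rewrite lin_klift; last exact: dual_linear.
  by apply: klift_eq => x y; rewrite dual_oneE (linZ (dual_linear f)).
split=> [y|x] a u v; first by rewrite counit_scalar scalerDl scalerA.
by rewrite scalerDr !scalerA mulrC.
Qed.

Fact dual_mul1r : right_id dual_one dual_mul.
Proof.
move=> f; apply: dualP => h; rewrite dual_mulE -[in RHS](counitR h).
rewrite lin_klift; last exact: dual_linear.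
  by apply: klift_eq => x y; rewrite dual_oneE (linZ (dual_linear f)) mulrC.
split=> [x|y] a u v; first by rewrite scalerDr !scalerA mulrC.
by rewrite counit_scalar scalerDl scalerA.
Qed.

Lemma klift_funD (M N V : lmodType k) (f g : M -> N -> V) t :
  klift (fun m n => f m n + g m n) t = klift f t + klift g t.
Proof. by rewrite /klift /lift /formal_eval big_split. Qed.

Lemma klift_funZ (M N V : lmodType k) a (f : M -> N -> V) t :
  klift (fun m n => a *: f m n) t = a *: klift f t.
Proof. by rewrite /klift /lift /formal_eval scaler_sumr. Qed.

Fact dual_mulDl : left_distributive dual_mul +%R.
Proof.
move=> f g e; apply: dualP => h; rewrite dualDE !dual_mulE -klift_funD.
by apply: klift_eq => x y; rewrite dualDE mulrDl.
Qed.
Fact dual_mulDr : right_distributive dual_mul +%R.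
Proof.
move=> e f g; apply: dualP => h; rewrite dualDE !dual_mulE -klift_funD.
by apply: klift_eq => x y; rewrite dualDE mulrDr.
Qed.
Fact dual_one_neq0 : dual_one != 0.
Proof.
apply/eqP => /(congr1 (fun f : dual => f 1)).
rewrite dual_oneE (counit_monoid.1) /dual_eval lfunE /=.
by move/eqP; rewrite oner_eq0.
Qed.

HB.instance Definition _ := GRing.Zmodule_isNzRing.Build dual
  dual_mulA dual_mul1l dual_mul1r dual_mulDl dual_mulDr dual_one_neq0.

Fact dual_scalerAl a (f g : dual) : a *: (f * g) = (a *: f) * g.
Proof.
apply: dualP => h; rewrite dualZE !dual_mulE.
rewrite -[LHS]/(a *: (klift _ _ : k^o)) -klift_funZ; apply: klift_eq => x y.
by rewrite dualZE -mulrA.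
Qed.
Fact dual_scalerAr a (f g : dual) : a *: (f * g) = f * (a *: g).
Proof.
apply: dualP => h; rewrite dualZE !dual_mulE.
rewrite -[LHS]/(a *: (klift _ _ : k^o)) -klift_funZ; apply: klift_eq => x y.
by rewrite dualZE mulrCA.
Qed.

HB.instance Definition _ := GRing.Lmodule_isLalgebra.Build k dual dual_scalerAl.
HB.instance Definition _ := GRing.Lalgebra_isAlgebra.Build k dual dual_scalerAr.

End Dual.

(* Hopf ideals; ideal_comul says that comul maps I into
   I (x) H + H (x) I. *)
Record hopfIdeal (k : fieldType) (H : finHopfAlgType k) := HopfIdeal {
  ideal_space : {vspace H};
  ideal_mull : forall a x, x \in ideal_space -> a * x \in ideal_space;
  ideal_mulr : forall a x, x \in ideal_space -> x * a \in ideal_space;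
  ideal_comul : forall x, x \in ideal_space ->
    exists s : seq (H * H),
      all (fun p => (p.1 \in ideal_space) || (p.2 \in ideal_space)) s /\
      comul x = \sum_(p <- s) p.1 \ox p.2;
  ideal_counit : forall x, x \in ideal_space -> counit x = 0;
  ideal_antipode : forall x, x \in ideal_space -> antipode x \in ideal_space
}.

(* H / I, carried by a linear complement of I; quot_pi is the projection, with
   kernel I (quot_pi_eq0), and is a morphism of Hopf algebras (quot_pi_hopf). *)
Section Quotient.
Variables (k : fieldType) (H : finHopfAlgType k) (I : hopfIdeal H).
Local Notation J := (ideal_space I).

Definition hopf_quot : Type := subvs_of (J^C)%VS.
HB.instance Definition _ := Vector.on hopf_quot.

Definition quot_pi (h : H) : hopf_quot := vsproj (J^C)%VS (h - projv J h).
Definition quot_repr (q : hopf_quot) : H := vsval q.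

Lemma quot_pi_linear : linear quot_pi.
Proof.
move=> a x y; rewrite /quot_pi -linearP; congr (vsproj _ _).
by rewrite linearP scalerBr opprD addrACA.
Qed.
Lemma quot_repr_linear : linear quot_repr.
Proof. by move=> a x y; rewrite /quot_repr linearP. Qed.

Lemma sub_projv_compl h : h - projv J h \in (J^C)%VS.
Proof.
have -> : h - projv J h = daddv_pi (J^C) J h.
  have := @daddv_pi_add _ _ J (J^C)%VS h.
  rewrite capv_compl addv_complf memvf => /(_ erefl isT) {1}<-.
  by rewrite /projv addrC addKr.
exact: memv_pi.
Qed.

Lemma quot_reprK : cancel quot_repr quot_pi.
Proof.
move=> q; have qC : quot_repr q \in (J^C)%VS by apply: subvsP.
have J0 : projv J (quot_repr q) = 0.
  have := @daddv_pi_add _ _ J (J^C)%VS (quot_repr q).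
  rewrite capv_compl addv_complf memvf => /(_ erefl isT).
  rewrite (daddv_pi_id _ qC) 1?capvC ?capv_compl // -[RHS]add0r.
  by move/addIr.
by rewrite /quot_pi J0 subr0 /quot_repr vsvalK.
Qed.

Lemma quot_pi_eq0 h : (quot_pi h == 0) = (h \in J).
Proof.
apply/eqP/idP => [/(congr1 quot_repr)|hJ].
  rewrite /quot_repr /quot_pi vsprojK ?sub_projv_compl // linear0.
  by move/eqP; rewrite subr_eq0 => /eqP ->; apply: memv_proj.
by rewrite /quot_pi projv_id // subrr linear0.
Qed.

Lemma quot_reprP h : quot_repr (quot_pi h) - h \in J.
Proof.
by rewrite -quot_pi_eq0 (linD quot_pi_linear) -scaleN1r (linZ quot_pi_linear)
  quot_reprK scaleN1r subrr.
Qed.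

Lemma quot_ind (P : hopf_quot -> Prop) : (forall h, P (quot_pi h)) -> forall q, P q.
Proof. by move=> h q; rewrite -[q]quot_reprK. Qed.

Lemma quot_pi_eq h h' : h - h' \in J -> quot_pi h = quot_pi h'.
Proof.
rewrite -quot_pi_eq0 (linD quot_pi_linear) -scaleN1r (linZ quot_pi_linear).
by rewrite scaleN1r subr_eq0 => /eqP.
Qed.

Definition quot_mul (p q : hopf_quot) : hopf_quot :=
  quot_pi (quot_repr p * quot_repr q).
Definition quot_one : hopf_quot := quot_pi 1.

Fact quot_pi_mul a b : quot_mul (quot_pi a) (quot_pi b) = quot_pi (a * b).
Proof.
apply: quot_pi_eq; set a' := quot_repr _; set b' := quot_repr _.
have -> : a' * b' - a * b = (a' - a) * b' + a * (b' - b).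
  by rewrite mulrBl mulrBr addrA subrK.
by apply: memvD; [apply: ideal_mulr|apply: ideal_mull]; apply: quot_reprP.
Qed.

Fact quot_mulA : associative quot_mul.
Proof.
by elim/quot_ind => x; elim/quot_ind => y; elim/quot_ind => z; rewrite !quot_pi_mul mulrA.
Qed.
Fact quot_mul1l : left_id quot_one quot_mul.
Proof. by elim/quot_ind => x; rewrite quot_pi_mul mul1r. Qed.
Fact quot_mul1r : right_id quot_one quot_mul.
Proof. by elim/quot_ind => x; rewrite quot_pi_mul mulr1. Qed.
Fact quot_mulDl : left_distributive quot_mul +%R.
Proof.
elim/quot_ind => x; elim/quot_ind => y; elim/quot_ind => z.
by rewrite -(linD quot_pi_linear) !quot_pi_mul mulrDl (linD quot_pi_linear).
Qed.
Fact quot_mulDr : right_distributive quot_mul +%R.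
Proof.
elim/quot_ind => x; elim/quot_ind => y; elim/quot_ind => z.
by rewrite -(linD quot_pi_linear) !quot_pi_mul mulrDr (linD quot_pi_linear).
Qed.
Fact quot_one_neq0 : quot_one != 0.
Proof.
rewrite quot_pi_eq0; apply/negP => /(@ideal_counit _ _ I).
by rewrite counit_monoid.1 => /eqP; rewrite oner_eq0.
Qed.

HB.instance Definition _ := GRing.Zmodule_isNzRing.Build hopf_quot
  quot_mulA quot_mul1l quot_mul1r quot_mulDl quot_mulDr quot_one_neq0.

Lemma quot_piM : {morph quot_pi : x y / x * y}.
Proof. by move=> x y; rewrite -quot_pi_mul. Qed.

Fact quot_scalerAl a (p q : hopf_quot) : a *: (p * q) = (a *: p) * q.
Proof.
move: p q; elim/quot_ind => x; elim/quot_ind => y.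
by rewrite -quot_piM -!(linZ quot_pi_linear) -quot_piM scalerAl.
Qed.
Fact quot_scalerAr a (p q : hopf_quot) : a *: (p * q) = p * (a *: q).
Proof.
move: p q; elim/quot_ind => x; elim/quot_ind => y.
by rewrite -quot_piM -!(linZ quot_pi_linear) -quot_piM scalerAr.
Qed.

HB.instance Definition _ := GRing.Lmodule_isLalgebra.Build k hopf_quot quot_scalerAl.
HB.instance Definition _ := GRing.Lalgebra_isAlgebra.Build k hopf_quot quot_scalerAr.
HB.instance Definition _ := Algebra_isFalgebra.Build k hopf_quot.

Lemma quot_pi_monoid : monoid_morphism quot_pi.
Proof. by split=> // x y; rewrite quot_piM. Qed.

Definition quot_comul (q : hopf_quot) : ktensor hopf_quot hopf_quot :=
  tmap quot_pi quot_pi (comul (quot_repr q)).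
Definition quot_counit (q : hopf_quot) : k := counit (quot_repr q).
Definition quot_antipode (q : hopf_quot) : hopf_quot :=
  quot_pi (antipode (quot_repr q)).

Lemma eq_on_quot (V : lmodType k) (f : H -> V) h : linear f ->
  (forall x, x \in J -> f x = 0) -> f (quot_repr (quot_pi h)) = f h.
Proof.
move=> lf f0; apply/eqP; rewrite -subr_eq0 -scaleN1r -(linZ lf) -(linD lf).
by rewrite scaleN1r f0 // quot_reprP.
Qed.

Let pp_linear : linear (tmap quot_pi quot_pi).
Proof. exact: tmap_linear quot_pi_linear quot_pi_linear. Qed.

Fact quot_comul_pi h : quot_comul (quot_pi h) = tmap quot_pi quot_pi (comul h).
Proof.
apply: (@eq_on_quot _ (fun h => tmap quot_pi quot_pi (comul h))).
  exact: (lin_comp (@comul_linear k H) pp_linear).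
move=> x /ideal_comul [s [/allP sJ ->]].
rewrite (big_morph _ (linD pp_linear) (lin0 pp_linear)) big_seq big1 // => p /sJ.
rewrite tmap_tens; try exact: quot_pi_linear.
by case/orP; rewrite -quot_pi_eq0 => /eqP ->;
  rewrite ?(lin0 (proj1 (ktens_bilin _ _) _)) ?(lin0 (proj2 (ktens_bilin _ _) _)).
Qed.
Fact quot_counit_pi h : quot_counit (quot_pi h) = counit h.
Proof.
apply: (@eq_on_quot k^o (@counit k H)); first exact: counit_scalar.
exact: ideal_counit.
Qed.
Fact quot_antipode_pi h : quot_antipode (quot_pi h) = quot_pi (antipode h).
Proof.
apply: (@eq_on_quot _ (fun h => quot_pi (antipode h))).
  exact: (lin_comp (@antipode_linear k H) quot_pi_linear).
by move=> x xJ; apply/eqP; rewrite quot_pi_eq0; apply: ideal_antipode.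
Qed.

Fact quot_comul_linear : linear quot_comul.
Proof.
apply: (lin_comp _ pp_linear (f := comul \o quot_repr)).
exact: (lin_comp quot_repr_linear (@comul_linear k H)).
Qed.

Lemma tmap_monoid (A B A' B' : algType k) (f : A -> A') (g : B -> B') :
  linear f -> linear g -> monoid_morphism f -> monoid_morphism g ->
  monoid_morphism (tmap f g).
Proof.
move=> lf lg [f1 fM] [g1 gM]; split; first by rewrite tmap_tens // f1 g1.
have lt := tmap_linear lf lg => t u.
move: t; apply: ktensor_ind => [|t t' ht ht'|a b].
- by rewrite mul0r !(lin0 lt) mul0r.
- by rewrite mulrDl !(linD lt) ht ht' mulrDl.
move: u; apply: ktensor_ind => [|t t' ht ht'|a' b'].
- by rewrite mulr0 !(lin0 lt) mulr0.
- by rewrite mulrDr !(linD lt) ht ht' mulrDr.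
by rewrite ktensM !tmap_tens // ktensM fM gM.
Qed.

Fact quot_comul_monoid : monoid_morphism quot_comul.
Proof.
have [p1 pM] := tmap_monoid quot_pi_linear quot_pi_linear quot_pi_monoid quot_pi_monoid.
split; first by rewrite quot_comul_pi comul_monoid.1.
elim/quot_ind => x; elim/quot_ind => y.
by rewrite -quot_piM !quot_comul_pi comul_monoid.2 pM.
Qed.
Fact quot_counit_scalar : scalar quot_counit.
Proof. by move=> a x y; rewrite /quot_counit quot_repr_linear counit_scalar. Qed.
Fact quot_counit_monoid : monoid_morphism quot_counit.
Proof.
split; first by rewrite quot_counit_pi counit_monoid.1.
elim/quot_ind => x; elim/quot_ind => y.
by rewrite -quot_piM !quot_counit_pi counit_monoid.2.
Qed.
Fact quot_antipode_linear : linear quot_antipode.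
Proof.
apply: (lin_comp _ quot_pi_linear (f := antipode \o quot_repr)).
exact: (lin_comp quot_repr_linear (@antipode_linear k H)).
Qed.

Let id_lin (V : lmodType k) : linear (@id V). Proof. by []. Qed.

Lemma tmap_comp (M N M' N' M2 N2 : lmodType k) (f : M -> M') (g : N -> N')
  (f2 : M' -> M2) (g2 : N' -> N2) t :
  linear f -> linear g -> linear f2 -> linear g2 ->
  tmap f2 g2 (tmap f g t) = tmap (f2 \o f) (g2 \o g) t.
Proof.
move=> lf lg lf2 lg2.
apply: (ktensor_ext (f := tmap f2 g2 \o tmap f g)).
- exact: (lin_comp (tmap_linear lf lg) (tmap_linear lf2 lg2)).
- exact: tmap_linear (lin_comp lf lf2) (lin_comp lg lg2).
- move=> m n /=; rewrite !tmap_tens //; [exact: (lin_comp lf lf2)|exact: (lin_comp lg lg2)].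
Qed.

Lemma tmap_eq (M N M' N' : lmodType k) (f f' : M -> M') (g g' : N -> N') t :
  f =1 f' -> g =1 g' -> tmap f g t = tmap f' g' t.
Proof. by move=> ff gg; apply: klift_eq => m n; rewrite ff gg. Qed.

Lemma tassoc_tmap (M N P M' N' P' : lmodType k) (f : M -> M') (g : N -> N')
  (h : P -> P') t : linear f -> linear g -> linear h ->
  tassoc (tmap (tmap f g) h t) = tmap f (tmap g h) (tassoc t).
Proof.
move=> lf lg lh.
have lfg := tmap_linear lf lg; have lgh := tmap_linear lg lh.
have l1 := lin_comp (tmap_linear lfg lh) (@tassoc_linear k M' N' P').
have l2 := lin_comp (@tassoc_linear k M N P) (tmap_linear lf lgh).
apply: (ktensor_ext l1 l2) => u p /=.
have l0 : linear (fun u : ktensor M N => u \ox p) by exact: (ktens_bilin _ _).1.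
apply: (ktensor_ext (lin_comp l0 l1) (lin_comp l0 l2)) => m n /=.
by rewrite tassoc_tens !tmap_tens // tassoc_tens.
Qed.

Fact quot_comulA q :
  tassoc (tmap quot_comul id (quot_comul q)) = tmap id quot_comul (quot_comul q).
Proof.
have lq := quot_pi_linear; have lc := quot_comul_linear; have lch := @comul_linear k H.
elim/quot_ind: q => h; rewrite !quot_comul_pi !tmap_comp //.
transitivity (tassoc (tmap (tmap quot_pi quot_pi) quot_pi (tmap comul id (comul h)))).
  rewrite tmap_comp //; congr tassoc.
  by apply: tmap_eq => x //=; rewrite quot_comul_pi.
rewrite tassoc_tmap // comulA tmap_comp //.
by apply: tmap_eq => x //=; rewrite quot_comul_pi.
Qed.

Fact quot_counitL q : klift (fun x y => quot_counit x *: y) (quot_comul q) = q.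
Proof.
elim/quot_ind: q => h; rewrite quot_comul_pi klift_tmap; try exact: quot_pi_linear.
  rewrite -[in RHS](counitL h) lin_klift; last exact: quot_pi_linear.
    by apply: klift_eq => x y; rewrite quot_counit_pi (linZ quot_pi_linear).
  split=> [y|x] a u v; first by rewrite counit_scalar scalerDl scalerA.
  by rewrite scalerDr !scalerA mulrC.
split=> [y|x] a u v; first by rewrite quot_counit_scalar scalerDl scalerA.
by rewrite scalerDr !scalerA mulrC.
Qed.
Fact quot_counitR q : klift (fun x y => quot_counit y *: x) (quot_comul q) = q.
Proof.
elim/quot_ind: q => h; rewrite quot_comul_pi klift_tmap; try exact: quot_pi_linear.
  rewrite -[in RHS](counitR h) lin_klift; last exact: quot_pi_linear.
    by apply: klift_eq => x y; rewrite quot_counit_pi (linZ quot_pi_linear).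
  split=> [y|x] a u v; last by rewrite counit_scalar scalerDl scalerA.
  by rewrite scalerDr !scalerA mulrC.
split=> [y|x] a u v; last by rewrite quot_counit_scalar scalerDl scalerA.
by rewrite scalerDr !scalerA mulrC.
Qed.

Lemma mul_lin_bilin (A : algType k) (f g : A -> A) : linear f -> linear g ->
  bilin (fun x y => f x * g y).
Proof.
move=> lf lg; split=> [y|x] a u v; first by rewrite lf mulrDl scalerAl.
by rewrite lg mulrDr scalerAr.
Qed.

Fact quot_antipodeL q :
  klift (fun x y => quot_antipode x * y) (quot_comul q) = (quot_counit q)%:A.
Proof.
have lq := quot_pi_linear; have la := @antipode_linear k H.
have lqa := quot_antipode_linear.
elim/quot_ind: q => h; rewrite quot_comul_pi klift_tmap //; last exact: mul_lin_bilin.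
rewrite quot_counit_pi -[1]/(quot_pi 1) -(linZ lq) -antipodeL lin_klift //.
  by apply: klift_eq => x y; rewrite quot_antipode_pi quot_piM.
exact: (mul_lin_bilin la (@id_lin H)).
Qed.
Fact quot_antipodeR q :
  klift (fun x y => x * quot_antipode y) (quot_comul q) = (quot_counit q)%:A.
Proof.
have lq := quot_pi_linear; have la := @antipode_linear k H.
have lqa := quot_antipode_linear.
elim/quot_ind: q => h; rewrite quot_comul_pi klift_tmap //.
  rewrite quot_counit_pi -[1]/(quot_pi 1) -(linZ lq) -antipodeR lin_klift //.
    by apply: klift_eq => x y; rewrite quot_antipode_pi quot_piM.
  exact: (mul_lin_bilin (@id_lin H) la).
exact: (mul_lin_bilin (@id_lin hopf_quot) lqa).
Qed.

HB.instance Definition _ := isHopfAlgebra.Build k hopf_quot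
  quot_comul_linear quot_comul_monoid quot_counit_scalar quot_counit_monoid
  quot_antipode_linear quot_comulA quot_counitL quot_counitR
  quot_antipodeL quot_antipodeR.

Lemma quot_pi_hopf : hopf_morphism quot_pi.
Proof.
split; first exact: quot_pi_linear.
- exact: quot_pi_monoid.
- exact: quot_comul_pi.
- exact: quot_counit_pi.
- exact: quot_antipode_pi.
Qed.

End Quotient.

(* The group algebra kG: comul, counit and antipode are the linear extensions
   of g |-> g (x) g, g |-> 1 and g |-> g^-1. *)
Section GroupAlgebra.
Variables (k : fieldType) (gT : finGroupType).

Definition groupAlg : Type := {ffun gT -> k^o}.
HB.instance Definition _ := Vector.on groupAlg.

Definition galg_coef (f : groupAlg) (x : gT) : k := fun_of_fin f x.
Definition galg_in (x : gT) : groupAlg := [ffun y => (y == x)%:R].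

Definition galg_ext (V : lmodType k) (phi : gT -> V) (f : groupAlg) : V :=
  \sum_x galg_coef f x *: phi x.

Lemma galg_ext_linear (V : lmodType k) (phi : gT -> V) : linear (galg_ext phi).
Proof.
move=> a f g; rewrite /galg_ext scaler_sumr -big_split; apply: eq_bigr => x _.
by rewrite /galg_coef !ffunE scalerDl scalerA.
Qed.

Lemma galg_ext_in (V : lmodType k) (phi : gT -> V) x :
  galg_ext phi (galg_in x) = phi x.
Proof.
rewrite /galg_ext (bigD1 x) //= big1 => [|y /negbTE yx].
  by rewrite /galg_coef ffunE eqxx scale1r addr0.
by rewrite /galg_coef ffunE yx scale0r.
Qed.

Lemma galg_sum (f : groupAlg) : galg_ext galg_in f = f.
Proof.
apply/ffunP => y; rewrite /galg_ext sum_ffunE (bigD1 y) //= big1 => [|x /negbTE yx].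
  by rewrite !ffunE eqxx addr0 -[_ *: _]/(_ * _) mulr1.
by rewrite !ffunE eq_sym yx -[_ *: _]/(_ * _) mulr0.
Qed.

Lemma galg_extP (V : lmodType k) (F G : groupAlg -> V) :
  linear F -> linear G -> (forall x, F (galg_in x) = G (galg_in x)) -> F =1 G.
Proof.
move=> lF lG FG f; rewrite -(galg_sum f) /galg_ext.
rewrite (big_morph _ (linD lF) (lin0 lF)) (big_morph _ (linD lG) (lin0 lG)).
by apply: eq_bigr => x _; rewrite (linZ lF) (linZ lG) FG.
Qed.

Definition galg_mul (f g : groupAlg) : groupAlg :=
  galg_ext (fun x => galg_ext (fun y => galg_in (x * y)%g) g) f.
Definition galg_one : groupAlg := galg_in 1%g.

Fact galg_mul_linl g : linear (galg_mul^~ g).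
Proof. exact: galg_ext_linear. Qed.
Fact galg_mul_linr f : linear (galg_mul f).
Proof.
move=> a g h; rewrite /galg_mul {1 3 5}/galg_ext scaler_sumr -big_split.
apply: eq_bigr => x _ /=; rewrite galg_ext_linear.
by rewrite scalerDr !scalerA mulrC.
Qed.
Fact galg_mul_in x y : galg_mul (galg_in x) (galg_in y) = galg_in (x * y)%g.
Proof. by rewrite /galg_mul !galg_ext_in. Qed.

Fact galg_mulA : associative galg_mul.
Proof.
move=> f g h; pose ml := galg_mul_linl; pose mr := galg_mul_linr.
move: f; apply: galg_extP; [exact: ml|exact: (lin_comp (ml g) (ml h))|move=> x].
move: g; apply: galg_extP.
- exact: (lin_comp (ml h) (mr _)).
- exact: (lin_comp (mr _) (ml h)).
move=> y; move: h; apply: galg_extP.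
- exact: (lin_comp (mr _) (mr _)).
- exact: mr.
by move=> z; rewrite !galg_mul_in mulgA.
Qed.
Fact galg_mul1l : left_id galg_one galg_mul.
Proof.
apply: galg_extP => //; first exact: galg_mul_linr.
by move=> x; rewrite galg_mul_in mul1g.
Qed.
Fact galg_mul1r : right_id galg_one galg_mul.
Proof.
apply: galg_extP => //; first exact: galg_mul_linl.
by move=> x; rewrite galg_mul_in mulg1.
Qed.
Fact galg_mulDl : left_distributive galg_mul +%R.
Proof. by move=> f g h; rewrite (linD (galg_mul_linl h)). Qed.
Fact galg_mulDr : right_distributive galg_mul +%R.
Proof. by move=> f g h; rewrite (linD (galg_mul_linr f)). Qed.
Fact galg_one_neq0 : galg_one != 0.
Proof.
apply/eqP => /(congr1 (fun f : groupAlg => galg_coef f 1%g)).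
by rewrite /galg_coef !ffunE eqxx => /eqP; rewrite oner_eq0.
Qed.

HB.instance Definition _ := GRing.Zmodule_isNzRing.Build groupAlg
  galg_mulA galg_mul1l galg_mul1r galg_mulDl galg_mulDr galg_one_neq0.

Fact galg_scalerAl a (f g : groupAlg) : a *: (f * g) = (a *: f) * g.
Proof. by rewrite -[RHS]/(galg_mul (a *: f) g) (linZ (galg_mul_linl g)). Qed.
Fact galg_scalerAr a (f g : groupAlg) : a *: (f * g) = f * (a *: g).
Proof. by rewrite -[RHS]/(galg_mul f (a *: g)) (linZ (galg_mul_linr f)). Qed.

HB.instance Definition _ := GRing.Lmodule_isLalgebra.Build k groupAlg galg_scalerAl.
HB.instance Definition _ := GRing.Lalgebra_isAlgebra.Build k groupAlg galg_scalerAr.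
HB.instance Definition _ := Algebra_isFalgebra.Build k groupAlg.

Definition galg_comul : groupAlg -> ktensor groupAlg groupAlg :=
  galg_ext (fun x => galg_in x \ox galg_in x).
Definition galg_counit (f : groupAlg) : k := \sum_x galg_coef f x.
Definition galg_antipode : groupAlg -> groupAlg :=
  galg_ext (fun x => galg_in x^-1%g).

Lemma galg_inM x y : galg_in x * galg_in y = galg_in (x * y)%g.
Proof. exact: galg_mul_in. Qed.

Fact galg_counitE : galg_counit =1 galg_ext (fun _ => 1 : k^o).
Proof. by move=> f; apply: eq_bigr => x _; rewrite -[RHS]/(_ * _) mulr1. Qed.
Fact galg_counit_scalar : scalar galg_counit.
Proof. by move=> a f g; rewrite !galg_counitE galg_ext_linear. Qed.
Fact galg_counit_in x : galg_counit (galg_in x) = 1.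
Proof. by rewrite galg_counitE galg_ext_in. Qed.
Fact galg_comul_linear : linear galg_comul. Proof. exact: galg_ext_linear. Qed.
Fact galg_comul_in x : galg_comul (galg_in x) = galg_in x \ox galg_in x.
Proof. exact: galg_ext_in. Qed.
Fact galg_antipode_linear : linear galg_antipode. Proof. exact: galg_ext_linear. Qed.
Fact galg_antipode_in x : galg_antipode (galg_in x) = galg_in x^-1%g.
Proof. exact: galg_ext_in. Qed.

Let mull (A : algType k) (b : A) : linear ( *%R^~ b).
Proof. by move=> a x y; rewrite mulrDl scalerAl. Qed.

Fact galg_comul_monoid : monoid_morphism galg_comul.
Proof.
split; first exact: galg_comul_in.
move=> f g; move: f; apply: galg_extP.
- exact: (lin_comp (mull g) galg_comul_linear).
- exact: (lin_comp galg_comul_linear (@ktensor_mul_linl _ _ _ _)).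
move=> x; move: g; apply: galg_extP.
- exact: (lin_comp (mulr_lin _) galg_comul_linear).
- exact: (lin_comp galg_comul_linear (@ktensor_mul_linr _ _ _ _)).
by move=> y; rewrite galg_inM !galg_comul_in ktensM !galg_inM.
Qed.
Fact galg_counit_monoid : monoid_morphism galg_counit.
Proof.
split; first exact: galg_counit_in.
have lc : linear (galg_counit : groupAlg -> k^o) by exact: galg_counit_scalar.
move=> f g; move: f; apply: (@galg_extP k^o).
- exact: (lin_comp (mull g) lc).
- exact: (lin_comp lc (@mull k^o _)).
move=> x; move: g; apply: (@galg_extP k^o).
- exact: (lin_comp (mulr_lin _) lc).
- exact: (lin_comp lc (@mulr_lin k k^o _)).
by move=> y; rewrite galg_inM !galg_counit_in mulr1.
Qed.

Let id_lin (V : lmodType k) : linear (@id V). Proof. by []. Qed.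

Fact galg_comulA f :
  tassoc (tmap galg_comul id (galg_comul f)) = tmap id galg_comul (galg_comul f).
Proof.
have lc := galg_comul_linear; have li := @id_lin groupAlg.
move: f; apply: galg_extP.
- exact: (lin_comp lc (lin_comp (tmap_linear lc li) (@tassoc_linear _ _ _ _))).
- exact: (lin_comp lc (tmap_linear li lc)).
by move=> x; rewrite !galg_comul_in !tmap_tens // !galg_comul_in tassoc_tens.
Qed.

Let cl_bilin : bilin (fun x y : groupAlg => galg_counit x *: y).
Proof.
split=> [y|x] a u v; first by rewrite galg_counit_scalar scalerDl scalerA.
by rewrite scalerDr !scalerA mulrC.
Qed.
Let cr_bilin : bilin (fun x y : groupAlg => galg_counit y *: x).
Proof. by split=> [y|x]; [apply: cl_bilin.2|apply: cl_bilin.1]. Qed.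

Fact galg_counitL f : klift (fun x y => galg_counit x *: y) (galg_comul f) = f.
Proof.
move: f; apply: galg_extP => //.
  exact: (lin_comp galg_comul_linear (klift_linear cl_bilin)).
by move=> x; rewrite galg_comul_in klift_tens // galg_counit_in scale1r.
Qed.
Fact galg_counitR f : klift (fun x y => galg_counit y *: x) (galg_comul f) = f.
Proof.
move: f; apply: galg_extP => //.
  exact: (lin_comp galg_comul_linear (klift_linear cr_bilin)).
by move=> x; rewrite galg_comul_in klift_tens // galg_counit_in scale1r.
Qed.

Let ea_linear : linear (fun f => (galg_counit f)%:A : groupAlg).
Proof. by move=> a u v; rewrite galg_counit_scalar scalerDl scalerA. Qed.

Fact galg_antipodeL f :
  klift (fun x y => galg_antipode x * y) (galg_comul f) = (galg_counit f)%:A.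
Proof.
have bl : bilin (fun x y => galg_antipode x * y).
  exact: (mul_lin_bilin galg_antipode_linear (@id_lin groupAlg)).
move: f; apply: galg_extP => //.
  exact: (lin_comp galg_comul_linear (klift_linear bl)).
move=> x; rewrite galg_comul_in klift_tens // galg_counit_in scale1r.
by rewrite galg_antipode_in galg_inM mulVg.
Qed.
Fact galg_antipodeR f :
  klift (fun x y => x * galg_antipode y) (galg_comul f) = (galg_counit f)%:A.
Proof.
have bl : bilin (fun x y => x * galg_antipode y).
  exact: (mul_lin_bilin (@id_lin groupAlg) galg_antipode_linear).
move: f; apply: galg_extP => //.
  exact: (lin_comp galg_comul_linear (klift_linear bl)).
move=> x; rewrite galg_comul_in klift_tens // galg_counit_in scale1r.
by rewrite galg_antipode_in galg_inM mulgV.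
Qed.

HB.instance Definition _ := isHopfAlgebra.Build k groupAlg
  galg_comul_linear galg_comul_monoid galg_counit_scalar galg_counit_monoid
  galg_antipode_linear galg_comulA galg_counitL galg_counitR
  galg_antipodeL galg_antipodeR.

End GroupAlgebra.

Record module_algebra (k : fieldType) (H : hopfAlgType k) (A : algType k)
    (act : H -> A -> A) : Prop := ModuleAlgebra {
  act_linearl : forall a, linear (act^~ a);
  act_linearr : forall h, linear (act h);
  act_unit : forall a, act 1 a = a;
  act_comp : forall h h' a, act (h * h') a = act h (act h' a);
  act_mul : forall h a b,
    act h (a * b) = klift (fun h1 h2 => act h1 a * act h2 b) (comul h);
  act_one : forall h, act h 1 = (counit h)%:A
}.

Definition invariant (k : fieldType) (H : hopfAlgType k) (A : algType k)
    (act : H -> A -> A) (a : A) : Prop :=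
  forall h, act h a = counit h *: a.

Definition invariants (k : fieldType) (H : hopfAlgType k) (A : algType k)
    (act : H -> A -> A) : Type := {a : A | invariant act a}.

Section HopfGalois.
Variables (k : fieldType) (H : finHopfAlgType k) (A : algType k).
Variable (act : H -> A -> A).

(* A (x)_{A^H} A *)
Definition tensor_inv : Type :=
  @tensor (invariants act) A A (fun b s => b * sval s) (fun s b => sval s * b).
HB.instance Definition _ := GRing.Zmodule.on tensor_inv.

Definition dual_basis (i : 'I_(\dim {:H})) : dual H := 
  linfun (coord (vbasis {:H}) i : H -> k^o).

Definition coaction (a : A) : ktensor A (dual H) :=
  \sum_(i < \dim {:H}) act (vbasis {:H})`_i a \ox dual_basis i.

Definition can : tensor_inv -> ktensor A (dual H) :=
  lift (fun b b' => (b \ox 1) * coaction b').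

Definition hopf_galois : Prop := bijective can.

Hypothesis hact : module_algebra act.

Lemma act_invl h s a : invariant act s -> act h (s * a) = s * act h a.
Proof.
move=> hs; rewrite (act_mul hact) -[in RHS](counitL h).
rewrite (lin_klift (g := act^~ a)); last exact: act_linearl.
  rewrite (lin_klift (g := *%R s)); last exact: mulr_lin.
    apply: klift_eq => x y; rewrite hs (linZ (act_linearl hact a)).
    by rewrite -scalerAl scalerAr.
    have la := act_linearl hact a; split=> [y|x] u v w.
      by rewrite counit_scalar scalerDl -scalerA (linD la) (linZ la).
    by rewrite scalerDr scalerA mulrC -scalerA la.
split=> [y|x] u v w; first by rewrite counit_scalar scalerDl scalerA.
by rewrite scalerDr !scalerA mulrC.
Qed.

Lemma coaction_linear : linear coaction.
Proof.
move=> a x y; rewrite /coaction scaler_sumr -big_split; apply: eq_bigr => i _ /=.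
by rewrite (act_linearr hact) (ktens_bilin _ _).1.
Qed.

Lemma coaction_mull s a : invariant act s ->
  coaction (s * a) = (s \ox 1) * coaction a.
Proof.
move=> hs; rewrite /coaction mulr_sumr; apply: eq_bigr => i _.
by rewrite act_invl // ktensM mul1r.
Qed.

Lemma can_balanced :
  balanced (fun b (s : invariants act) => b * sval s) (fun s b => sval s * b)
           (fun b b' => (b \ox 1 : ktensor A (dual H)) * coaction b').
Proof.
split.
- by move=> b' x y; rewrite (ktensDl 1 x y) mulrDl.
- by move=> b x y; rewrite (linD coaction_linear) mulrDr.
- by move=> b [s hs] b' /=; rewrite coaction_mull // mulrA ktensM mulr1.
Qed.

Lemma can_tens b b' : can (tens b b') = (b \ox 1) * coaction b'.
Proof. exact: (lift_tens _ _ can_balanced). Qed.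

(* rho (a) does not depend on the basis: it is the tensor representing
   h |-> h . a. *)
Lemma coaction_eval h a :
  klift (fun (b : A) (f : dual H) => f h *: b) (coaction a) = act h a.
Proof.
have bl : bilin (fun (b : A) (f : dual H) => f h *: b).
  split=> [f|b] u v w; first by rewrite scalerDr !scalerA mulrC.
  by rewrite dualDE dualZE scalerDl scalerA.
have hl := klift_linear bl.
rewrite /coaction (big_morph _ (linD hl) (lin0 hl)).
rewrite [in RHS](coord_vbasis (memvf h)).
have al := act_linearl hact a.
rewrite (big_morph (act^~ a) (linD al) (lin0 al)); apply: eq_bigr => i _.
by rewrite klift_tens // (linZ al) /dual_eval lfunE.
Qed.

End HopfGalois.

Definition factors_through_group (k : fieldType) (H : finHopfAlgType k)
    (A : algType k) (act : H -> A -> A) : Prop :=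
  exists I : hopfIdeal H,
    (forall h a, h \in ideal_space I -> act h a = 0) /\
    exists (gT : finGroupType) (f : hopf_quot I -> groupAlg k gT),
      hopf_morphism f /\ bijective f.

(* The defining relations of the Weyl algebra, and its presentation: A is
   universal among the R-algebras with elements satisfying them. *)
Definition weyl_relations (R : comNzRingType) (n : nat) (B : algType R)
    (x y : 'I_n -> B) : Prop :=
  [/\ forall i j, x i * x j - x j * x i = 0,
      forall i j, y i * y j - y j * y i = 0 &
      forall i j, y i * x j - x j * y i = (i == j)%:R].

Record is_weyl_algebra (R : comNzRingType) (n : nat) (A : algType R)
    (x y : 'I_n -> A) : Prop := IsWeylAlgebra {
  weyl_rel : weyl_relations x y;
  weyl_ext : forall (B : algType R) (u v : 'I_n -> B), weyl_relations u v ->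
    exists f : {lrmorphism A -> B},
      (forall i, f (x i) = u i) /\ (forall i, f (y i) = v i);
  weyl_unique : forall (B : algType R) (f g : {lrmorphism A -> B}),
    (forall i, f (x i) = g (x i)) -> (forall i, f (y i) = g (y i)) -> f =1 g
}.

(* Main.v *)
(* By the Hopf-Galois property every linear form f on H is represented by pairs
   (a_s, b_s) with sum_s a_s (h . b_s) = f(h).  Together with left integrals of H
   this makes A finitely generated over A^H, and it turns the matrices
   (f(u_lj)), u_lj the matrix coefficients of H, into sums of a_s rho(b_s),
   where rho : A -> M_d(A) is the coaction.  This situation involves finitely
   many scalars, hence it descends to a finitely generated ring and specializes
   to a field F of large characteristic p.  Over F the p-th powers of
   polynomials are central, and the Weyl algebra has a skew field of fractions
   of dimension p^(2n) over the fractions of these powers.  The span of the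
   invariants is a subalgebra of p-power dimension and of index < p, hence it
   is everything: up to a central denominator each element is a combination
   of invariants with central coefficients, which forces the matrices (f(u_lj))
   to commute.  So H is cocommutative.  Over an algebraically closed field of
   characteristic zero the trace form on the dual of H is then nondegenerate,
   joint eigenvectors of its regular representation are grouplike elements, and
   these span H: H itself is a group algebra and I = 0 works. *)

Require Import Defs.
From HB Require Import structures.
From mathcomp Require Import all_fingroup.
From mathcomp Require Import all_boot all_algebra all_field.
From mathcomp Require Import bigenough boolp.
From mathcomp.multinomials Require Import ssrcomplements mpoly.

Set Implicit Arguments.
Unset Strict Implicit.
Unset Printing Implicit Defensive.

Import GRing.Theory BigEnough.
Local Open Scope ring_scope.

(** In characteristic zero the center of the Weyl algebra is reduced to the scalars, so no count of
    dimensions over the center is possible there; this forces the detour through characteristic [p].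
    The Hopf algebra itself takes no part in the detour. What specializes is [galois_datum]:
    finitely many equations in the Weyl algebra, where the inverse law and the generation over the
    invariants are required on the [x_i] and [y_i] only and are propagated to all elements after the
    specialization. The rank [r] and the integer [D] controlling the specialization are fixed before
    [p], so [p] can exceed both, and a nonzero entry of [M * N - N * M] is made to survive. The
    field of characteristic [p] is taken perfect: a scalar c has to be a p-th power for c X^m to be
    a p-th power times a monomial with exponents below [p], and this yields the dimension p^(2n). *)

Section LinearMaps.
Variable R : pzRingType.
Implicit Types U V W : lmodType R.
Lemma linear_addE V W (g : V -> W) : linear g -> {morph g : x y / x + y}.
Proof. by move=> gl x y; have := gl 1 x y; rewrite !scale1r. Qed.
Lemma linear_zeroE V W (g : V -> W) : linear g -> g 0 = 0.
Proof. by move=> gl; apply: (addrI (g 0)); rewrite -linear_addE // !addr0. Qed.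
Lemma linear_scaleE V W (g : V -> W) : linear g -> forall a, {morph g : x / a *: x}.
Proof. by move=> gl a x; have := gl a x 0; rewrite !addr0 linear_zeroE // addr0. Qed.
Lemma linear_compE U V W (f : U -> V) (g : V -> W) :
  linear f -> linear g -> linear (g \o f).
Proof. by move=> lf lg a x y /=; rewrite lf lg. Qed.
End LinearMaps.

Section LinearExtension.
Variables (R : comNzRingType) (N : nat) (V : lmodType R).
Variable phi : 'X_{1..N} -> V.

Definition mlin (f : {mpoly R[N]}) : V := \sum_(m <- msupp f) f@_m *: phi m.

Lemma mlinE f k : (msize f <= k)%N ->
  mlin f = \sum_(m : 'X_{1..N < k}) f@_m *: phi m.
Proof.
move=> le_fk; rewrite /mlin (big_mksub 'X_{1..N < k}) ?msupp_uniq //=; first last.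
  by move=> x /msize_mdeg_lt /leq_trans; apply.
by rewrite big_rmcond //= => j /memN_msupp_eq0 ->; rewrite scale0r.
Qed.

Lemma mlin_is_linear : linear mlin.
Proof.
move=> a f g; pose_big_enough k.
  rewrite !(mlinE (k := k)) // scaler_sumr -big_split; apply: eq_bigr => m _ /=.
  by rewrite mcoeffD mcoeffZ scalerDl scalerA.
by close.
Qed.
HB.instance Definition _ :=
  GRing.isLinear.Build R {mpoly R[N]} V _ mlin mlin_is_linear.

Lemma mlinX m : mlin 'X_[m] = phi m.
Proof. by rewrite /mlin msuppX big_seq1 mcoeffX eqxx scale1r. Qed.

End LinearExtension.

(** Only additivity is assumed, so that it also serves maps such as [weyl_eval], which are
    semilinear along a ring morphism. *)
Lemma mpoly_linP (R : comNzRingType) (N : nat) (V : nmodType) (F G : {mpoly R[N]} -> V) :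
  {morph F : f g / f + g} -> {morph G : f g / f + g} -> F 0 = 0 -> G 0 = 0 ->
  (forall c m, F (c *: 'X_[m]) = G (c *: 'X_[m])) -> F =1 G.
Proof.
move=> FD GD F0 G0 FG; apply: mpolyind => [|c m p _ _ IH]; first by rewrite F0 G0.
by rewrite FD GD FG IH.
Qed.

Lemma mpoly_linPZ (R : comNzRingType) (N : nat) (V : lmodType R) (F G : {mpoly R[N]} -> V) :
  linear F -> linear G -> (forall m, F 'X_[m] = G 'X_[m]) -> F =1 G.
Proof.
move=> lF lG FG; apply: mpoly_linP; try exact: linear_addE; try exact: linear_zeroE.
by move=> c m; rewrite (linear_scaleE lF) (linear_scaleE lG) FG.
Qed.

Lemma split_lshift m n (i : 'I_m) : split (lshift n i) = inl i.
Proof. by rewrite -[lshift n i]/(unsplit (inl i)) unsplitK. Qed.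
Lemma split_rshift m n (i : 'I_n) : split (rshift m i) = inr i.
Proof. by rewrite -[rshift m i]/(unsplit (inr i)) unsplitK. Qed.

(** * The Weyl algebra on normally ordered polynomials *)

Section Star.
Variables (R : comNzRingType) (n : nat).
Notation P := {mpoly R[n + n]}.
Implicit Types (f g h : P) (m : 'X_{1..n + n}) (i j : 'I_n).

(* The product of [y_i] with the normally ordered [g]: [y_i g = g y_i + dg/dx_i]. *)
Definition Yd i g : P := 'X_(rshift n i) * g + g^`M(lshift n i).

Lemma Yd_is_linear i : linear (Yd i).
Proof.
by move=> a f g; rewrite /Yd mulrDr linearP /= scalerDr addrACA scalerAr.
Qed.
HB.instance Definition _ i := GRing.isLinear.Build R P P _ (Yd i) (Yd_is_linear i).

Lemma mderiv_XU (N : nat) (k l : 'I_N) : ('X_l : {mpoly R[N]})^`M(k) = (l == k)%:R.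
Proof.
rewrite mderivX mnm1E; case: eqP => [->|_]; last by rewrite scale0r.
rewrite scale1r; suff -> : (U_(k) - U_(k))%MM = 0%MM :> 'X_{1..N} by rewrite mpolyX0.
by apply/mnmP => j; rewrite mnmBE subnn mnm0E.
Qed.

Lemma YdC i j g : Yd i (Yd j g) = Yd j (Yd i g).
Proof.
rewrite /Yd !mderivD !mderivM !mderiv_XU !eq_rlshift !mul0r !add0r.
rewrite !mulrDr (mderiv_comm (lshift n i)) mulrCA; do 2 rewrite -addrA.
by congr (_ + _); rewrite addrCA.
Qed.

(** Left multiplication by the [y]-part of [m]; the exponents of the [x_i] are ignored, and the
    order of the factors is immaterial by [YdC]. *)
Definition Yop m g : P :=
  foldr (fun i h => iter (m (rshift n i)) (Yd i) h) g (enum 'I_n).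

Lemma iter_YdC i j k g : iter k (Yd i) (Yd j g) = Yd j (iter k (Yd i) g).
Proof. by elim: k => //= k ->; rewrite YdC. Qed.

Lemma iter_Yd_linear i k : linear (iter k (Yd i)).
Proof. by elim: k => [|k IH] a f g //=; rewrite IH linearP. Qed.

Lemma Yop_is_linear m : linear (Yop m).
Proof.
rewrite /Yop; elim: (enum _) => [|i s IH] a f g //=.
by rewrite IH iter_Yd_linear.
Qed.
HB.instance Definition _ m := GRing.isLinear.Build R P P _ (Yop m) (Yop_is_linear m).

Lemma Yop_YdC m j g : Yop m (Yd j g) = Yd j (Yop m g).
Proof. by rewrite /Yop; elim: (enum _) => //= i s ->; rewrite iter_YdC. Qed.

Lemma YopS m i g : Yop (m + U_(rshift n i)) g = Yd i (Yop m g).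
Proof.
rewrite /Yop; have: i \in enum 'I_n by rewrite mem_enum.
elim: (enum _) (enum_uniq 'I_n) => //= j s IH /andP[js us].
rewrite inE mnmDE mnm1E eq_rshift; case: (eqVneq i j) => [e _ | ij /= /IH -> //].
  subst j; rewrite addn1 /=; congr (Yd i (iter _ _ _)).
  elim: s js {IH us} => //= l s IH; rewrite inE negb_or => /andP[il /IH ->].
  by rewrite mnmDE mnm1E eq_rshift (negbTE il) addn0.
by rewrite addn0 iter_YdC.
Qed.

Definition mleft m : 'X_{1..n + n} :=
  [multinom (if split k is inl _ then m k else 0%N) | k < n + n].
Definition mright m : 'X_{1..n + n} :=
  [multinom (if split k is inr _ then m k else 0%N) | k < n + n].

Lemma mleft_l m i : mleft m (lshift n i) = m (lshift n i).
Proof. by rewrite mnmE split_lshift. Qed.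
Lemma mleft_r m i : mleft m (rshift n i) = 0%N.
Proof. by rewrite mnmE split_rshift. Qed.
Lemma mright_l m i : mright m (lshift n i) = 0%N.
Proof. by rewrite mnmE split_lshift. Qed.
Lemma mright_r m i : mright m (rshift n i) = m (rshift n i).
Proof. by rewrite mnmE split_rshift. Qed.
Definition mLR := (mleft_l, mleft_r, mright_l, mright_r).

Lemma mnmLRP m m' : (forall i, m (lshift n i) = m' (lshift n i)) ->
  (forall i, m (rshift n i) = m' (rshift n i)) -> m = m'.
Proof.
move=> hl hr; apply/mnmP => k; rewrite -(splitK k).
by case: (split k) => i; [apply: hl|apply: hr].
Qed.

Lemma mleftright m : (mleft m + mright m)%MM = m.
Proof. by apply: mnmLRP => i; rewrite mnmDE !mLR ?addn0. Qed.

Lemma mleftD m m' : mleft (m + m') = (mleft m + mleft m')%MM.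
Proof. by apply: mnmLRP => i; rewrite !(mnmDE, mLR). Qed.
Lemma mleftUl i : mleft U_(lshift n i) = U_(lshift n i)%MM.
Proof. by apply: mnmLRP => j; rewrite ?mLR // mnm1E eq_lrshift. Qed.
Lemma mleftUr i : mleft U_(rshift n i) = 0%MM.
Proof. by apply: mnmLRP => j; rewrite ?mLR ?mnm0E // mnm1E eq_rlshift. Qed.

Lemma eq_Yop m m' g : (forall i, m (rshift n i) = m' (rshift n i)) -> Yop m g = Yop m' g.
Proof. by move=> h; rewrite /Yop; elim: (enum _) => //= i s ->; rewrite h. Qed.

Lemma Yop_left m i g : Yop (m + U_(lshift n i)) g = Yop m g.
Proof. by apply: eq_Yop => j; rewrite mnmDE mnm1E eq_lrshift addn0. Qed.

Lemma Yd_right m i : (forall j, m (lshift n j) = 0%N) ->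
  Yd i 'X_[m] = 'X_[m + U_(rshift n i)].
Proof.
by move=> ml; rewrite /Yd mderivX ml scale0r addr0 mulrC -mpolyXD.
Qed.

Lemma Yop1 m : Yop m 1 = 'X_[mright m].
Proof.
pose mr (s : seq 'I_n) := [multinom (if split k is inr i then (if i \in s then m k else 0%N)
   else 0%N) | k < n + n] : 'X_{1..n + n}.
have mrl s i : mr s (lshift n i) = 0%N by rewrite mnmE split_lshift.
have mrr s i : mr s (rshift n i) = if i \in s then m (rshift n i) else 0%N.
  by rewrite mnmE split_rshift.
have -> : mright m = mr (enum 'I_n).
  by apply: mnmLRP => i; rewrite !mLR ?mrl ?mrr ?mem_enum.
rewrite /Yop; elim: (enum _) (enum_uniq 'I_n) => [_|j s IH /= /andP[js us]].
  by rewrite /= -mpolyX0; congr 'X_[_]; apply: mnmLRP => i; rewrite mnm0E ?mrl ?mrr.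
rewrite IH //; have -> : mr (j :: s) = (mr s + U_(rshift n j) *+ m (rshift n j))%MM.
  apply: mnmLRP => i; rewrite mnmDE mulmnE mnm1E ?mrl ?eq_rlshift ?mul0n //.
  rewrite !mrr inE eq_rshift eq_sym; case: eqVneq => [<-|_] /=.
    by rewrite (negbTE js) mul1n.
  by rewrite mul0n addn0.
elim: (m _) => [|k IHk]; first by rewrite mulm0n addm0.
rewrite /= IHk Yd_right ?mulmSr ?addmA // => i.
by rewrite mnmDE mrl mulmnE mnm1E eq_rlshift.
Qed.

(** Left multiplication by a normally ordered monomial x^a y^b is x^a times the operator [Yop].
    Defining the product by operators avoids the closed formula with binomial coefficients. *)
Definition star f g : P := mlin (fun m => 'X_[mleft m] * Yop m g) f.

Lemma star_linl g : linear (star^~ g). Proof. exact: mlin_is_linear. Qed.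
Lemma star_linr f : linear (star f).
Proof.
move=> a g h; rewrite /star /mlin scaler_sumr -big_split; apply: eq_bigr => m _ /=.
by rewrite linearP mulrDr scalerDr -!scalerAr !scalerA mulrC.
Qed.

Lemma starX m g : star 'X_[m] g = 'X_[mleft m] * Yop m g.
Proof. exact: mlinX. Qed.

Lemma mul_linl f : linear (fun g : P => f * g).
Proof. by move=> a g h; rewrite mulrDr scalerAr. Qed.

Lemma star_Xl i f g : star ('X_(lshift n i) * f) g = 'X_(lshift n i) * star f g.
Proof.
move: f; apply: mpoly_linPZ => [||m].
- exact: (linear_compE (mul_linl _) (star_linl g)).
- exact: (linear_compE (star_linl g) (mul_linl _)).
rewrite -mpolyXD addmC !starX mleftD mleftUl Yop_left.
by rewrite mpolyXD mulrAC mulrC.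
Qed.

(** Left multiplication by [y_i] commutes with right multiplication by [g]; with [star_Xl] this is
    associativity on generators, from which [starA] follows. *)
Lemma star_Yd i f g : star (Yd i f) g = Yd i (star f g).
Proof.
move: f; apply: mpoly_linPZ => [||m].
- exact: (linear_compE (Yd_is_linear i) (star_linl g)).
- exact: (linear_compE (star_linl g) (Yd_is_linear i)).
rewrite /Yd mderivX (linear_addE (star_linl g)) -mpolyXD addmC (linear_scaleE (star_linl g)) !starX.
rewrite mderivM YopS mleftD mleftUr addm0 mderivX mleft_l.
have -> : mleft (m - U_(lshift n i)) = (mleft m - U_(lshift n i))%MM.
  by apply: mnmLRP => j; rewrite !(mnmBE, mLR) // mnm1E.
have -> : Yop (m - U_(lshift n i)) g = Yop m g.
  by apply: eq_Yop => j; rewrite mnmBE mnm1E eq_lrshift subn0.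
by rewrite /Yd mulrDr -scalerAl mulrCA -addrA [_ *: _ + _]addrC.
Qed.

Lemma star_Yop m f g : star (Yop m f) g = Yop m (star f g).
Proof.
rewrite /Yop; elim: (enum _) => //= i s <-.
by elim: (m _) => //= k IH; rewrite star_Yd IH.
Qed.

Lemma star_mleft m f g : star ('X_[mleft m] * f) g = 'X_[mleft m] * star f g.
Proof.
pose s := iota 0 (n + n).
have Xl k (f' : P) : star ('X_k ^+ (mleft m k) * f') g = 'X_k ^+ (mleft m k) * star f' g.
  rewrite -(splitK k); case: (split k) => i /=; last by rewrite mleft_r !expr0 !mul1r.
  elim: (mleft m _) => [|e IH]; first by rewrite !mul1r.
  by rewrite !exprS -!mulrA star_Xl IH.
rewrite mpolyXE_id; elim/big_rec: _ f => [|k q _ IH] f; first by rewrite !mul1r.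
by rewrite -!mulrA Xl IH.
Qed.

Lemma starA : associative star.
Proof.
move=> f g h; move: f; apply: mpoly_linPZ => [||m].
- exact: star_linl.
- exact: (linear_compE (star_linl g) (star_linl h)).
by rewrite !starX star_mleft star_Yop.
Qed.

Lemma Yop0 g : Yop 0 g = g.
Proof. by rewrite /Yop; elim: (enum _) => //= i s ->; rewrite mnm0E. Qed.

Lemma star1l : left_id 1 star.
Proof.
move=> g; rewrite -mpolyX0 starX Yop0.
have -> : mleft 0 = 0%MM by apply: mnmLRP => i; rewrite !mLR mnm0E.
by rewrite mpolyX0 mul1r.
Qed.
Lemma star1r : right_id 1 star.
Proof.
apply: mpoly_linPZ => [||m]; [exact: star_linl|by []|].
by rewrite starX Yop1 -mpolyXD mleftright.
Qed.

End Star.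

(* The first [n] variables are the [x_i], the last [n] the [y_i]. *)
Definition weyl (R : comNzRingType) (n : nat) : Type := {mpoly R[n + n]}.

Section WeylAlgebra.
Variables (R : comNzRingType) (n : nat).
HB.instance Definition _ := GRing.Lmodule.on (weyl R n).

Definition weyl_mul (f g : weyl R n) : weyl R n := star f g.
Definition weyl_one : weyl R n := (1 : {mpoly R[n + n]}).
Fact weyl_mulDl : left_distributive weyl_mul +%R.
Proof. by move=> f g h; exact: (linear_addE (star_linl h)). Qed.
Fact weyl_mulDr : right_distributive weyl_mul +%R.
Proof. by move=> f g h; exact: (linear_addE (star_linr f)). Qed.
Fact weyl_one_neq0 : weyl_one != 0.
Proof. exact: oner_neq0. Qed.

HB.instance Definition _ := GRing.Zmodule_isNzRing.Build (weyl R n)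
  (@starA R n) (@star1l R n) (@star1r R n) weyl_mulDl weyl_mulDr weyl_one_neq0.
Fact weyl_scalerAl a (f g : weyl R n) : a *: weyl_mul f g = weyl_mul (a *: f) g.
Proof. exact: esym (linear_scaleE (star_linl g) a f). Qed.
Fact weyl_scalerAr a (f g : weyl R n) : a *: weyl_mul f g = weyl_mul f (a *: g).
Proof. exact: esym (linear_scaleE (star_linr f) a g). Qed.
HB.instance Definition _ := GRing.Lmodule_isLalgebra.Build R (weyl R n) weyl_scalerAl.
HB.instance Definition _ := GRing.Lalgebra_isAlgebra.Build R (weyl R n) weyl_scalerAr.

Definition wx (i : 'I_n) : weyl R n := 'X_(lshift n i).
Definition wy (i : 'I_n) : weyl R n := 'X_(rshift n i).

End WeylAlgebra.

Section WeylTheory.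
Variables (R : comNzRingType) (n : nat).
Notation W := (weyl R n).
Implicit Types (f g : W) (i j : 'I_n).

Lemma wxE i f : wx R i * f = ('X_(lshift n i) * f : {mpoly R[n + n]}).
Proof.
have e : wx R i = ('X_(lshift n i) * 1 : {mpoly R[n + n]}) by rewrite mulr1.
by rewrite -[LHS]/(star (wx R i) f) e star_Xl star1l.
Qed.

Lemma wyE i f : wy R i * f = Yd i f.
Proof.
have -> : wy R i = Yd i (1 : {mpoly R[n + n]}).
  by rewrite /Yd mulr1 -mpolyC1 mderivC addr0.
by rewrite -[LHS]/(star (Yd i 1) f) star_Yd star1l.
Qed.

(** A monomial arises from 1 by applying the [y_i] and then the [x_i] on the left, so left
    multiplications by generators suffice. *)
Lemma weyl_ind (Q : W -> Prop) : Q 1 -> (forall f g, Q f -> Q g -> Q (f + g)) ->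
  (forall c f, Q f -> Q (c *: f)) -> (forall i f, Q f -> Q (wx R i * f)) ->
  (forall i f, Q f -> Q (wy R i * f)) -> forall f, Q f.
Proof.
move=> Q1 QD QZ Qx Qy; apply: mpolyind => [|c m p _ _ Qp].
  by rewrite -[0](@scale0r _ W 1); apply: QZ.
apply: (QD) Qp; apply: QZ; rewrite -[X in Q X]star1r starX.
have: Q (Yop m 1).
  rewrite /Yop; elim: (enum _) => //= i s IH.
  by elim: (m _) => //= k IHk; rewrite -wyE; apply: Qy.
move: (Yop m 1) => g Qg; rewrite mpolyXE_id big_split_ord /=.
rewrite [X in _ * X * _]big1 ?mulr1 => [|i _]; last by rewrite mleft_r expr0.
elim/big_rec: _ => [|i p' _]; first by rewrite mul1r.
elim: (mleft m _) => [|k IHk] Qp'; first by rewrite mul1r.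
rewrite exprS -!mulrA -wxE; apply: (Qx); rewrite mulrA; exact: IHk.
Qed.

End WeylTheory.

(** * Evaluation of the Weyl algebra in noncommutative rings *)

Definition weyl_rels (T : pzRingType) n (u v : 'I_n -> T) : Prop :=
  [/\ forall i j, u i * u j = u j * u i, forall i j, v i * v j = v j * v i &
      forall i j, v i * u j = u j * v i + (i == j)%:R].

Section Eval.
Variables (R : comNzRingType) (n : nat) (T : nzRingType) (gam : {rmorphism R -> T}).
Hypothesis gamC : forall r t, gam r * t = t * gam r.
Variables u v : 'I_n -> T.
Hypothesis uv : weyl_rels u v.

Lemma prod_incr (w : 'I_n -> T) (a : 'I_n -> nat) j : (forall i l, w i * w l = w l * w i) ->
  \prod_i w i ^+ (a i + (j == i)) = w j * \prod_i w i ^+ a i.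
Proof.
move=> wC; rewrite /index_enum -enumT; have: j \in enum 'I_n by rewrite mem_enum.
elim: (enum _) (enum_uniq 'I_n) => //= i s IH /andP[js us].
rewrite inE !big_cons; case: (eqVneq j i) => [e _|ij /= /IH -> //].
  subst i; rewrite addn1 exprS -mulrA; congr (_ * (_ * _)).
  apply: eq_big_seq => l ls; case: eqP => [e|]; last by rewrite addn0.
  by rewrite e ls in js.
by rewrite addn0 !mulrA; congr (_ * _); apply/esym/commrX/wC.
Qed.

Lemma comm_v_uX i j k : v i * u j ^+ k = u j ^+ k * v i + (u j ^+ k.-1) *+ (k * (i == j)).
Proof.
case: uv => uu _ vu; elim: k => [|k IH]; first by rewrite mulr1 mul1r mul0n addr0.
rewrite exprS mulrA vu mulrDl -[u j * v i * _]mulrA IH mulrDr mulrA -addrA; congr (_ + _).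
case: eqP => _ /=; last by rewrite !muln0 !mulr0n mulr0 mul0r addr0.
rewrite !muln1 mul1r mulrnAr; case: k {IH} => [|k] /=; first by rewrite mulr0n add0r.
by rewrite -exprS addrC -mulrS.
Qed.

Lemma comm_v_prod i (a : 'I_n -> nat) :
  v i * \prod_j u j ^+ a j =
  (\prod_j u j ^+ a j) * v i + (\prod_j u j ^+ (a j - (i == j))) *+ a i.
Proof.
rewrite /index_enum -enumT.
have -> : a i = (a i * (i \in enum 'I_n))%N by rewrite mem_enum muln1.
elim: (enum _) (enum_uniq 'I_n) => [_|j s IH /= /andP[js us]].
  by rewrite !big_nil mul1r mulr1 muln0 addr0.
rewrite !big_cons mulrA comm_v_uX mulrDl -mulrA IH // mulrDr mulrA -addrA.
congr (_ + _); rewrite inE; case: (eqVneq i j) => [e|ij] /=; last first.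
  by rewrite muln0 mul0r addr0 subn0 mulrnAr.
subst j; rewrite (negbTE js) muln0 mulr0 add0r !muln1 subn1 mulrnAl.
congr (_ * _ *+ _); apply: eq_big_seq => l ls.
by case: eqP => [e|]; [rewrite e ls in js|rewrite subn0].
Qed.

Let h (k : 'I_(n + n)) : T := match split k with inl i => u i | inr i => v i end.
(** [mmap] forms ordered products, and the indices of the [x_i] precede those of the [y_i]:
    evaluation respects the normal order, hence the Weyl product, although [T] is not
    commutative. *)
Definition weyl_eval (f : weyl R n) : T := mmap gam h f.

Lemma mmap1_split m : mmap1 h m =
  (\prod_i u i ^+ m (lshift n i)) * \prod_i v i ^+ m (rshift n i).
Proof.
rewrite /mmap1 big_split_ord; congr (_ * _); apply: eq_bigr => i _.
  by rewrite /h split_lshift.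
by rewrite /h split_rshift.
Qed.

Lemma weyl_evalZ c f : weyl_eval (c *: f) = gam c * weyl_eval f.
Proof. exact: mmapZ. Qed.
Lemma weyl_evalD f g : weyl_eval (f + g) = weyl_eval f + weyl_eval g.
Proof. exact: mmapD. Qed.

Lemma weyl_eval_xM i f : weyl_eval (wx R i * f) = u i * weyl_eval f.
Proof.
rewrite wxE; move: f; apply: mpoly_linP => [f g|f g|||c m].
- by rewrite mulrDr weyl_evalD.
- by rewrite weyl_evalD mulrDr.
- by rewrite mulr0 /weyl_eval mmap0.
- by rewrite /weyl_eval mmap0 mulr0.
rewrite -scalerAr [LHS]weyl_evalZ [weyl_eval (c *: 'X_[m])]weyl_evalZ mulrA -gamC -mulrA.
congr (_ * _); rewrite -mpolyXD addmC /weyl_eval !mmapX !mmap1_split mulrA.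
case: uv => uu _ _; rewrite -prod_incr //; congr (_ * _); apply: eq_bigr => j _.
  by rewrite mnmDE mnm1E eq_lshift.
by rewrite mnmDE mnm1E eq_lrshift addn0.
Qed.

Lemma weyl_eval_yM i f : weyl_eval (wy R i * f) = v i * weyl_eval f.
Proof.
rewrite wyE; move: f; apply: mpoly_linP => [f g|f g|||c m].
- by rewrite linearD weyl_evalD.
- by rewrite weyl_evalD mulrDr.
- by rewrite linear0 /weyl_eval mmap0.
- by rewrite /weyl_eval mmap0 mulr0.
rewrite (linear_scaleE (Yd_is_linear i)) [LHS]weyl_evalZ [weyl_eval (c *: 'X_[m])]weyl_evalZ mulrA -gamC -mulrA.
congr (_ * _); rewrite /Yd /=. rewrite mderivX -mpolyXD addmC weyl_evalD weyl_evalZ.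
rewrite /weyl_eval !mmapX !mmap1_split [RHS]mulrA comm_v_prod mulrDl.
rewrite -[X in _ = X + _]mulrA.
case: uv => _ vv _; rewrite -prod_incr //; congr (_ * _ + _).
- by apply: eq_bigr => j _; rewrite mnmDE mnm1E eq_rlshift addn0.
- by apply: eq_bigr => j _; rewrite mnmDE mnm1E eq_rshift.
rewrite rmorph_nat mulr_natl mulrnAl; congr (_ * _ *+ _); apply: eq_bigr => j _.
  by rewrite mnmBE mnm1E eq_lshift.
by rewrite mnmBE mnm1E eq_lrshift subn0.
Qed.

Lemma weyl_eval1 : weyl_eval 1 = 1.
Proof. by rewrite /weyl_eval -[1]/(1 : {mpoly R[n + n]}) -mpolyX0 mmapX mmap11. Qed.

Lemma weyl_evalM f g : weyl_eval (f * g) = weyl_eval f * weyl_eval g.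
Proof.
move: f; apply: weyl_ind => [|f f' IH IH'|c f IH|i f IH|i f IH].
- by rewrite mul1r weyl_eval1 mul1r.
- by rewrite mulrDl !weyl_evalD IH IH' mulrDl.
- by rewrite -scalerAl !weyl_evalZ IH mulrA.
- by rewrite -mulrA !weyl_eval_xM IH mulrA.
- by rewrite -mulrA !weyl_eval_yM IH mulrA.
Qed.

Lemma weyl_morphism : exists phi : {rmorphism weyl R n -> T},
  [/\ forall i, phi (wx R i) = u i, forall i, phi (wy R i) = v i &
      forall c, phi c%:A = gam c].
Proof.
pose phi : {rmorphism weyl R n -> T} := HB.pack weyl_eval
  (GRing.isZmodMorphism.Build (weyl R n) T weyl_eval (mmap_is_additive h gam))
  (GRing.isMonoidMorphism.Build (weyl R n) T weyl_eval (conj weyl_eval1 weyl_evalM)).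
exists phi; split=> [i|i|c].
- rewrite -[LHS]/(weyl_eval (wx R i)) -(mulr1 (wx R i)).
  by rewrite weyl_eval_xM weyl_eval1 mulr1.
- rewrite -[LHS]/(weyl_eval (wy R i)) -(mulr1 (wy R i)).
  by rewrite weyl_eval_yM weyl_eval1 mulr1.
- rewrite -[LHS]/(weyl_eval c%:A).
  by rewrite weyl_evalZ weyl_eval1 mulr1.
Qed.

End Eval.

Lemma eq_weyl_morphism (R : comNzRingType) n (T : nzRingType)
  (phi psi : {rmorphism weyl R n -> T}) :
  (forall i, phi (wx R i) = psi (wx R i)) -> (forall i, phi (wy R i) = psi (wy R i)) ->
  (forall c, phi c%:A = psi c%:A) -> phi =1 psi.
Proof.
move=> hx hy hc; apply: weyl_ind => [|f g IH IH'|c f IH|i f IH|i f IH].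
- by rewrite !rmorph1.
- by rewrite !rmorphD IH IH'.
- by rewrite -mulr_algl !rmorphM hc IH.
- by rewrite !rmorphM hx IH.
- by rewrite !rmorphM hy IH.
Qed.

Lemma weyl_rels_gen (R : comNzRingType) n : weyl_rels (@wx R n) (@wy R n).
Proof.
split=> [i j|i j|i j].
- by rewrite !wxE mulrC.
- by rewrite -[RHS]mulr1 -[LHS]mulr1 -!mulrA !wyE YdC.
- rewrite wyE wxE /Yd mderiv_XU mulrC; congr (_ + _).
  by rewrite eq_lshift eq_sym.
Qed.

(** * Change of scalars *)

Lemma map_mderiv (R S : comNzRingType) N (phi : {rmorphism R -> S}) k (f : {mpoly R[N]}) :
  map_mpoly phi f^`M(k) = (map_mpoly phi f)^`M(k).
Proof.
by apply/mpolyP => m; rewrite mcoeff_map_mpoly !mcoeff_deriv mcoeff_map_mpoly raddfMn.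
Qed.

Section WeylMap.
Variables (R S : comNzRingType) (n : nat) (phi : {rmorphism R -> S}).

Definition weyl_map (f : weyl R n) : weyl S n := map_mpoly phi f.

Lemma weyl_mapZ c f : weyl_map (c *: f) = phi c *: weyl_map f.
Proof. by rewrite /weyl_map [LHS]map_mpolyZ. Qed.
Lemma weyl_map_is_additive : zmod_morphism weyl_map.
Proof. exact: map_mpoly_is_additive. Qed.
Lemma weyl_mapD f g : weyl_map (f + g) = weyl_map f + weyl_map g.
Proof. exact: (raddfD (map_mpoly phi : {additive {mpoly R[n + n]} -> {mpoly S[n + n]}})). Qed.
Lemma weyl_map1 : weyl_map 1 = 1.
Proof. exact: (rmorph1 (map_mpoly phi : {rmorphism {mpoly R[n + n]} -> {mpoly S[n + n]}})). Qed.
Lemma weyl_map_x i : weyl_map (wx R i) = wx S i.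
Proof. exact: map_mpolyX. Qed.
Lemma weyl_map_y i : weyl_map (wy R i) = wy S i.
Proof. exact: map_mpolyX. Qed.

HB.instance Definition _ := GRing.isZmodMorphism.Build (weyl R n) (weyl S n) weyl_map
  weyl_map_is_additive.

Lemma weyl_mapM f g : weyl_map (f * g) = weyl_map f * weyl_map g.
Proof.
move: f; apply: weyl_ind => [|f f' IH IH'|c f IH|i f IH|i f IH].
- by rewrite mul1r weyl_map1 mul1r.
- by rewrite mulrDl !weyl_mapD IH IH' mulrDl.
- by rewrite -scalerAl !weyl_mapZ IH scalerAl.
- have xM p : weyl_map (wx R i * p) = wx S i * weyl_map p.
    by rewrite !wxE /weyl_map rmorphM /= map_mpolyX.
  by rewrite -mulrA !xM IH mulrA.
- have yM p : weyl_map (wy R i * p) = wy S i * weyl_map p.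
    by rewrite !wyE /weyl_map /Yd raddfD /= rmorphM /= map_mpolyX map_mderiv.
  by rewrite -mulrA !yM IH mulrA.
Qed.

HB.instance Definition _ := GRing.isMonoidMorphism.Build (weyl R n) (weyl S n) weyl_map
  (conj weyl_map1 weyl_mapM).

Lemma weyl_map_alg c : weyl_map c%:A = (phi c)%:A.
Proof. by rewrite weyl_mapZ rmorph1. Qed.

Lemma weyl_map_inj : injective phi -> injective weyl_map.
Proof.
move=> phi_inj f g /(congr1 (fun f : weyl S n => f : {mpoly S[n + n]})) fg.
apply/mpolyP => m; apply: phi_inj; rewrite -!mcoeff_map_mpoly.
by congr (mcoeff m _).
Qed.

Lemma weyl_map_lift (g : weyl S n) :
  (forall m, mcoeff m g != 0 -> exists r, phi r = mcoeff m g) -> exists f, weyl_map f = g.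
Proof.
move=> hg; suff: exists f, weyl_map f = \sum_(m <- msupp g) (mcoeff m g *: 'X_[m] : weyl S n).
  by move=> [f ef]; exists f; rewrite ef; exact: esym (mpolyE g).
have: forall m, m \in msupp g -> mcoeff m g != 0 by move=> m; rewrite mcoeff_msupp.
elim: (msupp g) => [|m s IH] hs; first by exists 0; rewrite big_nil raddf0.
have [|f ef] := IH; first by move=> m' m's; apply: hs; rewrite inE m's orbT.
have [r er] := hg _ (hs _ (mem_head _ _)).
exists (r *: ('X_[m] : {mpoly R[n + n]}) + f).
rewrite big_cons weyl_mapD -ef; congr (_ + _).
by rewrite weyl_mapZ er; congr (_ *: _); exact: map_mpolyX.
Qed.

End WeylMap.

(** * Degree filtration: over a domain the Weyl algebra has no zero divisors *)

Lemma mnm_ind N (Q : 'X_{1..N} -> Prop) :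
  Q 0%MM -> (forall m i, Q m -> Q (m + U_(i))%MM) -> forall m, Q m.
Proof.
move=> Q0 QS m; have [k] := ubnP (mdeg m); elim: k m => // k IH m lt_mk.
case: (eqVneq m 0%MM) => [-> //|].
rewrite -mdeg_eq0 mdegE sum_nat_eq0 => /forallPn[i /= mi].
have e : m = (m - U_(i) + U_(i))%MM by rewrite submK // lep1mP.
rewrite e; apply/QS/IH; move: lt_mk; rewrite {1}e mdegD mdeg1 addn1.
by rewrite ltnS.
Qed.

Lemma msize_leP (R : comNzRingType) N (f : {mpoly R[N]}) k :
  reflect (forall m, (k <= mdeg m)%N -> mcoeff m f = 0) (msize f <= k)%N.
Proof.
apply: (iffP idP) => [fk m km|h].
  by apply/memN_msupp_eq0/msize_mdeg_ge/(leq_trans fk).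
case: (eqVneq f 0) => [->|f0]; first by rewrite msize0.
rewrite leqNgt; apply/negP; rewrite -mlead_deg // ltnS => /h/eqP.
by rewrite mleadc_eq0 (negbTE f0).
Qed.

Lemma msize_mderiv (R : comNzRingType) N i (f : {mpoly R[N]}) k :
  (msize f <= k)%N -> (msize f^`M(i) <= k.-1)%N.
Proof.
move=> /msize_leP fk; apply/msize_leP => m km; rewrite mcoeff_deriv fk ?mul0rn //.
by rewrite mdegD mdeg1 addn1; case: k km {fk}.
Qed.

Section Domain.
Variables (F : idomainType) (n : nat).
Notation P := {mpoly F[n + n]}.
Implicit Types (f g : P).

Lemma msizeM_bound f g : (msize (f * g) <= (msize f + msize g).-1)%N.
Proof.
case: (eqVneq f 0) => [->|f0]; first by rewrite mul0r msize0.
case: (eqVneq g 0) => [->|g0]; first by rewrite mulr0 msize0.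
by rewrite msizeM.
Qed.

Lemma star_Xr i f g : star ('X_(rshift n i) * f) g = star f (Yd i g).
Proof.
move: f; apply: mpoly_linPZ => [||m].
- exact: (linear_compE (mul_linl _) (star_linl g)).
- exact: star_linl.
by rewrite -mpolyXD addmC !starX mleftD mleftUr addm0 YopS Yop_YdC.
Qed.

(** Moving a [y_j] past [g] adds a derivative, of lower degree; [star] and the commutative product
    therefore agree in top degree. Variables are peeled off the monomial: an [x_j] is pulled out on
    the left, a [y_j] is absorbed into [g] by [star_Xr]. *)
Lemma starX_low m g k : (msize g <= k)%N ->
  (msize (star 'X_[m] g - 'X_[m] * g) <= (mdeg m + k).-1)%N.
Proof.
case: k => [|k]; first by rewrite leqn0 msize_poly_eq0 => /eqP ->;
  rewrite linear_zeroE ?mulr0 ?subr0 ?msize0 //; exact: star_linr.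
elim/mnm_ind: m g k => [|m i IH] g k gk.
  by rewrite mpolyX0 star1l mul1r subrr msize0.
rewrite mpolyXD ['X_[m] * _]mulrC mdegD mdeg1 -(splitK i).
case: (split i) => j /=; rewrite -!mulrA addnAC addn1 /=.
  rewrite star_Xl -mulrBr; apply: (leq_trans (msizeM_bound _ _)).
  by rewrite msizeX mdeg1 /= addnS ltnS (leq_trans (IH _ _ gk)) // addnS.
rewrite star_Xr.
have -> : star 'X_[m] (Yd j g) - 'X_(rshift n j) * ('X_[m] * g) =
   (star 'X_[m] (Yd j g) - 'X_[m] * Yd j g) + 'X_[m] * g^`M(lshift n j).
  by rewrite /Yd mulrDr opprD -!addrA addNr addr0 mulrCA.
apply: (leq_trans (msizeD_le _ _)); rewrite geq_max; apply/andP; split.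
  have : (msize (Yd j g) <= k.+2)%N.
    apply: (leq_trans (msizeD_le _ _)); rewrite geq_max; apply/andP; split.
      by apply: (leq_trans (msizeM_bound _ _)); rewrite msizeX mdeg1.
    by apply: (leq_trans (msize_mderiv _ gk)); rewrite /= ltnW.
  by move/IH; rewrite addnS.
apply: (leq_trans (msizeM_bound _ _)); rewrite msizeX addSn /=.
rewrite addnS; apply: (@leq_trans (mdeg m + k)) => //.
by rewrite leq_add2l (msize_mderiv _ gk).
Qed.

Lemma star_low f g : g != 0 ->
  (msize (star f g - f * g) <= (mdeg (mlead f) + mdeg (mlead g)))%N.
Proof.
move=> g0; have gE := mlead_deg g0.
have -> : star f g - f * g = \sum_(m <- msupp f) f@_m *: (star 'X_[m] g - 'X_[m] * g).
  have -> : star f g = \sum_(m <- msupp f) f@_m *: star 'X_[m] g.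
    by rewrite {1}/star {1}/mlin; apply: eq_bigr => m _; rewrite starX.
  have -> : f * g = \sum_(m <- msupp f) (f@_m *: 'X_[m]) * g.
    by rewrite {1}[f]mpolyE mulr_suml.
  rewrite -sumrB; apply: eq_bigr => m _.
  by rewrite scalerBr scalerAl.
apply: (leq_trans (msize_sum _ _ _)); apply/bigmax_leqP_seq => m mf _.
apply: (leq_trans (msizeZ_le _ _)).
have := starX_low m (leqnn (msize g)); rewrite -gE addnS /= => h.
by apply: (leq_trans h); rewrite leq_add2r; apply/lemc_mdeg/msupp_le_mlead.
Qed.

Lemma star_neq0 f g : f != 0 -> g != 0 -> star f g != 0.
Proof.
move=> f0 g0; apply/eqP => e.
have /msize_leP h := star_low f g0.
(* The correction term has too small a degree to reach the product of the leading monomials. *)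
have := h (mlead f + mlead g)%MM; rewrite mdegD leqnn => /(_ isT).
rewrite e sub0r mcoeffN mleadcM => /eqP; rewrite oppr_eq0 mulf_eq0 !mleadc_eq0.
by rewrite (negbTE f0) (negbTE g0).
Qed.

Lemma weyl_domain (f g : weyl F n) : f * g = 0 -> f = 0 \/ g = 0.
Proof.
move=> fg; case: (eqVneq f 0) => [|f0]; first by left.
case: (eqVneq g 0) => [|g0]; first by right.
by have /eqP := star_neq0 f0 g0.
Qed.

End Domain.

(** * Central p-th powers *)

Lemma comm_vX_u (R : pzRingType) n (u v : 'I_n -> R) i j k : weyl_rels u v ->
  v i ^+ k * u j = u j * v i ^+ k + (v i ^+ k.-1) *+ (k * (i == j)).
Proof.
case=> _ _ vu; elim: k => [|k IH]; first by rewrite mulr1 mul1r mul0n addr0.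
rewrite exprS -mulrA IH mulrDr mulrA vu mulrDl -mulrA -exprS -addrA; congr (_ + _).
case: eqP => _ /=; last by rewrite !muln0 !mulr0n mulr0 mul0r addr0.
rewrite !muln1 mul1r mulrnAr; case: k {IH} => [|k] /=; first by rewrite mulr0n addr0.
by rewrite -exprS -mulrS.
Qed.

Section PowersCentral.
Variables (F : idomainType) (n p : nat).
Hypothesis charFp : p \in [pchar F].
Notation P := {mpoly F[n + n]}.
Implicit Types (f g q z : P).

Lemma mulrn_pchar_eq0 (V : lmodType F) (v : V) : v *+ p = 0.
Proof. by rewrite -scaler_nat (pcharf0 charFp) scale0r. Qed.

Let wcomm (z : weyl F n) : Prop := forall g : weyl F n, z * g = g * z.

Lemma weyl_central (z : weyl F n) : (forall i, z * wx F i = wx F i * z) ->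
  (forall i, z * wy F i = wy F i * z) -> forall g : weyl F n, z * g = g * z.
Proof.
move=> zx zy; apply: weyl_ind => [|f g IH IH'|c f IH|i f IH|i f IH].
- by rewrite mulr1 mul1r.
- by rewrite mulrDl mulrDr IH IH'.
- by rewrite -scalerAl -scalerAr; congr (_ *: _).
- by rewrite mulrA zx -mulrA IH mulrA.
- by rewrite mulrA zy -mulrA IH mulrA.
Qed.

Lemma wxX_central i : wcomm (wx F i ^+ p).
Proof.
have rel := weyl_rels_gen F n; case: (rel) => xx _ _.
apply: weyl_central => j; first by apply/esym/commrX/xx.
have := comm_v_uX rel j i p.
by rewrite mulrnA mulrn_pchar_eq0 mul0rn addr0 => ->.
Qed.
Lemma wyX_central i : wcomm (wy F i ^+ p).
Proof.
have rel := weyl_rels_gen F n; case: (rel) => _ yy _.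
apply: weyl_central => j; last by apply/esym/commrX/yy.
by rewrite comm_vX_u // mulrnA mulrn_pchar_eq0 mul0rn addr0.
Qed.

(** More than centrality: the Weyl product with [z], on either side, is the commutative product.
    This allows p-th powers to be read in both multiplications. *)
Definition biscalar z := forall f : P, star z f = z * f /\ star f z = z * f.

Lemma biscalar1 : biscalar 1.
Proof. by move=> f; rewrite star1l star1r mul1r. Qed.
Lemma biscalarD z z' : biscalar z -> biscalar z' -> biscalar (z + z').
Proof.
move=> hz hz' f; rewrite (linear_addE (star_linl f)) (linear_addE (star_linr f)).
by rewrite (hz f).1 (hz f).2 (hz' f).1 (hz' f).2 mulrDl.
Qed.
Lemma biscalarZ c z : biscalar z -> biscalar (c *: z).
Proof.
move=> hz f; rewrite (linear_scaleE (star_linl f)) (linear_scaleE (star_linr f)).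
by rewrite (hz f).1 (hz f).2 scalerAl.
Qed.
Lemma biscalarM z z' : biscalar z -> biscalar z' -> biscalar (z * z').
Proof.
move=> hz hz' f; rewrite -(hz z').1 -starA (hz' f).1 (hz _).1 starA (hz f).2.
by rewrite -(hz f).1 -starA (hz' f).2 (hz _).1 (hz _).1 mulrA.
Qed.

(** Left multiplication by [x_i] and right multiplication by [y_i] are already commutative
    multiplications on normally ordered polynomials; the other sides follow from centrality, as the
    commutator carries a factor [p]. *)
Lemma biscalar_X k : biscalar ('X_k ^+ p).
Proof.
rewrite -(splitK k); case: (split k) => i /=.
  have xE e (g : P) : star (wx F i ^+ e : weyl F n) g = 'X_(lshift n i) ^+ e * g.
    elim: e => [|e IH]; first by rewrite mul1r star1l.
    by rewrite !exprS -mulrA -IH -wxE -[RHS]/(star _ (star _ _)) starA.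
  have xp : (wx F i ^+ p : weyl F n) = ('X_(lshift n i) ^+ p : P).
    by rewrite -[RHS]mulr1 -xE star1r.
  move=> f; split; first by rewrite -{1}xp xE.
  rewrite -{1}xp -[LHS]/((f : weyl F n) * wx F i ^+ p) -(wxX_central i).
  exact: xE.
have yE e f : star f (wy F i ^+ e : weyl F n) = 'X_(rshift n i) ^+ e * f.
  elim: e f => [|e IH] f; first by rewrite mul1r star1r.
  have -> : wy F i ^+ e.+1 = Yd i (wy F i ^+ e : weyl F n) by rewrite exprS wyE.
  by rewrite -star_Xr IH exprSr mulrA.
have yp : (wy F i ^+ p : weyl F n) = ('X_(rshift n i) ^+ p : P).
  by rewrite -[RHS]mulr1 -yE star1l.
move=> f; split; last by rewrite -{1}yp yE.
rewrite -{1}yp -[LHS]/(wy F i ^+ p * (f : weyl F n)) (wyX_central i).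
exact: yE.
Qed.

Lemma pchar_mpoly : p \in [pchar P].
Proof. exact: (rmorph_pchar (@mpolyC (n + n) F : {rmorphism F -> P}) charFp). Qed.

Lemma mpoly_pprime : prime p. Proof. by have [] := andP charFp. Qed.

(** Here [q ^+ p] is the power in the commutative polynomial ring, where Frobenius is additive and
    reduces the claim to the variables; p-th powers in the Weyl algebra are not additive. *)
Lemma biscalar_pow q : biscalar (q ^+ p).
Proof.
elim/mpolyind: q => [|c m q _ _ IH].
  rewrite expr0n gtn_eqF ?prime_gt0 ?mpoly_pprime //=.
  by rewrite mulr0n -(scale0r (1 : P)); apply/biscalarZ/biscalar1.
rewrite -(pFrobenius_autE pchar_mpoly) rmorphD /= !pFrobenius_autE.
apply: biscalarD IH; rewrite exprZn; apply: biscalarZ.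
rewrite mpolyXE_id -prodrXl; elim/big_rec: _ => [|k z _ hz]; first exact: biscalar1.
apply: biscalarM hz; rewrite -exprM mulnC exprM.
by elim: (m k) => [|e IHe]; [exact: biscalar1|rewrite exprS; apply: biscalarM (biscalar_X k) IHe].
Qed.

Lemma star_powl q f g : star (q ^+ p * f) g = q ^+ p * star f g.
Proof. by have hq := biscalar_pow q; rewrite -(hq f).1 -starA (hq _).1. Qed.
Lemma star_powr q f g : star f (q ^+ p * g) = q ^+ p * star f g.
Proof. by have hq := biscalar_pow q; rewrite -(hq g).1 starA (hq f).2 star_powl. Qed.

End PowersCentral.

(** * The skew field of fractions in characteristic p *)

Local Notation "x %:F" := (@FracField.tofrac _ x).

Local Open Scope quotient_scope.

Lemma frac_numden (R : idomainType) (l : {fraction R}) :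
  exists a b, b != 0 /\ l = a%:F / b%:F.
Proof.
elim/quotW: l => x; exists x.1, x.2; have x0 := denom_ratioP x; split=> //.
have x0' : x.2%:F != 0 by rewrite tofrac_eq0.
apply: (mulIf x0'); rewrite divfK //.
unlock FracField.tofrac; rewrite -[LHS]FracField.pi_mul; apply/eqmodP.
by rewrite /= FracField.equivfE /FracField.mulf !numden_Ratio ?mulr1 ?oner_neq0 //= mulrC.
Qed.

Section SkewField.
Variables (F : idomainType) (n p : nat) (charFp : p \in [pchar F]).
Notation P := {mpoly F[n + n]}.
Variables (L : fieldType) (tf : {rmorphism P -> L}) (tf_inj : injective tf).
Hypothesis tf_frac : forall l, exists a b, b != 0 /\ l = tf a / tf b.

Hypothesis perfectF : forall c : F, exists r, r ^+ p = c.

(* Every left fraction has a denominator which is a [p]-th power, hence central,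
   so the commutative fractions [L] carry the skew field as well. *)
Definition skew_field of p \in [pchar F] & injective tf &
  (forall l, exists a b, b != 0 /\ l = tf a / tf b) &
  (forall c : F, exists r, r ^+ p = c) : Type := L.
Notation D := (skew_field charFp tf_inj tf_frac perfectF).
HB.instance Definition _ := GRing.Zmodule.on D.

Let p_prime : prime p. Proof. by case/andP: charFp. Qed.
Let p_gt0 : (0 < p)%N. Proof. exact: prime_gt0. Qed.

Lemma tf_eq0 f : (tf f == 0) = (f == 0).
Proof. by rewrite -(rmorph0 tf) (inj_eq tf_inj). Qed.

Lemma pchar_frac : p \in [pchar L].
Proof. exact: (rmorph_pchar tf (pchar_mpoly n charFp)). Qed.

Lemma frobD (a b : L) : (a + b) ^+ p = a ^+ p + b ^+ p.
Proof. by rewrite -!(pFrobenius_autE pchar_frac) rmorphD. Qed.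

(* The scalar [q] acts on [D] as multiplication by [q ^+ p]: this makes the
   field of fractions of the center of the Weyl algebra a copy of [L]. *)
Definition skew_scale (q : L) (d : D) : D := q ^+ p * (d : L).
Fact skew_scaleA a b d : skew_scale a (skew_scale b d) = skew_scale (a * b) d.
Proof. by rewrite /skew_scale exprMn mulrA. Qed.
Fact skew_scale1 : left_id 1 skew_scale.
Proof. by move=> d; rewrite /skew_scale expr1n mul1r. Qed.
Fact skew_scaleDr : right_distributive skew_scale +%R.
Proof. by move=> a x y; rewrite /skew_scale -mulrDr. Qed.
Fact skew_scaleDl v : {morph skew_scale^~ v : a b / a + b}.
Proof. by move=> a b; rewrite /skew_scale frobD mulrDl. Qed.
HB.instance Definition _ := GRing.Zmodule_isLmodule.Build L D
  skew_scaleA skew_scale1 skew_scaleDr skew_scaleDl.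

Lemma tf_common (I : finType) (l : I -> L) :
  exists (a : I -> P) b, b != 0 /\ forall i, l i = tf (a i) / tf b.
Proof.
have h i : exists ab : P * P, (ab.2 != 0) && (l i == tf ab.1 / tf ab.2).
  by have [a [b [b0 ->]]] := tf_frac (l i); exists (a, b); rewrite b0 eqxx.
pose ab i := xchoose (h i).
exists (fun i => (ab i).1 * \prod_(j | j != i) (ab j).2), (\prod_i (ab i).2).
split=> [|i]; first by apply/prodf_neq0 => i _; case/andP: (xchooseP (h i)).
have hD : \prod_j (ab j).2 = (ab i).2 * \prod_(j | j != i) (ab j).2 by rewrite (bigD1 i).
have [_ /eqP {1}->] := andP (xchooseP (h i)); rewrite -/(ab i) hD !(rmorphM tf).
rewrite -mulf_div divff ?mulr1 // tf_eq0; apply/prodf_neq0 => j _.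
by case/andP: (xchooseP (h j)).
Qed.

Definition pfrac (f g : P) : D := tf f / tf g ^+ p.

(** Expand [a / b] by [b ^+ p.-1]. *)
Lemma pfracP (d : D) : exists f g, (g != 0) && (d == pfrac f g).
Proof.
have [a [b [b0 e]]] := tf_frac d; exists (a * b ^+ p.-1), b; rewrite b0.
apply/eqP; rewrite e /pfrac (rmorphM tf) (rmorphXn tf).
have b0' : tf b != 0 by rewrite tf_eq0.
by rewrite -{2}(prednK p_gt0) exprSr invfM mulrA mulfK // expf_neq0.
Qed.

Lemma tfp_neq0 (q : P) : q != 0 -> tf q ^+ p != 0.
Proof. by move=> q0; rewrite expf_neq0 // tf_eq0. Qed.

Lemma pfrac_eqP f g f' g' : g != 0 -> g' != 0 ->
  pfrac f g = pfrac f' g' -> f * g' ^+ p = f' * g ^+ p.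
Proof.
move=> /tfp_neq0 g0 /tfp_neq0 g0' /eqP; rewrite /pfrac (eqr_div _ _ g0 g0') => /eqP e.
by apply: tf_inj; rewrite [LHS]rmorphM [RHS]rmorphM !(rmorphXn tf).
Qed.

Lemma pfrac_eqI f g f' g' : g != 0 -> g' != 0 ->
  f * g' ^+ p = f' * g ^+ p -> pfrac f g = pfrac f' g'.
Proof.
move=> /tfp_neq0 g0 /tfp_neq0 g0' /(congr1 tf); rewrite [LHS]rmorphM [RHS]rmorphM.
by rewrite !(rmorphXn tf) => e; apply/eqP; rewrite /pfrac (eqr_div _ _ g0 g0') e.
Qed.

Lemma pfrac_scale a b f g : b != 0 -> g != 0 ->
  (tf a / tf b) *: pfrac f g = pfrac (a ^+ p * f) (b * g).
Proof.
move=> b0 g0; rewrite -[LHS]/((tf a / tf b) ^+ p * (tf f / tf g ^+ p)) /pfrac.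
by rewrite expr_div_n mulf_div !(rmorphM tf) (rmorphXn tf) exprMn.
Qed.

Lemma pfracD f f' g : pfrac f g + pfrac f' g = pfrac (f + f') g.
Proof. by rewrite /pfrac (rmorphD tf) mulrDl. Qed.

Lemma pfrac_common (d d' : D) : exists f f' g, [/\ g != 0, d = pfrac f g & d' = pfrac f' g].
Proof.
have [f [g /andP[g0 /eqP ->]]] := pfracP d; have [f' [g' /andP[g0' /eqP ->]]] := pfracP d'.
exists (f * g' ^+ p), (f' * g ^+ p), (g * g'); split; first exact: mulf_neq0.
  by apply: (pfrac_eqI g0 (mulf_neq0 g0 g0')); rewrite exprMn mulrA mulrAC.
by apply: (pfrac_eqI g0' (mulf_neq0 g0 g0')); rewrite exprMn mulrA.
Qed.

Lemma pfrac_sig (d : D) : {fg : P * P | (fg.2 != 0) && (d == pfrac fg.1 fg.2)}.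
Proof. by apply: sigW; have [f [g h]] := pfracP d; exists (f, g). Qed.

Definition skew_mul (d d' : D) : D :=
  let: exist (f, g) _ := pfrac_sig d in let: exist (f', g') _ := pfrac_sig d' in
  pfrac (star f f') (g * g').

(** Independence of representatives: p-th powers pass through [star] on both sides, so products can
    be compared after clearing denominators. *)
Lemma skew_mulE f g f' g' : g != 0 -> g' != 0 ->
  skew_mul (pfrac f g) (pfrac f' g') = pfrac (star f f') (g * g').
Proof.
move=> g0 g0'; rewrite /skew_mul.
case: (pfrac_sig (pfrac f g)) => [[a b] /= /andP[b0 /eqP/esym]].
case: (pfrac_sig (pfrac f' g')) => [[a' b'] /= /andP[b0' /eqP/esym]].
move=> /(pfrac_eqP b0' g0') e' /(pfrac_eqP b0 g0) e.
apply: pfrac_eqI; [exact: mulf_neq0|exact: mulf_neq0|].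
have key (q q' u u' : P) : star u u' * (q * q') ^+ p = star (u * q ^+ p) (u' * q' ^+ p).
  rewrite (mulrC u) (mulrC u') (star_powl charFp q u) (star_powr charFp q' u u').
  by rewrite exprMn mulrA mulrC.
by rewrite !key e e'.
Qed.

Definition skew_one : D := pfrac 1 1.

Fact skew_mulA : associative skew_mul.
Proof.
move=> x y z; have [f [g /andP[g0 /eqP ->]]] := pfracP x.
have [f' [g' /andP[g0' /eqP ->]]] := pfracP y.
have [f'' [g'' /andP[g0'' /eqP ->]]] := pfracP z.
have [h h'] := (mulf_neq0 g0 g0', mulf_neq0 g0' g0'').
rewrite (skew_mulE _ _ g0' g0'') (skew_mulE _ _ g0 h') (skew_mulE _ _ g0 g0').
by rewrite (skew_mulE _ _ h g0'') starA mulrA.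
Qed.
Fact skew_mul1l : left_id skew_one skew_mul.
Proof.
move=> x; have [f [g /andP[g0 /eqP ->]]] := pfracP x.
by rewrite skew_mulE ?oner_neq0 // star1l mul1r.
Qed.
Fact skew_mul1r : right_id skew_one skew_mul.
Proof.
move=> x; have [f [g /andP[g0 /eqP ->]]] := pfracP x.
by rewrite skew_mulE ?oner_neq0 // star1r mulr1.
Qed.
Fact skew_mulDl : left_distributive skew_mul +%R.
Proof.
move=> x y z; have [f [f' [g [g0 -> ->]]]] := pfrac_common x y.
have [f'' [g'' /andP[g0'' /eqP ->]]] := pfracP z.
by rewrite pfracD !skew_mulE // pfracD (linear_addE (star_linl f'')).
Qed.
Fact skew_mulDr : right_distributive skew_mul +%R.
Proof.
move=> z x y; have [f [f' [g [g0 -> ->]]]] := pfrac_common x y.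
have [f'' [g'' /andP[g0'' /eqP ->]]] := pfracP z.
by rewrite pfracD !skew_mulE // pfracD (linear_addE (star_linr f'')).
Qed.
Fact pfrac_eq0 f g : g != 0 -> (pfrac f g == 0) = (f == 0).
Proof.
move=> g0; rewrite /pfrac mulf_eq0 tf_eq0 invr_eq0 expf_eq0 tf_eq0.
by rewrite (negbTE g0) andbF orbF.
Qed.
Fact skew_one_neq0 : skew_one != 0.
Proof. by rewrite pfrac_eq0 oner_neq0. Qed.

HB.instance Definition _ := GRing.Zmodule_isNzRing.Build D
  skew_mulA skew_mul1l skew_mul1r skew_mulDl skew_mulDr skew_one_neq0.

Fact skew_scalerAl a (x y : D) : a *: skew_mul x y = skew_mul (a *: x) y.
Proof.
have [f [g /andP[g0 /eqP ->]]] := pfracP x.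
have [f' [g' /andP[g0' /eqP ->]]] := pfracP y.
have [q [b [b0 ->]]] := tf_frac a.
have [h h'] := (mulf_neq0 g0 g0', mulf_neq0 b0 g0).
rewrite (skew_mulE _ _ g0 g0') (pfrac_scale _ _ b0 h) (pfrac_scale _ _ b0 g0).
by rewrite (skew_mulE _ _ h' g0') (star_powl charFp) mulrA.
Qed.
Fact skew_scalerAr a (x y : D) : a *: skew_mul x y = skew_mul x (a *: y).
Proof.
have [f [g /andP[g0 /eqP ->]]] := pfracP x.
have [f' [g' /andP[g0' /eqP ->]]] := pfracP y.
have [q [b [b0 ->]]] := tf_frac a.
have [h h'] := (mulf_neq0 g0 g0', mulf_neq0 b0 g0').
rewrite (skew_mulE _ _ g0 g0') (pfrac_scale _ _ b0 h) (pfrac_scale _ _ b0 g0').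
by rewrite (skew_mulE _ _ g0 h') (star_powr charFp) mulrCA.
Qed.
HB.instance Definition _ := GRing.Lmodule_isLalgebra.Build L D skew_scalerAl.
HB.instance Definition _ := GRing.Lalgebra_isAlgebra.Build L D skew_scalerAr.

Lemma skew_domain (x y : D) : x * y = 0 -> (x == 0) || (y == 0).
Proof.
have [f [g /andP[g0 /eqP ->]]] := pfracP x.
have [f' [g' /andP[g0' /eqP ->]]] := pfracP y.
rewrite -[_ * _]/(skew_mul _ _) (skew_mulE _ _ g0 g0') => /eqP.
rewrite (pfrac_eq0 _ g0) (pfrac_eq0 _ g0') (pfrac_eq0 _ (mulf_neq0 g0 g0')).
by apply: contraTT; rewrite negb_or => /andP[? ?]; apply: star_neq0.
Qed.

Lemma pow_pE (a : P) : a ^+ p = \sum_(m <- msupp a) (mcoeff m a ^+ p) *: 'X_[m *+ p].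
Proof.
rewrite {1}[a]mpolyE -(pFrobenius_autE (pchar_mpoly n charFp)) rmorph_sum /=.
by apply: eq_bigr => m _; rewrite pFrobenius_autE exprZn mpolyXn.
Qed.

Notation digits := {ffun 'I_(n + n) -> 'I_p}.
Definition mdig (t : digits) : 'X_{1..n + n} := [multinom (t i : nat) | i < n + n].

Lemma mdig_inj m m' t t' : (m *+ p + mdig t == m' *+ p + mdig t')%MM = (m == m') && (t == t').
Proof.
apply/eqP/andP => [/mnmP e|[/eqP -> /eqP -> //]].
have ei i : (m i * p + t i = m' i * p + t' i)%N by have := e i; rewrite !(mnmDE, mulmnE, mnmE).
split; apply/eqP; [apply/mnmP => i|apply/ffunP => i; apply: val_inj].
  by have := congr1 (divn^~ p) (ei i); rewrite !divnMDl // !divn_small ?addn0.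
by have := congr1 (modn^~ p) (ei i); rewrite !modnMDl !modn_small.
Qed.

(** The candidate basis consists of the monomials with all exponents below [p]: these exponents are
    the remainders modulo [p], while the quotients are absorbed by the scalars, which act through
    p-th powers. *)
Definition of_coord (c : 'rV[L]_#|{: digits}|) : D :=
  \sum_j c 0 j *: (tf 'X_[mdig (enum_val j)] : D).

Lemma of_coord_linear : linear of_coord.
Proof.
move=> a c d; rewrite /of_coord scaler_sumr -big_split; apply: eq_bigr => j _ /=.
by rewrite !mxE scalerDl scalerA.
Qed.

(** After clearing denominators, the terms for different digit vectors have disjoint supports by
    [mdig_inj], so nothing can cancel. *)
Lemma of_coord_eq0 c : of_coord c = 0 -> c = 0.
Proof.
have [a [b [b0 ca]]] := tf_common (fun j => c 0 j).
have b0' := tfp_neq0 b0.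
have -> : of_coord c = tf (\sum_j a j ^+ p * 'X_[mdig (enum_val j)]) / tf b ^+ p.
  rewrite rmorph_sum mulr_suml; apply: eq_bigr => j _.
  rewrite ca -[LHS]/((tf (a j) / tf b) ^+ p * tf 'X_[mdig (enum_val j)]).
  by rewrite expr_div_n [tf (_ * _)]rmorphM rmorphXn mulrAC.
move/eqP; rewrite mulf_eq0 invr_eq0 (negbTE b0') orbF tf_eq0 => /eqP e.
apply/rowP => j; rewrite mxE ca; suff -> : a j = 0 by rewrite rmorph0 mul0r.
apply/mpolyP => m; rewrite mcoeff0; apply/eqP.
suff: mcoeff m (a j) ^+ p == 0 by rewrite expf_eq0 p_gt0.
have /eqP := congr1 (mcoeff (m *+ p + mdig (enum_val j))%MM) e.
rewrite mcoeff0 raddf_sum (bigD1 j) //= big1 ?addr0 => [|i ij]; last first.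
  rewrite pow_pE mulr_suml raddf_sum big1 // => m' _ /=.
  rewrite -scalerAl mcoeffZ -mpolyXD mcoeffX mdig_inj (inj_eq enum_val_inj) (negbTE ij).
  by rewrite andbF mulr0.
rewrite pow_pE mulr_suml raddf_sum /=.
case: (boolP (m \in msupp (a j))) => [mj|/memN_msupp_eq0 -> _]; last first.
  by rewrite expr0n gtn_eqF.
rewrite (bigD1_seq m) //= big1 ?addr0 => [|m' mm'].
  by rewrite -scalerAl mcoeffZ -mpolyXD mcoeffX eqxx mulr1.
rewrite -scalerAl mcoeffZ -mpolyXD mcoeffX mdig_inj (negbTE mm').
by rewrite mulr0.
Qed.

(** Divide the exponents by [p] with remainder; the coefficient has to be absorbed by the p-th power
    as well, which is where [perfectF] enters. *)
Lemma of_coord_surj (d : D) : exists c, of_coord c == d.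
Proof.
have clin := of_coord_linear.
have [f [g /andP[g0 /eqP ->]]] := pfracP d.
suff [c ec] : exists c, of_coord c = tf f.
  exists ((tf g)^-1 *: c); apply/eqP; rewrite (linear_scaleE clin) ec.
  by rewrite -[LHS]/((tf g)^-1 ^+ p * tf f) exprVn mulrC.
elim/mpolyind: f => [|a m f _ _ [c ec]].
  by exists 0; rewrite rmorph0 (linear_zeroE clin).
have [r er] := perfectF a.
pose t : digits := [ffun i => Ordinal (ltn_pmod (m i) p_gt0)].
pose q : 'X_{1..n + n} := [multinom (m i %/ p)%N | i < n + n].
have em : m = (q *+ p + mdig t)%MM.
  by apply/mnmP => i; rewrite mnmDE mulmnE !mnmE ffunE -divn_eq.
exists (tf (r *: 'X_[q]) *: delta_mx 0 (enum_rank t) + c).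
rewrite clin ec rmorphD; congr (_ + _); rewrite /of_coord (bigD1 (enum_rank t)) //= big1.
  rewrite mxE !eqxx scale1r addr0 enum_rankK.
  rewrite -[LHS]/(tf (r *: 'X_[q]) ^+ p * tf 'X_[mdig t]) -rmorphXn -rmorphM.
  by rewrite exprZn er mpolyXn -scalerAl -mpolyXD -em.
by move=> j jt; rewrite mxE (negbTE jt) andbF scale0r.
Qed.

Definition coord_of (d : D) : 'rV[L]_#|{: digits}| := xchoose (of_coord_surj d).
Lemma coord_ofK : cancel coord_of of_coord.
Proof. by move=> d; apply/eqP/(xchooseP (of_coord_surj d)). Qed.
Lemma of_coord_inj : injective of_coord.
Proof.
move=> c c' /eqP; rewrite -subr_eq0 -scaleN1r addrC -of_coord_linear => /eqP.
by move/of_coord_eq0/eqP; rewrite scaleN1r addrC subr_eq0 => /eqP.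
Qed.
Lemma of_coordK : cancel of_coord coord_of.
Proof. by move=> c; apply: of_coord_inj; rewrite coord_ofK. Qed.
Lemma coord_of_linear : linear coord_of.
Proof. by move=> a x y; apply: of_coord_inj; rewrite of_coord_linear !coord_ofK. Qed.

HB.instance Definition _ := Lmodule_hasFinDim.Build L D (dim := #|{: digits}|)
  (exist2 _ _ coord_of coord_of_linear (Bijective coord_ofK of_coordK)).
HB.instance Definition _ := Algebra_isFalgebra.Build L D.

Lemma dim_skew_field : \dim {:D} = (p ^ (n + n))%N.
Proof. by rewrite dimvf -[LHS]/#|{: digits}| card_ffun !card_ord. Qed.

(** In finite dimension, multiplication by an element that is not a zero divisor is bijective. *)
Lemma skew_fieldP : GRing.field_axiom D.
Proof. exact: Falgebra_FieldMixin skew_domain. Qed.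

End SkewField.

(** * Subalgebras with few generators are everything, up to central denominators *)

Section CentralDenominators.
Variables (F : idomainType) (n p : nat) (charFp : p \in [pchar F]).
Notation P := {mpoly F[n + n]}.
Variables (L : fieldType) (tf : {rmorphism P -> L}) (tf_inj : injective tf).
Hypothesis tf_frac : forall l, exists a b, b != 0 /\ l = tf a / tf b.
Hypothesis perfectF : forall c : F, exists r, r ^+ p = c.
Notation D := (skew_field charFp tf_inj tf_frac perfectF).

Definition skew_in (f : weyl F n) : D := tf f.

Lemma skew_inE f : skew_in f = pfrac charFp tf_inj tf_frac perfectF f 1.
Proof. by rewrite /pfrac rmorph1 expr1n divr1. Qed.

Lemma skew_inM f g : skew_in (f * g) = skew_in f * skew_in g.
Proof.
rewrite !skew_inE -[RHS]/(skew_mul _ _) skew_mulE ?oner_neq0 //.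
by rewrite mulr1.
Qed.
Lemma skew_inD f g : skew_in (f + g) = skew_in f + skew_in g.
Proof. exact: (rmorphD tf). Qed.
Lemma skew_in1 : skew_in 1 = 1.
Proof. by rewrite skew_inE. Qed.

Variables (B : weyl F n -> Prop) (r : nat) (b : 'I_r -> weyl F n).
Hypotheses (B1 : B 1) (BM : forall f g, B f -> B g -> B (f * g)).
Hypothesis genB : forall w, exists c : 'I_r -> weyl F n,
  (forall s, B (c s)) /\ w = \sum_s c s * b s.
Hypothesis lt_rp : (r < p)%N.

(** A family of maximal rank spans. The space is kept as the span of explicit elements of [B], since
    [central_denominator] needs coordinates with respect to such elements. *)
Lemma max_span : exists bs : seq (weyl F n), (forall w, w \in bs -> B w) /\
  forall w, B w -> skew_in w \in <<map skew_in bs>>%VS.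
Proof.
pose Q k := `[< exists bs : seq (weyl F n), (forall w, w \in bs -> B w) /\
   \dim <<map skew_in bs>>%VS = k >].
have exQ : exists k, Q k by exists (\dim <<map skew_in [::]>>%VS); apply/asboolP; exists [::].
have ubQ k : Q k -> (k <= \dim {:D})%N by case/asboolP=> bs [_ <-]; apply/dimvS/subvf.
case: (ex_maxnP exQ ubQ) => k /asboolP[bs [bsB dimk]] maxk.
exists bs; split=> // w Bw; have: Q (\dim <<map skew_in (w :: bs)>>%VS).
  by apply/asboolP; exists (w :: bs); split=> // w'; rewrite inE => /orP[/eqP ->|/bsB].
move/maxk; rewrite -dimk => le_dim.
have sub : (<<map skew_in bs>> <= <<map skew_in (w :: bs)>>)%VS.
  by rewrite /= span_cons addvSr.
have /eqP -> : (<<map skew_in bs>> == <<map skew_in (w :: bs)>>)%VS by rewrite eqEdim sub.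
by apply: memv_span; rewrite mem_head.
Qed.

(* [K] is a subalgebra, so its dimension divides [p ^ (n + n)]; as [r < p]
   translates of [K] cover [D], it cannot be a proper one. *)
Lemma full_span : exists bs : seq (weyl F n), (forall w, w \in bs -> B w) /\
  <<map skew_in bs>>%VS = {:D}%VS.
Proof.
have [bs [bsB spanB]] := max_span; exists bs; split=> //.
set K := <<_>>%VS in spanB *.
have K1 : 1 \in K by rewrite -skew_in1 spanB.
have KM : (K * K <= K)%VS.
  apply/prodvP => u v uK vK; rewrite (coord_span (X := in_tuple (map skew_in bs)) uK).
  rewrite mulr_suml memv_suml // => i _; rewrite -scalerAl memvZ //.
  rewrite (coord_span (X := in_tuple (map skew_in bs)) vK).
  rewrite mulr_sumr memv_suml // => j _; rewrite -scalerAr memvZ //.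
  have /mapP[w wbs ->] := mem_nth 0 (ltn_ord i); have /mapP[w' wbs' ->] := mem_nth 0 (ltn_ord j).
  by rewrite -skew_inM spanB //; apply: BM; apply: bsB.
have Kasp : is_aspace K by rewrite /is_aspace has_algid1.
pose KA : {aspace D} := ASpace Kasp.
(* Denominators are central and become scalars, so generation by the [b s] over [B] passes to the
   skew field. *)
have full : ({:D} <= \sum_s K * <[skew_in (b s)]>)%VS.
  apply/subvP => d _; have [f [g /andP[g0 /eqP ->]]] := pfracP d.
  have -> : pfrac charFp tf_inj tf_frac perfectF f g = (tf g)^-1 *: skew_in f.
    have -> : (tf g)^-1 = tf 1 / tf g by rewrite rmorph1 div1r.
    by rewrite skew_inE pfrac_scale ?oner_neq0 // expr1n mul1r mulr1.
  apply: memvZ; have [c [cB ->]] := genB f.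
  have -> : skew_in (\sum_s c s * b s) = \sum_s skew_in (c s) * skew_in (b s).
    rewrite (big_morph skew_in skew_inD (rmorph0 tf)).
    by apply: eq_bigr => s _; rewrite skew_inM.
  apply: memv_sumr => s _; apply: memv_mul; [exact: spanB|exact: memv_line].
have fieldD : GRing.field_axiom D := @skew_fieldP _ _ _ charFp _ _ tf_inj tf_frac perfectF.
have dimKv (v : D) : (\dim (K * <[v]>) <= \dim K)%N.
  case: (eqVneq v 0) => [->|v0]; last by rewrite dim_cosetv_unit // fieldD.
  by rewrite (_ : <[0]>%VS = 0%VS) ?prodv0 ?dimv0 //; apply/eqP; rewrite -dimv_eq0 dim_vline eqxx.
have le_dim : (\dim {:D} <= r * \dim K)%N.
  apply: leq_trans (dimvS full) _; apply: leq_trans (dimv_leq_sum _ _ _) _.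
  have -> : (r * \dim K = \sum_(s < r) \dim K)%N by rewrite sum_nat_const card_ord.
  by apply: leq_sum => s _; exact: dimKv.
have := skew_field_dimS fieldD (subvf KA); rewrite dim_skew_field => dvd.
have pp : prime p by case/andP: charFp.
have [e le_e eK] : exists2 e, (e <= n + n)%N & \dim KA = (p ^ e)%N by apply/dvdn_pfactor.
apply/eqP; rewrite eqEdim subvf dim_skew_field -[\dim K]/(\dim KA) eK.
rewrite dim_skew_field -[\dim K]/(\dim KA) eK in le_dim.
case: (ltnP e (n + n)) => [lt_e|]; last by move/(leq_pexp2l (prime_gt0 pp)).
(* For [e < n + n] this reads p^(e+1) <= r p^e, against [r < p]. *)
have := leq_trans (leq_pexp2l (prime_gt0 pp) lt_e) le_dim.
by rewrite expnS leq_pmul2r ?expn_gt0 ?prime_gt0 // leqNgt lt_rp.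
Qed.

(** Expand [a] in a spanning family from [B] and clear the common denominator of the coordinates;
    scalars act through p-th powers, hence the exponents. *)
Lemma central_denominator (a : P) : exists (g : P) (N : nat) (q : 'I_N -> P) (c : 'I_N -> weyl F n),
  [/\ g != 0, forall i, B (c i) & g ^+ p * a = \sum_i q i ^+ p * (c i : P)].
Proof.
have [bs [bsB full]] := full_span; have := memvf (skew_in a); rewrite -full => aK.
pose co i := coord (in_tuple (map skew_in bs)) i (skew_in a).
have e : skew_in a = \sum_i co i *: (map skew_in bs)`_i by rewrite -(coord_span (X := in_tuple _) aK).
have [q [g [g0 eq]]] := tf_common tf_inj tf_frac co.
have nthE (i : 'I_(size (map skew_in bs))) : (map skew_in bs)`_i = skew_in bs`_i.
  by rewrite (nth_map 0) //; case: i => i /=; rewrite size_map.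
exists g, (size (map skew_in bs)), q, (fun i => bs`_i); split=> // [i|].
  by apply/bsB/mem_nth; case: i => i /=; rewrite size_map.
apply: tf_inj; rewrite [LHS]rmorphM -[tf a]/(skew_in a) e rmorph_sum mulr_sumr.
apply: eq_bigr => i _; rewrite nthE eq [RHS]rmorphM !(rmorphXn tf).
rewrite -[_ *: _]/((tf (q i) / tf g) ^+ p * tf (bs`_i : P)) expr_div_n.
rewrite mulrA; congr (_ * _); rewrite mulrC divfK //.
by rewrite expf_neq0 // (tf_eq0 tf_inj).
Qed.

End CentralDenominators.

(** * Commutation in characteristic p *)

Section ScalarMatrices.
Variables (W : nzRingType) (d : nat).
Implicit Types (a : W) (U : 'M[W]_d.+1).

Lemma scalar_mulE a U i j : (a%:M * U) i j = a * U i j.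
Proof. by rewrite -mulmxE mul_scalar_mx mxE. Qed.

Lemma mul_scalarE a U i j : (U * a%:M) i j = U i j * a.
Proof.
rewrite -mulmxE mxE (bigD1 j) //= big1 => [|k kj]; first by rewrite mxE eqxx addr0.
by rewrite mxE (negbTE kj) mulr0.
Qed.

Lemma scalar_mxMr (a b : W) : (a * b)%:M = a%:M * b%:M :> 'M[W]_d.+1.
Proof. exact: scalar_mxM. Qed.

End ScalarMatrices.

(** It is not [a] and [b] but [t * a] and [t * b] that commute with [t]; the price is the factor
    [t * t]. It will be used with [t = rho z], which has to be cancelled afterwards. *)
Lemma comm_squareP (T : pzRingType) (t a b : T) :
  t * a * t = t * (t * a) -> t * b * t = t * (t * b) ->
  (t * a) * (t * b) = (t * b) * (t * a) -> t * t * (a * b - b * a) = 0.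
Proof.
move=> ta tb ab; have e c u : t * c * t = t * (t * c) -> t * t * (c * u) = t * c * (t * u).
  by move=> h; rewrite [RHS]mulrA h !mulrA.
by rewrite mulrBr (e _ _ ta) (e _ _ tb) ab subrr.
Qed.

Lemma mulr_comm3 (T : pzRingType) (a t b : T) :
  a * t = t * a -> a * b = b * a -> a * (t * b) = t * b * a.
Proof. by move=> h h'; rewrite mulrA h -mulrA h' mulrA. Qed.

Lemma sum_pred1 (V : nmodType) (I : finType) (i : I) (x : I -> V) :
  \sum_q x q *+ (q == i) = x i.
Proof.
rewrite (bigD1 i) //= big1 => [|q /negbTE -> //].
by rewrite eqxx addr0.
Qed.

Lemma weyl_alg_inj (R : comNzRingType) n : injective (fun c : R => c%:A : weyl R n).
Proof.
have h (c : R) : mcoeff 0%MM ((c%:A : weyl R n) : {mpoly R[n + n]}) = c.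
  by rewrite -[c%:A]/(c *: (1 : {mpoly R[n + n]})) mcoeffZ mcoeff1 eqxx mulr1.
by move=> c c' /(congr1 (fun f : weyl R n => mcoeff 0%MM (f : {mpoly R[n + n]}))); rewrite !h.
Qed.

Section GaloisDatum.
Variables (R : comNzRingType) (n d r : nat).
Notation W := (weyl R n).
Notation MW := 'M[W]_d.+1.

(* The finite amount of data which the argument in characteristic [p] needs:
   [rho] is the coaction [a |-> (u_lj . a)] in terms of matrix coefficients
   [u_lj] of [H], [sigma] is [a |-> (S(u_jl) . a)], the [b s] generate the
   algebra over the invariants [{w | rho w = w%:M}], and [M] and [N] represent
   two elements of the dual Hopf algebra. *)
Definition galois_datum (rho sigma : {rmorphism W -> MW})
    (b c1 : 'I_r -> W) (cx cy : 'I_n -> 'I_r -> 'I_r -> W)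
    (M N : 'M[R]_d.+1) (aM aN : 'I_r -> W) : Prop :=
  [/\ (forall c, rho c%:A = (c%:A)%:M) /\ (forall c, sigma c%:A = (c%:A)%:M),
      (forall i l j, \sum_q sigma (rho (wx R i) q j) q l = wx R i *+ (l == j)) /\
      (forall i l j, \sum_q sigma (rho (wy R i) q j) q l = wy R i *+ (l == j)),
      [/\ forall s, rho (c1 s) = (c1 s)%:M, forall i s t, rho (cx i s t) = (cx i s t)%:M
        & forall i s t, rho (cy i s t) = (cy i s t)%:M],
      [/\ 1 = \sum_s c1 s * b s, forall i s, b s * wx R i = \sum_t cx i s t * b t
        & forall i s, b s * wy R i = \sum_t cy i s t * b t]
    & map_mx (GRing.in_alg W) M = \sum_s (aM s)%:M * rho (b s) /\
      map_mx (GRing.in_alg W) N = \sum_s (aN s)%:M * rho (b s)].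

End GaloisDatum.

Section CharacteristicP.
Variables (F : idomainType) (n d r p : nat) (charFp : p \in [pchar F]).
Notation P := {mpoly F[n + n]}.
Notation W := (weyl F n).
Notation MW := 'M[W]_d.+1.
Hypothesis perfectF : forall c : F, exists r, r ^+ p = c.
Variables (rho sigma : {rmorphism W -> MW}).
Variables (b c1 : 'I_r -> W) (cx cy : 'I_n -> 'I_r -> 'I_r -> W).
Variables (M N : 'M[F]_d.+1) (aM aN : 'I_r -> W).
Hypothesis dat : galois_datum rho sigma b c1 cx cy M N aM aN.
Hypothesis lt_rp : (r < p)%N.

(* [Psi] undoes [rho]; it shows below that [rho z] is not a zero divisor on
   constant matrices. *)
Let Psi (U : MW) : MW := \matrix_(l, j) \sum_q sigma (U q j) q l.

Let PsiE U l j : Psi U l j = \sum_q sigma (U q j) q l.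
Proof. by rewrite mxE. Qed.

Let PsiM a U : Psi (rho a) = a%:M -> Psi (rho a * U) = a%:M * Psi U.
Proof.
move=> ha; apply/matrixP => l j; rewrite scalar_mulE !mxE.
transitivity (\sum_q \sum_t Psi (rho a) t q * sigma (U q j) t l).
  under eq_bigr => q _.
    rewrite mxE rmorph_sum summxE.
    under eq_bigr => t _ do rewrite rmorphM mxE.
    over.
  rewrite exchange_big; apply: eq_bigr => q _; rewrite exchange_big.
  by apply: eq_bigr => t _; rewrite mxE mulr_suml.
rewrite ha mulr_sumr; apply: eq_bigr => q _; rewrite (bigD1 q) //= big1 => [|t tq].
  by rewrite mxE eqxx mulr1n addr0.
by rewrite mxE (negbTE tq) mulr0n mul0r.
Qed.

Let PsiZ c (U : MW) : (forall c, sigma c%:A = (c%:A)%:M) ->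
  Psi ((c%:A)%:M * U) = (c%:A)%:M * Psi U.
Proof.
move=> sZ; apply/matrixP => l j; rewrite scalar_mulE !mxE mulr_sumr.
by apply: eq_bigr => q _; rewrite scalar_mulE rmorphM sZ scalar_mulE.
Qed.

Let PsiD U V : Psi (U + V) = Psi U + Psi V.
Proof.
apply/matrixP => l j; rewrite !mxE -big_split; apply: eq_bigr => q _.
by rewrite mxE raddfD mxE.
Qed.

(** The datum grants this on the generators only; [PsiM] propagates it through products. *)
Let Psi_rho a : Psi (rho a) = a%:M.
Proof.
case: dat => [[rZ sZ] [hx hy] _ _ _].
have Psi1 : Psi 1 = 1.
  apply/matrixP => l j; rewrite !mxE (bigD1 j) //= big1 => [|q qj].
    by rewrite mxE eqxx rmorph1 mxE addr0 eq_sym.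
  by rewrite mxE (negbTE qj) raddf0 mxE.
move: a; apply: weyl_ind => [|f g IH IH'|c f IH|i f IH|i f IH].
- by rewrite rmorph1 Psi1.
- by rewrite rmorphD PsiD IH IH' raddfD.
- by rewrite -mulr_algl rmorphM rZ PsiZ // IH -scalar_mxMr.
- rewrite rmorphM PsiM ?IH -?scalar_mxMr //.
  by apply/matrixP => l j; rewrite !mxE hx.
- rewrite rmorphM PsiM ?IH -?scalar_mxMr //.
  by apply/matrixP => l j; rewrite !mxE hy.
Qed.

Let B (w : W) : Prop := rho w = w%:M.
Let cent (w : W) : Prop := forall f, w * f = f * w.
Let BZ (w : W) : Prop := exists (N : nat) (c z : 'I_N -> W),
  [/\ forall i, B (c i), forall i, cent (z i) & w = \sum_i c i * z i].

Let BM f g : B f -> B g -> B (f * g).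
Proof. by rewrite /B rmorphM => -> ->; rewrite scalar_mxMr. Qed.
Let BD f g : B f -> B g -> B (f + g).
Proof. by rewrite /B rmorphD => -> ->; rewrite raddfD. Qed.
Let B0 : B 0. Proof. by rewrite /B !raddf0. Qed.
Let B1 : B 1. Proof. by rewrite /B rmorph1. Qed.
Let BS (I : Type) (s : seq I) (f : I -> W) : (forall i, B (f i)) -> B (\sum_(i <- s) f i).
Proof. by move=> h; elim/big_ind: _. Qed.

(** The left [B]-module spanned by the [b s] contains 1 and is stable under right multiplication by
    the generators, hence by the whole algebra. *)
Let generated w : exists c : 'I_r -> W, (forall s, B (c s)) /\ w = \sum_s c s * b s.
Proof.
case: dat => _ _ [B_1 B_x B_y] [g1 gx gy] _.
have comb (m : 'I_r -> W) f (e : 'I_r -> 'I_r -> W) : (forall s, B (m s)) ->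
    (forall s t, B (e s t)) -> (forall s, b s * f = \sum_t e s t * b t) ->
    exists c : 'I_r -> W, (forall s, B (c s)) /\ (\sum_s m s * b s) * f = \sum_s c s * b s.
  move=> Bm Be ef; exists (fun t => \sum_s m s * e s t); split=> [t|].
    by apply: BS => s; apply: BM.
  rewrite mulr_suml; under eq_bigr => s _ do rewrite -mulrA ef mulr_sumr.
  rewrite exchange_big; apply: eq_bigr => t _; rewrite mulr_suml.
  by apply: eq_bigr => s _; rewrite mulrA.
suff h f : exists e : 'I_r -> 'I_r -> W,
    (forall s t, B (e s t)) /\ forall s, b s * f = \sum_t e s t * b t.
  have [e [Be ef]] := h w; rewrite -[w]mul1r g1; exact: comb Be ef.
move: f; apply: weyl_ind => [|f g [e [Be ef]] [e' [Be' ef']]|c f [e [Be ef]]|i f [e [Be ef]]|i f [e [Be ef]]].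
- exists (fun s t => (s == t)%:R); split=> [s t|s]; first by case: (s == t).
  rewrite mulr1 (bigD1 s) //= big1 => [|t ts]; first by rewrite eqxx mul1r addr0.
  by rewrite eq_sym (negbTE ts) mul0r.
- exists (fun s t => e s t + e' s t); split=> [s t|s]; first exact: BD.
  rewrite mulrDr ef ef' -big_split; apply: eq_bigr => t _ /=.
  by rewrite mulrDl.
- exists (fun s t => c%:A * e s t); split=> [s t|s].
    by apply: BM => //; rewrite /B; case: dat => [[rZ _] _ _ _ _].
  rewrite -scalerAr ef scaler_sumr; apply: eq_bigr => t _.
  by rewrite mulr_algl scalerAl.
- have [c cE] := choice (fun s => comb (cx i s) f e (B_x i s) Be ef).
  exists c; split=> [s t|s]; first exact: (cE s).1.
  by rewrite mulrA gx (cE s).2.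
- have [c cE] := choice (fun s => comb (cy i s) f e (B_y i s) Be ef).
  exists c; split=> [s t|s]; first exact: (cE s).1.
  by rewrite mulrA gy (cE s).2.
Qed.

Let cent_pow (q : P) : cent (q ^+ p : P).
Proof.
move=> f; have h := biscalar_pow charFp q f.
exact: etrans h.1 (esym h.2).
Qed.

Let denominator a : exists z, [/\ z != 0, cent z & BZ (z * a)].
Proof.
have tf_inj : injective (@FracField.tofrac P) by move=> x y /eqP; rewrite tofrac_eq => /eqP.
have [g [N' [q [c [g0 Bc e]]]]] :=
  central_denominator charFp tf_inj (@frac_numden P) perfectF B1 BM generated lt_rp a.
exists (g ^+ p : P); split; [by rewrite expf_neq0|exact: cent_pow|].
exists N', c, (fun i => q i ^+ p : P); split; [exact: Bc|by move=> i; apply: cent_pow|].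
transitivity (g ^+ p * (a : P)); first exact: (biscalar_pow charFp g a).1.
rewrite e; apply: eq_bigr => i _.
exact: esym (biscalar_pow charFp (q i) (c i)).2.
Qed.

Let centM z z' : cent z -> cent z' -> cent (z * z').
Proof. by move=> hz hz' f; rewrite -mulrA hz' mulrA hz mulrA. Qed.

Let weyl_mulf_neq0 (f g : W) : f != 0 -> g != 0 -> f * g != 0.
Proof. exact: star_neq0. Qed.

Let common_denominator : exists z, [/\ z != 0, cent z & forall s, BZ (z * b s)].
Proof.
suff [z [z0 cz hz]] : exists z, [/\ z != 0, cent z & forall s, s \in enum 'I_r -> BZ (z * b s)].
  by exists z; split=> // s; apply: hz; rewrite mem_enum.
elim: (enum _) => [|s l [z [z0 cz hz]]].
  by exists 1; split=> //; [exact: oner_neq0|move=> f; rewrite mul1r mulr1].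
have BZc w z' : cent z' -> BZ w -> BZ (z' * w).
  move=> cz' [N' [c [y [Bc cy' ->]]]]; exists N', c, (fun i => z' * y i); split=> // [i|].
    exact: centM.
  by rewrite mulr_sumr; apply: eq_bigr => i _; rewrite mulrA cz' -mulrA.
have [z' [z0' cz' hz']] := denominator (b s).
exists (z * z'); split; [exact: weyl_mulf_neq0|exact: centM|].
move=> t; rewrite inE => /orP[/eqP ->|/hz h]; first by rewrite -mulrA; apply: BZc.
by rewrite cz -mulrA; apply: BZc.
Qed.

(** Any [a] has a nonzero central multiple in [BZ], with which [w] commutes; the central factor
    cancels in a domain. *)
Let cent_commB w : (forall c, B c -> w * c = c * w) -> cent w.
Proof.
move=> hw a; have [z [z0 cz [N' [c [y [Bc cy' e]]]]]] := denominator a.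
have: z * (w * a - a * w) = 0.
  rewrite mulrBr mulrA cz -mulrA e mulrA e mulr_sumr mulr_suml -sumrB big1 // => i _.
  by rewrite mulrA hw // -!mulrA cy' subrr.
by case/weyl_domain => /eqP; [rewrite (negbTE z0)|rewrite subr_eq0 => /eqP].
Qed.

Let scentral (U : MW) : Prop := forall a : W, a%:M * U = U * a%:M.

Let scentralP (U : MW) : (forall i j, cent (U i j)) -> scentral U.
Proof.
by move=> hU a; apply/matrixP => i j; rewrite scalar_mulE mul_scalarE hU.
Qed.

(** An invariant [c] satisfies [rho c = c%:M], so the entries of [rho z] commute with [c]; by
    [cent_commB] they are central. *)
Let rho_central z : cent z -> scentral (rho z).
Proof.
move=> cz; apply: scentralP => i j; apply: cent_commB => c Bc.
have /matrixP/(_ i j) : rho z * c%:M = c%:M * rho z by rewrite -Bc -!rmorphM cz.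
by rewrite scalar_mulE mul_scalarE.
Qed.

Let RZ (U : MW) : Prop := exists (N : nat) (w z : 'I_N -> W),
  (forall i, cent (z i)) /\ U = \sum_i (w i)%:M * rho (z i).

(** The matrices [rho z], [z] central, commute with each other and with scalar matrices. It remains
    to move [U] past the coefficients of [V], which [scentral U] permits. *)
Let RZ_comm (U V : MW) : scentral U -> RZ U -> RZ V -> U * V = V * U.
Proof.
move=> sU [NU [wU [zU [cU eU]]]] [NV [wV [zV [cV ->]]]].
rewrite mulr_sumr mulr_suml; apply: eq_bigr => i _; rewrite mulrA -sU -!mulrA.
congr (_ * _); rewrite {1}eU [in RHS]eU mulr_sumr mulr_suml; apply: eq_bigr => j _.
by rewrite -mulrA -rmorphM cU rmorphM !mulrA rho_central.
Qed.

Let RZ_sum (I : Type) (s : seq I) (U : I -> MW) : (forall i, RZ (U i)) -> RZ (\sum_(i <- s) U i).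
Proof.
move=> h; elim/big_ind: _ => // [|_ _ [N1 [w1 [z1 [c1' ->]]]] [N2 [w2 [z2 [c2 ->]]]]].
  by exists 0%N, (fun=> 0), (fun=> 0); rewrite big_ord0; split=> // -[].
pose w i := match split i with inl i => w1 i | inr i => w2 i end.
pose z i := match split i with inl i => z1 i | inr i => z2 i end.
exists (N1 + N2)%N, w, z; split=> [i|]; first by rewrite /z; case: (split i).
have e1 : \sum_i (w1 i)%:M * rho (z1 i) = \sum_(i < N1) (w (lshift N2 i))%:M * rho (z (lshift N2 i)).
  by apply: eq_bigr => i _; rewrite /w /z split_lshift.
have e2 : \sum_i (w2 i)%:M * rho (z2 i) = \sum_(i < N2) (w (rshift N1 i))%:M * rho (z (rshift N1 i)).
  by apply: eq_bigr => i _; rewrite /w /z split_rshift.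
by rewrite e1 e2 [RHS]big_split_ord.
Qed.

Theorem charp_commute : M * N = N * M.
Proof.
have [z [z0 cz hz]] := common_denominator.
case: (dat) => [[_ sZ] _ _ _ [eM eN]].
set Mh := map_mx _ M in eM; set Nh := map_mx _ N in eN.
have sc := rho_central cz.
(* [rho z] moves past the scalar matrix of [a s] and turns [rho (b s)] into [rho (z * b s)], where
   [z * b s] is a sum of invariants times central elements. *)
have RZs a : RZ (rho z * \sum_s (a s)%:M * rho (b s)).
  rewrite mulr_sumr; apply: RZ_sum => s; rewrite mulrA -sc -mulrA -rmorphM.
  have [N' [c [y [Bc cy' ->]]]] := hz s.
  exists N', (fun i => a s * c i), y; split=> //.
  rewrite rmorph_sum mulr_sumr; apply: eq_bigr => i _.
  by rewrite rmorphM Bc mulrA -scalar_mxMr.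
have RZz : RZ (rho z).
  exists 1%N, (fun=> 1), (fun=> z); split=> //.
  by rewrite big_ord1 mul1r.
have sca (X : 'M[F]_d.+1) : scentral (rho z * map_mx (GRing.in_alg W) X).
  have hc : scentral (map_mx (GRing.in_alg W) X).
    by apply: scentralP => i j f; rewrite mxE /= mulr_algl mulr_algr.
  by move=> a; apply: mulr_comm3 (sc a) (hc a).
have RM : RZ (rho z * Mh) by rewrite eM.
have RN : RZ (rho z * Nh) by rewrite eN.
have cMz := RZ_comm (sca M) RM RZz; have cNz := RZ_comm (sca N) RN RZz.
have cMN := RZ_comm (sca M) RM RN; rewrite -/Mh -/Nh in cMz cNz cMN.
have e : rho (z * z) * map_mx (GRing.in_alg W) (M * N - N * M) = 0.
  have -> : map_mx (GRing.in_alg W) (M * N - N * M) = Mh * Nh - Nh * Mh.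
    by rewrite rmorphB !rmorphM.
  have := comm_squareP cMz cNz cMN; by rewrite -rmorphM.
(* [Psi] undoes [rho (z * z)] and fixes constant matrices, so each entry of the commutator is killed
   by the nonzero element [z * z] of a domain. *)
have := PsiM (map_mx (GRing.in_alg W) (M * N - N * M)) (Psi_rho (z * z)); rewrite e.
have -> : Psi 0 = 0 by apply: (addrI (Psi 0)); rewrite -PsiD !addr0.
have aE (X : 'M[F]_d.+1) q j : map_mx (GRing.in_alg W) X q j = (X q j)%:A by rewrite mxE.
have -> (X : 'M[F]_d.+1) : Psi (map_mx (GRing.in_alg W) X) = map_mx (GRing.in_alg W) X.
  have sX q l j : sigma (map_mx (GRing.in_alg W) X q j) q l = (X q j)%:A *+ (q == l).
    by rewrite aE sZ mxE.
  apply/matrixP => l j; rewrite PsiE aE; under eq_bigr => q _ do rewrite sX.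
  exact: sum_pred1.
move=> h; apply/eqP; rewrite -subr_eq0; apply/eqP/matrixP => l j.
have /esym := congr1 (fun U : MW => U l j) h; rewrite scalar_mulE aE [RHS]mxE => e2.
case: (weyl_domain e2) => [zz|e3].
  by case: (weyl_domain zz) => /eqP; rewrite (negbTE z0).
rewrite [RHS]mxE; apply: (@weyl_alg_inj F n); rewrite e3.
exact: esym (scale0r _).
Qed.

End CharacteristicP.

(** * Reduction to positive characteristic *)

(* Points of the spectrum of the image of [psi] exist in all but finitely many
   positive characteristics. *)
Definition many_points (S : idomainType) (K : fieldType) (psi : {rmorphism S -> K}) : Prop :=
  forall q, psi q != 0 -> exists2 D : nat, (0 < D)%N &
    forall Om : closedFieldType, D%:R != 0 :> Om ->
      exists phi : {rmorphism S -> Om}, (forall s, psi s = 0 -> phi s = 0) /\ phi q != 0.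

Lemma many_points_int (K : fieldType) (psi : {rmorphism int -> K}) :
  [pchar K] =i pred0 -> many_points psi.
Proof.
move=> K0 q q0; exists `|q|%N.
  by rewrite absz_gt0; apply: contraNneq q0 => ->; rewrite rmorph0.
have absE (T : pzRingType) (z : int) : z%:~R = 0 :> T <-> (`|z|%N)%:R = 0 :> T.
  case: z => m; rewrite ?NegzE ?rmorphN /= -?pmulrn //.
  by split=> [/eqP|e]; [rewrite oppr_eq0 => /eqP|rewrite e oppr0].
move=> Om h; exists (intmul 1 : {rmorphism int -> Om}); split=> [s|/=].
  have -> : psi s = s%:~R by rewrite -{1}[s]intz rmorph_int.
  move/absE/eqP; rewrite (pcharf0P _).1 // absz_eq0 => /eqP ->.
  by rewrite rmorph0.
by apply: contraNneq h => /absE ->.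
Qed.

(** * Specializations survive the adjunction of one element *)

Section PolynomialStep.
Variables (S : idomainType) (K : fieldType) (psi : {rmorphism S -> K}) (a : K).

Definition eval_at : {poly S} -> K := horner_eval a \o map_poly psi.
HB.instance Definition _ := GRing.RMorphism.copy eval_at (horner_eval a \o map_poly psi).

Lemma eval_atE P : eval_at P = (map_poly psi P).[a]. Proof. by []. Qed.

Lemma eval_atZ c P : eval_at (c *: P) = psi c * eval_at P.
Proof. by rewrite !eval_atE map_polyZ hornerZ. Qed.

Lemma eval_atD P Q : eval_at (P + Q) = eval_at P + eval_at Q.
Proof. exact: rmorphD. Qed.
Lemma eval_atM P Q : eval_at (P * Q) = eval_at P * eval_at Q.
Proof. exact: rmorphM. Qed.

(** [psi] need not be injective, so a leading coefficient may vanish in [K]; arguments on degrees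
    need lifts whose degree survives. *)
Lemma truncate_poly (P : {poly S}) : exists P' : {poly S},
  map_poly psi P' = map_poly psi P /\ size P' = size (map_poly psi P).
Proof.
set m := size (map_poly psi P); exists (take_poly m P).
have e : map_poly psi (take_poly m P) = map_poly psi P.
  apply/polyP => i; rewrite !coef_map /= coef_take_poly; case: ltnP => // mi.
  by rewrite rmorph0 -(coef_map psi P) nth_default.
split=> //; apply/eqP; rewrite eqn_leq size_take_poly /= /m -[in X in (size X <= _)%N]e.
exact: size_poly.
Qed.

(** A root of [Q - 1] is not a root of [Q]; such a root is missing only if [Q - 1] is a nonzero
    constant, and then [Q] is constant. *)
Lemma nonroot (Om : closedFieldType) (Q : {poly Om}) : Q != 0 -> exists x, Q.[x] != 0.
Proof.
move=> Q0; case: (boolP (size (Q - 1) == 1%N)) => [/size_poly1P[c c0 e]|/closed_rootP[x]].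
  exists 0; have -> : Q = (c + 1)%:P by rewrite polyCD -e subrK.
  rewrite hornerC; apply: contraNneq Q0 => c1.
  by rewrite -[Q](subrK 1) e -polyC1 -polyCD c1.
by exists x; move/rootP: p => /eqP; rewrite !hornerE subr_eq0 => /eqP ->; apply: oner_neq0.
Qed.

Lemma eval_at_point (Om : closedFieldType) (phi : {rmorphism S -> Om}) x (q : {poly S}) :
  (forall P, eval_at P = 0 -> (map_poly phi P).[x] = 0) -> (map_poly phi q).[x] != 0 ->
  exists phi' : {rmorphism {poly S} -> Om}, (forall s, eval_at s = 0 -> phi' s = 0) /\ phi' q != 0.
Proof.
by move=> h hq; exists (horner_eval x \o map_poly phi); split.
Qed.

Lemma map_poly_ker (T : nzRingType) (phi : {rmorphism S -> T}) (P : {poly S}) :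
  (forall s, psi s = 0 -> phi s = 0) -> map_poly psi P = 0 -> map_poly phi P = 0.
Proof.
move=> h P0; apply/polyP => i; rewrite coef0 coef_map /=; apply: h.
by rewrite -(coef_map psi) P0 coef0.
Qed.

(** Some coefficient of [Q] is nonzero in [K]. Once it survives in [Om], the variable can be sent to
    any nonroot of the image of [Q], as the kernel condition is inherited coefficientwise. *)
Lemma many_points_transcendental : (forall P, eval_at P = 0 -> map_poly psi P = 0) ->
  many_points psi -> many_points eval_at.
Proof.
move=> tr mp Q Q0.
have [i qi0] : exists i, psi Q`_i != 0.
  case: (eqVneq (map_poly psi Q) 0) => [e|].
    by move: Q0; rewrite /= eval_atE e horner0 eqxx.
  by rewrite -lead_coef_eq0 lead_coefE coef_map => h; exists (size (map_poly psi Q)).-1.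
have [D D0 hD] := mp _ qi0; exists D => // Om /hD[phi [kphi qphi]].
have [|x xQ] := @nonroot Om (map_poly phi Q).
  by apply: contraNneq qphi => e; rewrite -(coef_map phi) e coef0.
apply: (eval_at_point (phi := phi) (x := x)) => // P /tr/(map_poly_ker kphi) ->.
by rewrite horner0.
Qed.

Section Algebraic.
Variable G : {poly S}.
Hypotheses (Ga : eval_at G = 0) (sG : size G = size (map_poly psi G)) (G0 : G != 0).
Hypothesis minG : forall P, eval_at P = 0 -> map_poly psi P != 0 ->
  (size G <= size (map_poly psi P))%N.

Lemma pseudo_division (P T : {poly S}) : T != 0 -> size T = size (map_poly psi T) ->
  exists c U V, [/\ psi c != 0, c *: P = U * T + V & (size (map_poly psi V) < size T)%N].
Proof.
move=> T0 sT; exists (lead_coef T ^+ scalp P T), (P %/ T), (P %% T); split.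
- rewrite rmorphXn expf_neq0 // lead_coefE sT -(coef_map psi) -lead_coefE lead_coef_eq0.
  by rewrite -size_poly_eq0 -sT size_poly_eq0.
- exact: Pdiv.Idomain.divp_eq.
- by apply: leq_ltn_trans (size_poly _ _) _; rewrite Pdiv.Idomain.ltn_modp.
Qed.

(* The Bezout identity in disguise: [Q] is invertible modulo [G], up to a
   scalar. *)
Lemma pseudo_inverse Q : eval_at Q != 0 -> exists w U V,
  psi w != 0 /\ map_poly psi (U * G + V * Q) = map_poly psi w%:P.
Proof.
move=> Q0; pose good R := exists U V, map_poly psi (U * G + V * Q) = map_poly psi R.
have Ggood : good G by exists 1, 0; rewrite mul1r mul0r addr0.
have goodB R R' U : good R -> good R' -> good (R' - U * R).
  move=> [A [B e]] [A' [B' e']]; exists (A' - U * A), (B' - U * B).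
  rewrite [RHS]rmorphB [in RHS]rmorphM /= -e -e' -rmorphM -rmorphB; congr map_poly.
  by rewrite !mulrBl mulrDr opprD !mulrA addrACA.
have goodZ c R : good R -> good (c *: R).
  move=> [A [B e]]; exists (c *: A), (c *: B).
  by rewrite -!scalerAl -scalerDr !map_polyZ e.
have [R [gR Ra sR ltR]] : exists R, [/\ good R, eval_at R != 0,
    size R = size (map_poly psi R) & (size R < size G)%N].
  have [c [U [V [c0 e lt]]]] := pseudo_division Q G0 sG.
  have [R [eR sR]] := truncate_poly V; exists R; split; last by rewrite sR.
  - have : good V by rewrite (_ : V = c *: Q - U * G);
      [apply: goodB => //; apply: goodZ; exists 0, 1; rewrite mul0r mul1r add0r
      |rewrite e addrC addKr].
    by rewrite /good eR.
  - rewrite eval_atE eR -eval_atE; have := congr1 eval_at e.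
    rewrite eval_atZ eval_atD eval_atM Ga mulr0 add0r => <-.
    by rewrite mulf_neq0.
  - by rewrite eR.
(* Euclidean descent: an [R] that is a combination of [G] and [Q], nonzero at [a] and shorter than
   [G], is replaced by the pseudo-remainder of [G] by [R] until it is constant. *)
have [k] := ubnP (size R); elim: k R gR Ra sR ltR => // k IH R gR Ra sR ltR Rk.
have R0 : R != 0 by apply: contraNneq Ra => ->; rewrite rmorph0.
case: (ltnP 1 (size R)) => [R1|R1]; last first.
  have := size1_polyC R1; set w := R`_0 => eR; exists w.
  have [U [V e]] := gR; exists U, V; rewrite -eR; split=> //.
  by move: Ra; rewrite eR eval_atE map_polyC hornerC.
have [c [U [V [c0 e lt]]]] := pseudo_division G R0 sR.
have eV : V = c *: G - U * R by rewrite e addrC addKr.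
(* Otherwise minimality of [G] makes the remainder zero over [K], and the quotient [U] would vanish
   at [a] while being shorter than [G]. *)
have Va : eval_at V != 0.
  apply/eqP => Va.
  have V0 : map_poly psi V = 0.
    apply/eqP/negPn/negP => /(minG Va); rewrite leqNgt => /negP; apply.
    exact: ltn_trans lt ltR.
  have e' := congr1 (map_poly psi) e; rewrite map_polyZ rmorphD rmorphM /= V0 addr0 in e'.
  have Ua : eval_at U = 0.
    have := congr1 (horner^~ a) e'; rewrite hornerZ hornerM -!eval_atE Ga mulr0.
    by move/esym/eqP; rewrite mulf_eq0 (negbTE Ra) orbF => /eqP.
  have U0 : map_poly psi U != 0.
    apply: contraNneq G0 => U0; move: e'; rewrite U0 mul0r => /eqP.
    rewrite scaler_eq0 (negbTE c0) /= => /eqP mG.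
    by move: sG; rewrite mG size_poly0 => /eqP; rewrite size_poly_eq0.
  have := minG Ua U0; rewrite leqNgt => /negP; apply.
  have := congr1 (fun P : {poly K} => size P) e'; rewrite size_scale // -sG => ->.
  rewrite size_mul //; last by rewrite -size_poly_eq0 -sR size_poly_eq0.
  by rewrite -sR; case: (size R) R1 => [|[|k']] // _; rewrite !addnS /= ltnS leq_addr.
have [R' [eR' sR']] := truncate_poly V.
apply: (IH R'); rewrite ?eR' //.
- suff : good V by rewrite /good eR'.
  by rewrite eV; apply: goodB => //; apply: goodZ.
- by rewrite eval_atE eR'.
- by rewrite sR' (ltn_trans lt ltR).
- by rewrite sR' -ltnS (leq_trans _ Rk) // ltnS.
Qed.

(** Two elements must survive: the leading coefficient of [G], so that [G] keeps a root [x] and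
    pseudo-division by [G] controls the kernel; and [w], so that [U * G + V * Q = w] prevents [Q]
    from vanishing at [x]. *)
Lemma many_points_algebraic : many_points psi -> many_points eval_at.
Proof.
move=> mp Q Q0; have [w [U [V [w0 eW]]]] := pseudo_inverse Q0.
have g0 : psi (lead_coef G) != 0.
  rewrite lead_coefE sG -(coef_map psi) -lead_coefE lead_coef_eq0.
  by rewrite -size_poly_eq0 -sG size_poly_eq0.
have [|D D0 hD] := mp (lead_coef G * w); first by rewrite rmorphM mulf_neq0.
exists D => // Om /hD[phi [kphi]]; rewrite rmorphM mulf_eq0 negb_or => /andP[gphi wphi].
have sGphi : size (map_poly phi G) = size G by rewrite size_map_poly_id0.
have [|x /rootP xG] := closed_rootP (map_poly phi G) _.
  rewrite sGphi; apply/eqP => G1; have := Ga; rewrite (size1_polyC (eq_leq G1)).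
  rewrite eval_atE map_polyC hornerC /= => e; move: g0.
  by rewrite lead_coefE G1 /= e eqxx.
have ker (P P' : {poly S}) : map_poly psi P = map_poly psi P' -> map_poly phi P = map_poly phi P'.
  move/eqP; rewrite -subr_eq0 -rmorphB => /eqP/(map_poly_ker kphi)/eqP.
  by rewrite rmorphB subr_eq0 => /eqP.
apply: (eval_at_point (phi := phi) (x := x)) => [P Pa|].
  have [c [A [B [c0 e lt]]]] : exists c A B, [/\ phi c != 0, c *: P = A * G + B
      & (size (map_poly psi B) < size G)%N].
    exists (lead_coef G ^+ scalp P G), (P %/ G), (P %% G); split.
    - by rewrite rmorphXn expf_neq0.
    - exact: Pdiv.Idomain.divp_eq.
    - by apply: leq_ltn_trans (size_poly _ _) _; rewrite Pdiv.Idomain.ltn_modp.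
  have Ba : eval_at B = 0.
    have := congr1 eval_at e; rewrite eval_atZ Pa mulr0 eval_atD eval_atM Ga mulr0 add0r.
    by move=> <-.
  have B0 : map_poly psi B = 0.
    by apply/eqP/negPn/negP => /(minG Ba); rewrite leqNgt lt.
  have := congr1 (fun T => (map_poly phi T).[x]) e.
  rewrite map_polyZ hornerZ rmorphD rmorphM /= (map_poly_ker kphi B0) addr0 hornerM xG mulr0.
  by move/eqP; rewrite mulf_eq0 (negbTE c0) => /eqP.
apply: contraNneq wphi => Qx; have := congr1 (horner^~ x) (ker _ _ eW).
rewrite map_polyC hornerC rmorphD !rmorphM hornerD !hornerM xG Qx !mulr0 addr0 /=.
by move=> <-.
Qed.

End Algebraic.

Lemma many_points_poly : many_points psi -> many_points eval_at.
Proof.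
move=> mp; case: (pselect (forall P, eval_at P = 0 -> map_poly psi P = 0)) => [tr|].
  exact: many_points_transcendental.
move=> /existsNP[P0 /not_implyP[P0a /eqP P0n]].
pose Q k := `[< exists P, [/\ eval_at P = 0, map_poly psi P != 0 & size (map_poly psi P) = k] >].
have exQ : exists k, Q k by exists (size (map_poly psi P0)); apply/asboolP; exists P0.
case: (ex_minnP exQ) => k /asboolP[P [Pa Pn sP]] mink.
have [G [eG sG]] := truncate_poly P.
apply: (@many_points_algebraic G) => //.
- by rewrite eval_atE eG.
- by rewrite eG.
- by rewrite -size_poly_eq0 sG size_poly_eq0.
- by move=> T Ta Tn; rewrite sG sP; apply: mink; apply/asboolP; exists T.
Qed.

End PolynomialStep.

Lemma many_points_seq (K : fieldType) (s : seq K) : [pchar K] =i pred0 ->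
  exists (S : idomainType) (psi : {rmorphism S -> K}),
    many_points psi /\ forall a, a \in s -> exists u, psi u = a.
Proof.
move=> K0; elim: s => [|a s [S [psi [mp hs]]]].
  by exists int, (intmul 1 : {rmorphism int -> K}); split=> //; apply: many_points_int.
exists {poly S}, (eval_at psi a); split; first exact: many_points_poly.
move=> b; rewrite inE => /orP[/eqP ->|/hs[u <-]].
  by exists 'X; rewrite /= eval_atE map_polyX hornerX.
by exists u%:P; rewrite /= eval_atE map_polyC hornerC.
Qed.

Section ImageRing.
Variables (S : comNzRingType) (K : fieldType) (psi : {rmorphism S -> K}).

Definition in_image : {pred K} := [pred x | `[< exists u, psi u = x >]].
Lemma in_imageP x : reflect (exists u, psi u = x) (x \in in_image).
Proof. exact: asboolP. Qed.

Fact image_subring : subring_closed in_image.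
Proof.
split=> [|x y|x y]; first by apply/in_imageP; exists 1; rewrite rmorph1.
  by move=> /in_imageP[u <-] /in_imageP[v <-]; apply/in_imageP; exists (u - v); rewrite rmorphB.
by move=> /in_imageP[u <-] /in_imageP[v <-]; apply/in_imageP; exists (u * v); rewrite rmorphM.
Qed.
HB.instance Definition _ := GRing.isSubringClosed.Build K in_image image_subring.

(** Relations are pulled back along an injection into [K]. As [psi] need not be injective, its
    source is replaced by its image, through which every [phi] killing the kernel factors. *)
Record image_ring : predArgType := ImageRing { image_val :> K; _ : image_val \in in_image }.
HB.instance Definition _ := [isSub for image_val].
HB.instance Definition _ := [Choice of image_ring by <:].
HB.instance Definition _ := [SubChoice_isSubComNzRing of image_ring by <:].

Definition image_incl : {rmorphism image_ring -> K} := (val : image_ring -> K).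

Lemma image_point (Om : fieldType) (phi : {rmorphism S -> Om}) :
  (forall s, psi s = 0 -> phi s = 0) ->
  exists phi' : {rmorphism image_ring -> Om}, forall s x, image_val x = psi s -> phi' x = phi s.
Proof.
move=> ker; have inP (x : image_ring) : exists u, psi u = val x by apply/in_imageP; case: x.
have eqphi s t : psi s = psi t -> phi s = phi t.
  move=> e; apply/eqP; rewrite -subr_eq0 -rmorphB; apply/eqP/ker.
  by rewrite rmorphB e subrr.
have [u uP] := choice inP; pose f x := phi (u x).
have fE s x : val x = psi s -> f x = phi s by move=> e; apply: eqphi; rewrite uP.
have fB : zmod_morphism f.
  by move=> x y; rewrite /f -rmorphB; apply: fE; rewrite [RHS]rmorphB !uP.
have fM : monoid_morphism f.
  split; first by rewrite -(rmorph1 phi); apply: fE; rewrite !rmorph1.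
  by move=> x y; rewrite /f -rmorphM; apply: fE; rewrite [RHS]rmorphM !uP.
pose g : {rmorphism image_ring -> Om} := HB.pack f
  (GRing.isZmodMorphism.Build image_ring Om f fB) (GRing.isMonoidMorphism.Build image_ring Om f fM).
by exists g.
Qed.

End ImageRing.

(** * Transport of the Galois datum along ring morphisms *)

Section RelationTransport.
Variables (T T' : nzRingType) (f : {rmorphism T -> T'}) (n : nat).
Variables (u v : 'I_n -> T) (u' v' : 'I_n -> T').
Hypotheses (fu : forall i, f (u i) = u' i) (fv : forall i, f (v i) = v' i).

Lemma weyl_rels_push : weyl_rels u v -> weyl_rels u' v'.
Proof.
case=> uu vv vu; split=> i j; rewrite -?fu -?fv -!rmorphM.
- by rewrite uu.
- by rewrite vv.
- by rewrite vu rmorphD rmorph_nat.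
Qed.

Lemma weyl_rels_pull : injective f -> weyl_rels u' v' -> weyl_rels u v.
Proof.
move=> fI [uu vv vu]; split=> i j; apply: fI; rewrite ?rmorphD ?rmorphM ?fu ?fv.
- exact: uu.
- exact: vv.
- by rewrite rmorph_nat; exact: vu.
Qed.

End RelationTransport.

Section Transport.
Variables (R R' : comNzRingType) (n d r : nat) (phi : {rmorphism R -> R'}).
Notation W := (weyl R n).
Notation W' := (weyl R' n).
Notation wm := (@weyl_map R R' n phi).
Notation wmx := (map_mx wm).

Lemma wmx_scalar (a : W) : wmx (a%:M : 'M[W]_d.+1) = (wm a)%:M.
Proof. exact: map_scalar_mx. Qed.

Lemma morphism_transport (rho : {rmorphism W -> 'M[W]_d.+1}) (rho' : {rmorphism W' -> 'M[W']_d.+1}) :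
  (forall c, rho c%:A = (c%:A)%:M) -> (forall c, rho' c%:A = (c%:A)%:M) ->
  (forall i, wmx (rho (wx R i)) = rho' (wx R' i)) ->
  (forall i, wmx (rho (wy R i)) = rho' (wy R' i)) -> forall f, wmx (rho f) = rho' (wm f).
Proof.
move=> rZ rZ' hx hy.
apply: (@eq_weyl_morphism _ _ _ (map_mx wm \o rho : {rmorphism W -> 'M[W']_d.+1})
  (rho' \o wm : {rmorphism W -> 'M[W']_d.+1})) => [i|i|c] /=.
- by rewrite hx weyl_map_x.
- by rewrite hy weyl_map_y.
- by rewrite rZ weyl_map_alg rZ' wmx_scalar weyl_map_alg.
Qed.

Definition scalar_alg (T : comNzRingType) : {rmorphism T -> 'M[weyl T n]_d.+1} :=
  @scalar_mx (weyl T n) d.+1 \o GRing.in_alg (weyl T n).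

Lemma matrix_morphism (T : comNzRingType) (u v : 'I_n -> 'M[weyl T n]_d.+1) : weyl_rels u v ->
  exists rho : {rmorphism weyl T n -> 'M[weyl T n]_d.+1},
  [/\ forall c, rho c%:A = (c%:A)%:M, forall i, rho (wx T i) = u i & forall i, rho (wy T i) = v i].
Proof.
move=> uv; have gC (c : T) (U : 'M[weyl T n]_d.+1) : scalar_alg T c * U = U * scalar_alg T c.
  by apply/matrixP => i j; rewrite scalar_mulE mul_scalarE /= mulr_algl mulr_algr.
by have [rho [hx hy hc]] := weyl_morphism gC uv; exists rho; split.
Qed.

Section Datum.
Variables (rho sigma : {rmorphism W -> 'M[W]_d.+1}) (rho' sigma' : {rmorphism W' -> 'M[W']_d.+1}).
Hypotheses (hr : forall f, wmx (rho f) = rho' (wm f)) (hs : forall f, wmx (sigma f) = sigma' (wm f)).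
Variables (b c1 : 'I_r -> W) (cx cy : 'I_n -> 'I_r -> 'I_r -> W).
Variables (M N : 'M[R]_d.+1) (aM aN : 'I_r -> W).
Hypotheses (rZ : forall c, rho c%:A = (c%:A)%:M) (sZ : forall c, sigma c%:A = (c%:A)%:M).
Hypotheses (rZ' : forall c, rho' c%:A = (c%:A)%:M) (sZ' : forall c, sigma' c%:A = (c%:A)%:M).

Let Psi_map a l j :
  wm (\sum_q sigma (rho a q j) q l) = \sum_q sigma' (rho' (wm a) q j) q l.
Proof.
rewrite (big_morph wm (@weyl_mapD R R' n phi) (raddf0 _)); apply: eq_bigr => q _.
have e (U : 'M[W]_d.+1) i i' : wm (U i i') = wmx U i i' by rewrite mxE.
by rewrite e hs e hr.
Qed.

Let dot_map (c e : 'I_r -> W) : wm (\sum_s c s * e s) = \sum_s wm (c s) * wm (e s).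
Proof.
rewrite (big_morph wm (@weyl_mapD R R' n phi) (raddf0 _)); apply: eq_bigr => s _.
exact: weyl_mapM.
Qed.

Let alg_map (X : 'M[R]_d.+1) :
  wmx (map_mx (GRing.in_alg W) X) = map_mx (GRing.in_alg W') (map_mx phi X).
Proof. by apply/matrixP => i j; rewrite !mxE weyl_map_alg. Qed.

Let lin_map (a e : 'I_r -> W) :
  wmx (\sum_s (a s)%:M * rho (e s)) = \sum_s (wm (a s))%:M * rho' (wm (e s)).
Proof.
rewrite (rmorph_sum (map_mx wm : {rmorphism 'M[W]_d.+1 -> 'M[W']_d.+1})).
apply: eq_bigr => s _; rewrite rmorphM; congr (_ * _); [exact: wmx_scalar|exact: hr].
Qed.

Let muln_map (w : W) (l j : 'I_d.+1) : wm (w *+ (l == j)) = wm w *+ (l == j).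
Proof. exact: raddfMn. Qed.

Notation datum := (galois_datum rho sigma b c1 cx cy M N aM aN).
Notation datum' := (galois_datum rho' sigma' (wm \o b) (wm \o c1) (fun i s t => wm (cx i s t))
  (fun i s t => wm (cy i s t)) (map_mx phi M) (map_mx phi N) (wm \o aM) (wm \o aN)).

Lemma datum_push : datum -> datum'.
Proof.
case=> _ [hx hy] [h1 h2 h3] [g1 g2 g3] [eM eN]; split=> //.
- split=> i l j; first by rewrite -(weyl_map_x phi) -Psi_map hx muln_map.
  by rewrite -(weyl_map_y phi) -Psi_map hy muln_map.
- split=> [s|i s t|i s t].
  + by rewrite -[LHS]hr h1 wmx_scalar.
  + by rewrite -[LHS]hr h2 wmx_scalar.
  + by rewrite -[LHS]hr h3 wmx_scalar.
- split=> [|i s|i s]; first by rewrite -(weyl_map1 n phi) g1 dot_map.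
  + by rewrite -(weyl_map_x phi) -weyl_mapM g2 dot_map.
  + by rewrite -(weyl_map_y phi) -weyl_mapM g3 dot_map.
- by split; rewrite -alg_map ?eM ?eN lin_map.
Qed.

Lemma datum_pull : injective phi -> datum' -> datum.
Proof.
move=> phi_inj; have wI := @weyl_map_inj R R' n phi phi_inj.
have wxI : injective (wmx : 'M[W]_d.+1 -> _).
  move=> U V /matrixP UV; apply/matrixP => i j; apply: wI.
  by have := UV i j; rewrite !mxE.
case=> _ [hx hy] [h1 h2 h3] [g1 g2 g3] [eM eN]; split=> //.
- split=> i l j; apply: wI; rewrite Psi_map muln_map.
    by rewrite weyl_map_x hx.
  by rewrite weyl_map_y hy.
- split=> [s|i s t|i s t]; apply: wxI; rewrite hr wmx_scalar.
  + exact: h1.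
  + exact: h2.
  + exact: h3.
- split=> [|i s|i s]; apply: wI; rewrite ?weyl_map1 ?weyl_mapM dot_map.
  + exact: g1.
  + by rewrite weyl_map_x; exact: g2.
  + by rewrite weyl_map_y; exact: g3.
- by split; apply: wxI; rewrite alg_map lin_map.
Qed.

End Datum.
End Transport.

Lemma closed_field_root (Om : closedFieldType) p (c : Om) : (0 < p)%N -> exists r, r ^+ p = c.
Proof.
move=> p0; have [x e] := @solve_monicpoly Om p (fun i => c *+ (i == 0)%N) p0.
exists x; rewrite e; case: p p0 {e} => // p _.
by rewrite big_ord_recl big1 => [|i _]; rewrite ?mulr1 ?addr0 // mul0r.
Qed.

Lemma closed_field_pchar p : prime p -> exists Om : closedFieldType, p \in [pchar Om].
Proof.
move=> pp; have [Om [f _]] := @countable_algebraic_closure 'F_p.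
exists Om; apply: (rmorph_pchar f); exact: pchar_Fp.
Qed.

Section Transfer.
Variables (k : fieldType) (char0 : [pchar k] =i pred0) (n d r : nat).
Notation W := (weyl k n).
Variables (rho sigma : {rmorphism W -> 'M[W]_d.+1}).
Variables (b c1 : 'I_r -> W) (cx cy : 'I_n -> 'I_r -> 'I_r -> W).
Variables (M N : 'M[k]_d.+1) (aM aN : 'I_r -> W).
Hypothesis dat : galois_datum rho sigma b c1 cx cy M N aM aN.

Let entries (tau : {rmorphism W -> 'M[W]_d.+1}) : seq W :=
  codom (fun t : 'I_n * ('I_d.+1 * 'I_d.+1) => tau (wx k t.1) t.2.1 t.2.2) ++
  codom (fun t : 'I_n * ('I_d.+1 * 'I_d.+1) => tau (wy k t.1) t.2.1 t.2.2).

Let ws : seq W := entries rho ++ entries sigma ++ codom b ++ codom c1 ++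
  codom (fun t : 'I_n * ('I_r * 'I_r) => cx t.1 t.2.1 t.2.2) ++
  codom (fun t : 'I_n * ('I_r * 'I_r) => cy t.1 t.2.1 t.2.2) ++ codom aM ++ codom aN.

Let coefs (g : W) : seq k := [seq mcoeff m g | m <- msupp g].

Let scal : seq k := flatten (map coefs ws) ++
  codom (fun t : 'I_d.+1 * 'I_d.+1 => M t.1 t.2) ++
  codom (fun t : 'I_d.+1 * 'I_d.+1 => N t.1 t.2).

Section Lift.
Variables (R : comNzRingType) (iota : {rmorphism R -> k}).
Hypotheses (iota_inj : injective iota) (iota_scal : forall a, a \in scal -> exists u, iota u = a).
Notation wm := (@weyl_map R k n iota).

Lemma lift_ws g : g \in ws -> exists f, wm f = g.
Proof.
move=> gws; apply: weyl_map_lift => m gm; apply: iota_scal.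
rewrite mem_cat; apply/orP; left; apply/flatten_mapP; exists g => //.
by apply: map_f; rewrite mcoeff_msupp.
Qed.

Lemma lift_family (I : finType) (f : I -> W) : {subset codom f <= ws} ->
  exists g : I -> weyl R n, forall i, wm (g i) = f i.
Proof. by move=> h; have [g gE] := choice (fun i => lift_ws (h _ (codom_f f i))); exists g. Qed.

Lemma lift_scalars (f : 'I_d.+1 * 'I_d.+1 -> k) : {subset codom f <= scal} ->
  exists X : 'M[R]_d.+1, forall i j, iota (X i j) = f (i, j).
Proof.
move=> h; have [g gE] := choice (fun ij => iota_scal (h _ (codom_f f ij))).
by exists (\matrix_(i, j) g (i, j)) => i j; rewrite mxE gE.
Qed.

(** Only the images of generators are lifted; the lifted matrices satisfy the Weyl relations because
    their images over [k] do and [iota] is injective. *)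
Lemma lift_morphism (tau : {rmorphism W -> 'M[W]_d.+1}) : {subset entries tau <= ws} ->
  (forall c, tau c%:A = (c%:A)%:M) ->
  exists tauR : {rmorphism weyl R n -> 'M[weyl R n]_d.+1},
    (forall c, tauR c%:A = (c%:A)%:M) /\ forall f, map_mx wm (tauR f) = tau (wm f).
Proof.
move=> sub tZ.
have [|g gE] := @lift_family _ (fun t : 'I_n * ('I_d.+1 * 'I_d.+1) => tau (wx k t.1) t.2.1 t.2.2).
  by move=> x hx; apply: sub; rewrite mem_cat hx.
have [|g' g'E] := @lift_family _ (fun t : 'I_n * ('I_d.+1 * 'I_d.+1) => tau (wy k t.1) t.2.1 t.2.2).
  by move=> x hx; apply: sub; rewrite mem_cat hx orbT.
pose u i : 'M[weyl R n]_d.+1 := \matrix_(l, j) g (i, (l, j)).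
pose v i : 'M[weyl R n]_d.+1 := \matrix_(l, j) g' (i, (l, j)).
have uE i : map_mx wm (u i) = tau (wx k i) by apply/matrixP => l j; rewrite !mxE gE.
have vE i : map_mx wm (v i) = tau (wy k i) by apply/matrixP => l j; rewrite !mxE g'E.
have wI : injective (map_mx wm : 'M[weyl R n]_d.+1 -> _).
  move=> U V /matrixP UV; apply/matrixP => i j; apply: (weyl_map_inj iota_inj).
  by have := UV i j; rewrite !mxE.
have rels : weyl_rels u v.
  apply: (weyl_rels_pull uE vE wI).
  exact: (weyl_rels_push (f := tau) (fun=> erefl) (fun=> erefl) (weyl_rels_gen k n)).
have [tauR [tRZ tx ty]] := matrix_morphism rels.
exists tauR; split=> // f; apply: morphism_transport => // i; first by rewrite tx uE.
by rewrite ty vE.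
Qed.

End Lift.

Theorem galois_datum_commute : M * N = N * M.
Proof.
case: (dat) => [[rZ sZ] _ _ _ _].
apply/matrixP => i j; apply/eqP; rewrite -subr_eq0; apply/negPn/negP => MNn.
pose e := (M * N) i j - (N * M) i j.
(* The entry [e] joins the list so that the point can be chosen where it does not vanish. *)
have [S [psi [mp hs]]] := many_points_seq (e :: scal) char0.
have [q qe] := hs e (mem_head _ _).
have [|D D0 hD] := mp q; first by rewrite qe.
(* [charp_commute] asks for [r < p], and [0 < D < p] keeps [D] nonzero in characteristic [p]. *)
have [p lt_p pp] := prime_above (maxn r D).
have [Om Omp] := closed_field_pchar pp.
have [|phi [kphi phiq]] := hD Om.
  rewrite -(dvdn_pcharf Omp) gtnNdvd //; exact: leq_ltn_trans (leq_maxr _ _) lt_p.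
have [phi' phi'E] := image_point kphi.
pose R : comNzRingType := image_ring psi.
pose iota : {rmorphism R -> k} := image_incl psi.
have iota_inj : injective iota by exact: val_inj.
have iota_scal a : a \in scal -> exists u, iota u = a.
  move=> ha; have [|u ue] := hs a; first by rewrite inE ha orbT.
  have ina : a \in in_image psi by apply/in_imageP; exists u.
  by exists (ImageRing ina).
have [rhoR [rRZ rRE]] : exists tauR : {rmorphism weyl R n -> 'M[weyl R n]_d.+1},
    (forall c, tauR c%:A = (c%:A)%:M) /\
    forall f, map_mx (@weyl_map R k n iota) (tauR f) = rho (@weyl_map R k n iota f).
  by apply: lift_morphism => // x hx; rewrite /ws mem_cat hx.
have [sigmaR [sRZ sRE]] : exists tauR : {rmorphism weyl R n -> 'M[weyl R n]_d.+1},
    (forall c, tauR c%:A = (c%:A)%:M) /\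
    forall f, map_mx (@weyl_map R k n iota) (tauR f) = sigma (@weyl_map R k n iota f).
  by apply: lift_morphism => // x hx; rewrite /ws mem_cat (mem_cat x (entries sigma)) hx orbT.
have lf := lift_family iota_scal.
have [|bR bE] := lf _ b; first by move=> x hx; rewrite /ws !mem_cat hx ?orbT.
have [|cR cE] := lf _ c1; first by move=> x hx; rewrite /ws !mem_cat hx ?orbT.
have [|aMR aME] := lf _ aM; first by move=> x hx; rewrite /ws !mem_cat hx ?orbT.
have [|aNR aNE] := lf _ aN; first by move=> x hx; rewrite /ws !mem_cat hx ?orbT.
have [|cxR cxE] := lf _ (fun t : 'I_n * ('I_r * 'I_r) => cx t.1 t.2.1 t.2.2).
  by move=> x hx; rewrite /ws !mem_cat hx ?orbT.
have [|cyR cyE] := lf _ (fun t : 'I_n * ('I_r * 'I_r) => cy t.1 t.2.1 t.2.2).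
  by move=> x hx; rewrite /ws !mem_cat hx ?orbT.
have [|MR ME] := lift_scalars iota_scal (f := fun t => M t.1 t.2).
  by move=> x hx; rewrite /scal !mem_cat hx ?orbT.
have [|NR NE] := lift_scalars iota_scal (f := fun t => N t.1 t.2).
  by move=> x hx; rewrite /scal !mem_cat hx ?orbT.
have MRE : map_mx iota MR = M by apply/matrixP => l l'; rewrite mxE ME.
have NRE : map_mx iota NR = N by apply/matrixP => l l'; rewrite mxE NE.
have datR : galois_datum rhoR sigmaR bR cR (fun i s t => cxR (i, (s, t)))
    (fun i s t => cyR (i, (s, t))) MR NR aMR aNR.
  have bRE : @weyl_map R k n iota \o bR = b by apply/funext.
  have cRE : @weyl_map R k n iota \o cR = c1 by apply/funext.
  have aMRE : @weyl_map R k n iota \o aMR = aM by apply/funext.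
  have aNRE : @weyl_map R k n iota \o aNR = aN by apply/funext.
  have cxRE : (fun i s t => @weyl_map R k n iota (cxR (i, (s, t)))) = cx.
    by apply/funext => ?; apply/funext => ?; apply/funext => ?; rewrite cxE.
  have cyRE : (fun i s t => @weyl_map R k n iota (cyR (i, (s, t)))) = cy.
    by apply/funext => ?; apply/funext => ?; apply/funext => ?; rewrite cyE.
  have := dat; rewrite -bRE -cRE -aMRE -aNRE -cxRE -cyRE -MRE -NRE.
  exact: (datum_pull rRE sRE rRZ sRZ iota_inj).
have push (tauR : {rmorphism weyl R n -> 'M[weyl R n]_d.+1}) :
    (forall c, tauR c%:A = (c%:A)%:M) ->
    exists tau : {rmorphism weyl Om n -> 'M[weyl Om n]_d.+1}, (forall c, tau c%:A = (c%:A)%:M) /\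
      forall f, map_mx (@weyl_map R Om n phi') (tauR f) = tau (@weyl_map R Om n phi' f).
  move=> tRZ; pose mu : {rmorphism 'M[weyl R n]_d.+1 -> 'M[weyl Om n]_d.+1} :=
    map_mx (@weyl_map R Om n phi').
  have rels := weyl_rels_push (f := mu \o tauR) (fun=> erefl) (fun=> erefl) (weyl_rels_gen R n).
  have [tau [tZ tx ty]] := matrix_morphism rels.
  by exists tau; split=> // f; apply: morphism_transport.
have [rhoO [rOZ rOE]] := push _ rRZ; have [sigmaO [sOZ sOE]] := push _ sRZ.
have datO := datum_push rOE sOE rOZ sOZ datR.
have perf (c : Om) : exists r, r ^+ p = c by apply: closed_field_root; exact: prime_gt0.
have comm := charp_commute Omp perf datO (leq_ltn_trans (leq_maxl _ _) lt_p).
have eR : iota ((MR * NR - NR * MR) i j) = psi q.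
  transitivity (map_mx iota (MR * NR - NR * MR) i j); first by rewrite [RHS]mxE.
  by rewrite rmorphB !rmorphM /= MRE NRE qe /e mxE [X in _ + X]mxE.
have := phi'E _ _ eR; have -> : phi' ((MR * NR - NR * MR) i j) = 0.
  transitivity (map_mx phi' (MR * NR - NR * MR) i j); first by rewrite [RHS]mxE.
  by rewrite rmorphB !rmorphM /= comm subrr mxE.
by move/esym/eqP; rewrite (negbTE phiq).
Qed.

End Transfer.

(** * Matrix coefficients and integrals of a Hopf algebra *)

Section DualBases.
Variables (k : fieldType) (H : falgType k).

(** The dimension is written [d.+1] because square matrices form a nonzero ring only in positive
    size. *)
Lemma dual_bases : exists (d : nat) (e : 'I_d.+1 -> H) (cf : 'I_d.+1 -> H -> k),
  [/\ forall i, linear (cf i : H -> k^o), forall h, h = \sum_i cf i h *: e i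
    & forall i j, cf i (e j) = (i == j)%:R].
Proof.
have dim_gt0 : (0 < \dim {:H})%N.
  by rewrite lt0n dimv_eq0; apply/eqP => H0; have := memvf (1 : H);
     rewrite H0 memv0 oner_eq0.
have e : (\dim {:H}).-1.+1 = \dim {:H} by rewrite prednK.
exists (\dim {:H}).-1, (fun i => (vbasis {:H})`_i),
  (fun i => coord (vbasis {:H}) (cast_ord e i)); split=> [i|h|i j].
- by move=> a x y; rewrite linearP.
- rewrite [LHS](coord_vbasis (memvf h)); rewrite [LHS](reindex (cast_ord e)) //.
  by exists (cast_ord (esym e)) => i _; rewrite ?cast_ordK ?cast_ordKV.
- have -> : (vbasis {:H})`_j = (vbasis {:H})`_(cast_ord e j) by [].
  by rewrite coord_free ?(basis_free (vbasisP _)) // (inj_eq (@cast_ord_inj _ _ e)) eq_sym.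
Qed.
End DualBases.

Section TensorCoordinates.
Variables (k : fieldType) (H : hopfAlgType k) (d : nat).
Variables (e : 'I_d.+1 -> H) (cf : 'I_d.+1 -> H -> k).
Hypotheses (cf_lin : forall i, linear (cf i : H -> k^o)) (cfE : forall h, h = \sum_i cf i h *: e i).
Hypothesis cf_e : forall i j, cf i (e j) = (i == j)%:R.

Lemma linear_sumE (V W : lmodType k) (g : V -> W) (I : Type) (s : seq I) (F : I -> V) :
  linear g -> g (\sum_(i <- s) F i) = \sum_(i <- s) g (F i).
Proof. by move=> gl; rewrite (big_morph g (linD gl) (lin0 gl)). Qed.

Lemma ktens_suml (M N : lmodType k) (I : Type) (s : seq I) (F : I -> M) (y : N) :
  (\sum_(i <- s) F i) \ox y = \sum_(i <- s) F i \ox y.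
Proof. by rewrite (linear_sumE (g := fun x => x \ox y)) //; exact: (ktens_bilin _ _).1. Qed.
Lemma ktens_sumr (M N : lmodType k) (I : Type) (s : seq I) (F : I -> N) (x : M) :
  x \ox (\sum_(i <- s) F i) = \sum_(i <- s) x \ox F i.
Proof. by rewrite (linear_sumE (g := fun y => x \ox y)) //; exact: (ktens_bilin _ _).2. Qed.

Lemma klift_sum (M N V : lmodType k) (f : M -> N -> V) (I : Type) (s : seq I) (F : I -> ktensor M N) :
  bilin f -> klift f (\sum_(i <- s) F i) = \sum_(i <- s) klift f (F i).
Proof. by move=> bf; apply: linear_sumE; apply: klift_linear. Qed.

Lemma slice_bilin (V : lmodType k) (f : H -> k) : linear (f : H -> k^o) ->
  bilin (fun (x : V) (y : H) => f y *: x).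
Proof.
move=> lf; split=> [y|x] a v w; first by rewrite scalerDr !scalerA mulrC.
by rewrite lf scalerDl scalerA.
Qed.

Definition slice (V : lmodType k) (f : H -> k) (t : ktensor V H) : V :=
  klift (fun x y => f y *: x) t.

Lemma slice_tens (V : lmodType k) (f : H -> k) (x : V) y :
  linear (f : H -> k^o) -> slice f (x \ox y) = f y *: x.
Proof. by move=> lf; rewrite /slice klift_tens //; apply: slice_bilin. Qed.
Lemma slice_linear (V : lmodType k) (f : H -> k) : linear (f : H -> k^o) -> linear (@slice V f).
Proof. by move=> lf; apply: klift_linear; apply: slice_bilin. Qed.

Lemma tensor_coord (V : lmodType k) (t : ktensor V H) : t = \sum_j slice (cf j) t \ox e j.
Proof.
move: t; apply: ktensor_ind => [|t t' ht ht'|x y].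
- rewrite big1 // => j _; rewrite (lin0 (slice_linear (cf_lin j))).
  exact: (lin0 ((ktens_bilin _ _).1 _)).
- rewrite {1}ht {1}ht' -big_split; apply: eq_bigr => j _.
  by rewrite (linD (slice_linear (cf_lin j))) ktensDl.
- rewrite {1}(cfE y) ktens_sumr; apply: eq_bigr => j _.
  by rewrite slice_tens // ktensZlr.
Qed.

(* The matrix coefficients of the regular comodule in the basis [e]. *)
Definition mcf (l j : 'I_d.+1) : H := slice (cf j) (comul (e l)).
Local Notation u := mcf.

Lemma comul_e l : comul (e l) = \sum_j u l j \ox e j.
Proof. exact: tensor_coord. Qed.

(** Coassociativity at [e l], with the last tensor factor contracted by [cf j]. *)
Lemma comul_mcf l j : comul (u l j) = \sum_q u l q \ox u q j.
Proof.
have lc := @comul_linear k H; have lid : linear (@id H) by [].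
have ls := slice_linear (V := H) (cf_lin j).
have L : linear (tmap id (slice (cf j)) \o @tassoc k H H H).
  exact: (lin_comp (@tassoc_linear k H H H) (tmap_linear lid ls)).
have := congr1 (tmap id (slice (cf j))) (comulA (e l)).
rewrite {1}comul_e (linear_sumE _ _ (tmap_linear lc lid)) comul_e (linear_sumE _ _ (tmap_linear lid lc)).
rewrite (linear_sumE _ _ (@tassoc_linear k H H H)) !(linear_sumE _ _ (tmap_linear lid ls)).
have lhs i : tmap id (slice (cf j)) (tassoc (tmap comul id (u l i \ox e i))) =
    (i == j)%:R *: comul (u l i).
  rewrite tmap_tens //; move: (comul (u l i)); apply: ktensor_ext.
  - apply: (lin_comp _ L); exact: (ktens_bilin _ _).1.
  - by move=> a x y; rewrite scalerDr !scalerA mulrC.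
  - by move=> x y /=; rewrite tassoc_tens tmap_tens // slice_tens // cf_e eq_sym ktensZr.
under eq_bigr => i _ do rewrite lhs.
rewrite (bigD1 j) //= eqxx scale1r big1 ?addr0 => [->|i /negbTE ->]; last by rewrite scale0r.
by apply: eq_bigr => q _; rewrite !tmap_tens.
Qed.

Lemma counit_mcf l j : counit (u l j) = (l == j)%:R.
Proof.
have bl : bilin (fun x y : H => counit x *: y).
  split=> [y|x] a v w; first by rewrite counit_scalar scalerDl scalerA.
  by rewrite scalerDr !scalerA mulrC.
have := counitL (e l); rewrite comul_e (klift_sum _ _ bl) => h.
have := congr1 (cf j) h; rewrite cf_e eq_sym => <-; rewrite (linear_sumE _ _ (cf_lin j)).
rewrite (bigD1 j) //= big1 ?addr0 => [|i ij]; rewrite klift_tens // (linZ (cf_lin j)) cf_e.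
  by rewrite eqxx -[RHS]/(_ * _) mulr1.
by rewrite eq_sym (negbTE ij) -[LHS]/(_ * _) mulr0.
Qed.

Lemma e_mcf l : e l = \sum_j counit (e j) *: u l j.
Proof.
have bl : bilin (fun x y : H => counit y *: x) by apply: slice_bilin; exact: counit_scalar.
rewrite -{1}(counitR (e l)) comul_e (klift_sum _ _ bl); apply: eq_bigr => j _.
by rewrite klift_tens.
Qed.

(** The matrix coefficients span [H] by [e_mcf]; identities in Sweedler notation can thus be
    verified as matrix identities in the [u l j]. *)
Lemma mcf_ext (V : lmodType k) (F G : H -> V) : linear F -> linear G ->
  (forall l j, F (u l j) = G (u l j)) -> F =1 G.
Proof.
move=> lF lG FG h; have FGe i : F (e i) = G (e i).
  rewrite e_mcf (linear_sumE _ _ lF) (linear_sumE _ _ lG); apply: eq_bigr => j _.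
  by rewrite (linZ lF) (linZ lG) FG.
rewrite (cfE h) (linear_sumE _ _ lF) (linear_sumE _ _ lG); apply: eq_bigr => i _.
by rewrite (linZ lF) (linZ lG) FGe.
Qed.

Lemma klift_mcf (V : lmodType k) (f : H -> H -> V) l j : bilin f ->
  klift f (comul (u l j)) = \sum_q f (u l q) (u q j).
Proof.
by move=> bf; rewrite comul_mcf (klift_sum _ _ bf); apply: eq_bigr => q _; rewrite klift_tens.
Qed.

Local Notation S := (@antipode k H).
Let S_lin := @antipode_linear k H.

Lemma antipode_mcfl l j : \sum_q S (u l q) * u q j = (l == j)%:R.
Proof.
have := antipodeL (u l j); rewrite klift_mcf; last exact: (mul_lin_bilin S_lin (fun _ _ _ => erefl)).
by move=> ->; rewrite counit_mcf scaler_nat.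
Qed.
Lemma antipode_mcfr l j : \sum_q u l q * S (u q j) = (l == j)%:R.
Proof.
have := antipodeR (u l j).
rewrite klift_mcf; last exact: (mul_lin_bilin (f := id) (fun _ _ _ => erefl) S_lin).
by move=> ->; rewrite counit_mcf scaler_nat.
Qed.

Lemma antipode1 : S 1 = 1.
Proof.
have := antipodeL (1 : H); rewrite (@comul_monoid k H).1 ktensor_1E klift_tens.
  by rewrite mulr1 (@counit_monoid k H).1 scale1r.
exact: (mul_lin_bilin S_lin (fun _ _ _ => erefl)).
Qed.

Lemma sum_delta (V : nmodType) (i : 'I_d.+1) (F : 'I_d.+1 -> V) :
  \sum_q F q *+ (i == q) = F i.
Proof.
rewrite (bigD1 i) //= eqxx big1 ?addr0 // => q /negbTE; rewrite eq_sym => -> //.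
Qed.

Lemma klift_mcf2 (V : lmodType k) (f : H -> H -> V) l j l' j' : bilin f ->
  klift f (comul (u l j * u l' j')) =
  \sum_q \sum_q' f (u l q * u l' q') (u q j * u q' j').
Proof.
move=> bf; rewrite (@comul_monoid k H).2 !comul_mcf mulr_suml (klift_sum _ _ bf).
apply: eq_bigr => q _; rewrite mulr_sumr (klift_sum _ _ bf); apply: eq_bigr => q' _.
by rewrite ktensM klift_tens.
Qed.

(** Uniqueness of convolution inverses: [X] is a left inverse and [Z] a right inverse of the
    multiplication [Y] of [H]. *)
Lemma antipodeM a b : S (a * b) = S b * S a.
Proof.
have mull (x : H) : linear ( *%R^~ x) by move=> c y z; rewrite mulrDl scalerAl.
move: a; apply: mcf_ext => [||l j].
- exact: (lin_comp (mull b) S_lin).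
- exact: (lin_comp S_lin (@mulr_lin k H _)).
move: b; apply: mcf_ext => [||l' j'].
- exact: (lin_comp (@mulr_lin k H _) S_lin).
- exact: (lin_comp S_lin (mull _)).
pose X q q' := S (u l q * u l' q').
pose Y q q' r r' := u q r * u q' r'; pose Z r r' := S (u r' j') * S (u r j).
have XY r r' : \sum_q \sum_q' X q q' * Y q q' r r' = (l == r)%:R * (l' == r')%:R.
  have := antipodeL (u l r * u l' r'); rewrite klift_mcf2.
    move=> ->; rewrite (@counit_monoid k H).2 !counit_mcf.
    by case: (l == r); case: (l' == r'); rewrite ?(mulr1, mulr0, scale1r, scale0r).
  exact: (mul_lin_bilin S_lin (fun _ _ _ => erefl)).
have YZ q q' : \sum_r \sum_r' Y q q' r r' * Z r r' = (q == j)%:R * (q' == j')%:R.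
  rewrite -antipode_mcfr mulr_suml; apply: eq_bigr => r _.
  have -> : \sum_r' Y q q' r r' * Z r r' = u q r * (\sum_r' u q' r' * S (u r' j')) * S (u r j).
    by rewrite mulr_sumr mulr_suml; apply: eq_bigr => r' _; rewrite !mulrA.
  by rewrite antipode_mcfr; case: (q' == j'); rewrite ?(mulr1, mulr0, mul0r).
have deltar (b' : bool) (x : H) : x * b'%:R = x *+ b' by case: b'; rewrite ?mulr1 ?mulr0.
have deltal (b' : bool) (x : H) : b'%:R * x = x *+ b' by case: b'; rewrite ?mul1r ?mul0r.
transitivity (\sum_q \sum_q' X q q' * \sum_r \sum_r' Y q q' r r' * Z r r').
  rewrite -[LHS](sum_delta j (fun q => S (u l q * u l' j'))); apply: eq_bigr => q _.
  rewrite -(sum_delta j' (fun q' => S (u l q * u l' q'))) -sumrMnl; apply: eq_bigr => q' _.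
  by rewrite YZ mulrA !deltar (eq_sym q) (eq_sym q') mulrnAC.
transitivity (\sum_r \sum_r' (\sum_q \sum_q' X q q' * Y q q' r r') * Z r r').
  under eq_bigr => q _ do under eq_bigr => q' _ do rewrite mulr_sumr.
  under eq_bigr => q _ do rewrite exchange_big.
  rewrite exchange_big; apply: eq_bigr => r _.
  under eq_bigr => q _ do under eq_bigr => q' _ do rewrite mulr_sumr.
  under eq_bigr => q _ do rewrite exchange_big.
  rewrite exchange_big; apply: eq_bigr => r' _.
  rewrite mulr_suml; apply: eq_bigr => q _; rewrite mulr_suml; apply: eq_bigr => q' _.
  by rewrite mulrA.
rewrite -[RHS](sum_delta l (fun r => S (u l' j') * S (u r j))); apply: eq_bigr => r _.
rewrite -(sum_delta l' (fun r' => S (u r' j') * S (u r j))) -sumrMnl; apply: eq_bigr => r' _.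
by rewrite XY -mulrA !deltal mulrnAC.
Qed.

(** [X] is a left inverse and [Z] a right inverse of the matrix [Y] of the [comul (u l j)]. *)
Lemma comul_antipode_mcf l j : comul (S (u l j)) = \sum_q S (u q j) \ox S (u l q).
Proof.
have lS : linear (fun h => comul (S h)) by exact: (lin_comp S_lin (@comul_linear k H)).
pose X : 'M[ktensor H H]_d.+1 := \matrix_(l, j) comul (S (u l j)).
pose Y : 'M[ktensor H H]_d.+1 := \matrix_(l, j) comul (u l j).
pose Z : 'M[ktensor H H]_d.+1 := \matrix_(l, j) \sum_q S (u q j) \ox S (u l q).
have cnat (b : bool) : comul (b%:R : H) = b%:R.
  case: b; first by rewrite (@comul_monoid k H).1.
  exact: (lin0 (@comul_linear k H)).
have XY : X *m Y = 1%:M.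
  apply/matrixP => a b; rewrite !mxE -[RHS]cnat -antipode_mcfl (linear_sumE _ _ (@comul_linear k H)).
  by apply: eq_bigr => q _; rewrite !mxE (@comul_monoid k H).2.
have YZ : Y *m Z = 1%:M.
  apply/matrixP => a b; rewrite !mxE.
  transitivity (\sum_s \sum_t (u a s * S (u t b)) \ox ((s == t)%:R : H)).
    under eq_bigr => q _ do rewrite !mxE comul_mcf mulr_suml.
    rewrite exchange_big; apply: eq_bigr => s _ /=.
    under eq_bigr => q _ do rewrite mulr_sumr.
    rewrite exchange_big; apply: eq_bigr => t _ /=.
    rewrite -antipode_mcfr ktens_sumr; apply: eq_bigr => q _.
    exact: ktensM.
  transitivity (\sum_s (u a s * S (u s b)) \ox (1 : H)).
    apply: eq_bigr => s _; rewrite (bigD1 s) //= eqxx big1 ?addr0 // => t /negbTE.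
    by rewrite eq_sym => ->; apply: (lin0 ((ktens_bilin _ _).2 _)).
  rewrite -ktens_suml antipode_mcfr; case: (a == b) => //.
  exact: (lin0 ((ktens_bilin _ _).1 _)).
have : X = Z by rewrite -[X]mulmx1 -YZ mulmxA XY mul1mx.
by move/matrixP/(_ l j); rewrite !mxE.
Qed.

Section Integral.

(* [f(S^2 y_2) y_1] in Sweedler notation. *)
Definition antipode2_slice (f : H -> k) (y : H) : H := slice (fun b => f (S (S b))) (comul y).

Lemma antipode2_form_linear (f : H -> k) : linear (f : H -> k^o) -> linear (fun b => f (S (S b)) : k^o).
Proof. by move=> lf; exact: (lin_comp S_lin (lin_comp S_lin lf)). Qed.

Lemma antipode2_slice_linear (f : H -> k) : linear (f : H -> k^o) -> linear (antipode2_slice f).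
Proof. by move=> lf; apply: (lin_comp (@comul_linear k H)); apply/slice_linear/antipode2_form_linear. Qed.

Lemma antipode2_slice_mcf (f : H -> k) a b : linear (f : H -> k^o) ->
  antipode2_slice f (u a b) = \sum_t f (S (S (u t b))) *: u a t.
Proof. by move=> lf; apply: klift_mcf; apply/slice_bilin/antipode2_form_linear. Qed.

Lemma antipode2_slice_mcf2 (f : H -> k) c q a b : linear (f : H -> k^o) -> antipode2_slice f (u c q * u a b) =
  \sum_s \sum_t f (S (S (u s q * u t b))) *: (u c s * u a t).
Proof. by move=> lf; apply: klift_mcf2; apply/slice_bilin/antipode2_form_linear. Qed.

Lemma antipode2_slice_suml (I : finType) (a : I -> k) (f : I -> H -> k) y :
  antipode2_slice (fun x => \sum_i a i * f i x) y = \sum_i a i *: antipode2_slice (f i) y.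
Proof.
rewrite /antipode2_slice /slice /klift /lift /formal_eval.
under [RHS]eq_bigr => i _ do rewrite scaler_sumr.
rewrite exchange_big; apply: eq_bigr => p _ /=; rewrite scaler_suml.
by apply: eq_bigr => i _; rewrite scalerA.
Qed.

Lemma eq_antipode2_slice f g y : f =1 g -> antipode2_slice f y = antipode2_slice g y.
Proof. by move=> fg; apply: klift_eq => m n; rewrite fg. Qed.

Let mull (x : H) : linear ( *%R^~ x).
Proof. by move=> c y z; rewrite mulrDl scalerAl. Qed.

(** For [h] in place of [u c d'], the right side is [f(S(h_3) S^2(h_2 y_2)) h_1 y_1], and S(h_3)
    S^2(h_2) = S(S(h_2) h_3) collapses to a counit. *)
Lemma mcf_mul_antipode2_slice (f : H -> k) c d' y : linear (f : H -> k^o) ->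
  u c d' * antipode2_slice f y = \sum_q antipode2_slice (fun x => f (S (u q d') * x)) (u c q * y).
Proof.
move=> lf; have lfq q : linear (fun x => f (S (u q d') * x) : k^o).
  exact: (lin_comp (@mulr_lin k H _) lf).
move: y; apply: mcf_ext => [||a b].
- exact: (lin_comp (antipode2_slice_linear lf) (@mulr_lin k H _)).
- move=> t x y; rewrite scaler_sumr -big_split; apply: eq_bigr => q _ /=.
  by rewrite mulrDr -scalerAr (antipode2_slice_linear (lfq q)).
rewrite antipode2_slice_mcf // mulr_sumr; under [RHS]eq_bigr => q _ do rewrite (antipode2_slice_mcf2 _ _ _ _ (lfq q)).
rewrite exchange_big -[LHS](sum_delta d' (fun s => \sum_t u c s * (f (S (S (u t b))) *: u a t))) /=.
apply: eq_bigr => s _; rewrite exchange_big -sumrMnl; apply: eq_bigr => t _.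
rewrite -scaler_suml -scalerAr.
have -> : \sum_q f (S (u q d') * S (S (u s q * u t b))) = f (S (S (u t b))) *+ (d' == s).
  rewrite -[LHS](linear_sumE (V := H) (W := k^o)) //.
  have -> : \sum_q S (u q d') * S (S (u s q * u t b)) = S (S (u t b)) *+ (d' == s).
    transitivity (S (\sum_q S (u s q) * u q d') * S (S (u t b))).
      rewrite (linear_sumE _ _ S_lin) mulr_suml; apply: eq_bigr => q _.
      by rewrite !antipodeM mulrA.
    rewrite antipode_mcfl eq_sym; case: (d' == s); first by rewrite antipode1 mul1r.
    by rewrite (lin0 S_lin) mul0r.
  by case: (d' == s) => //=; rewrite !mulr0n (lin0 lf).
by case: (d' == s); rewrite ?scale0r ?mulr1n ?mulr0n.
Qed.

(* As [H] need not be semisimple yet, no single integral can be normalized; the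
   family over a basis is, by [left_integral_total]. *)
Definition left_integral (m : H) : H := \sum_j antipode2_slice (cf j) (e j * m).

Lemma left_integralP m g : g * left_integral m = counit g *: left_integral m.
Proof.
move: g; apply: mcf_ext => [||c d'].
- exact: mull.
- by move=> a x y; rewrite counit_scalar scalerDl scalerA.
rewrite counit_mcf mulr_sumr.
under eq_bigr => j _ do rewrite (mcf_mul_antipode2_slice _ _ _ (cf_lin j)).
rewrite exchange_big /=.
(* Cyclicity of the trace over the basis [e]: multiplication by [u c q] moves from the argument
   [e j] to the value under the form, where it meets [S (u q d')]; their sum over [q] is a
   counit. *)
have trace q : \sum_j antipode2_slice (fun x => cf j (S (u q d') * x)) (u c q * (e j * m)) =
    \sum_i antipode2_slice (fun x => cf i (u c q * (S (u q d') * x))) (e i * m).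
  have lfq j : linear (fun x => cf j (S (u q d') * x) : k^o).
    exact: (lin_comp (@mulr_lin k H _) (cf_lin j)).
  transitivity (\sum_j \sum_i cf i (u c q * e j) *: antipode2_slice (fun x => cf j (S (u q d') * x)) (e i * m)).
    apply: eq_bigr => j _; rewrite mulrA {1}(cfE (u c q * e j)) mulr_suml.
    rewrite (linear_sumE _ _ (antipode2_slice_linear (lfq j))); apply: eq_bigr => i _.
    by rewrite -scalerAl (linZ (antipode2_slice_linear (lfq j))).
  rewrite exchange_big; apply: eq_bigr => i _ /=; rewrite -antipode2_slice_suml; apply: eq_antipode2_slice => x.
  rewrite [in RHS](cfE (S (u q d') * x)) mulr_sumr (linear_sumE _ _ (cf_lin i)).
  apply: eq_bigr => j _; rewrite -scalerAr (linZ (cf_lin i)).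
  by rewrite mulrC.
under eq_bigr => q _ do rewrite trace.
rewrite exchange_big scaler_sumr; apply: eq_bigr => i _ /=.
have -> : \sum_q antipode2_slice (fun x => cf i (u c q * (S (u q d') * x))) (e i * m) =
    antipode2_slice (fun x => \sum_q 1 * cf i (u c q * (S (u q d') * x))) (e i * m).
  by rewrite antipode2_slice_suml; apply: eq_bigr => q _; rewrite scale1r.
have -> : antipode2_slice (fun x => \sum_q 1 * cf i (u c q * (S (u q d') * x))) (e i * m) =
    antipode2_slice (fun x => \sum_(q : 'I_1) (c == d')%:R * cf i x) (e i * m).
  apply: eq_antipode2_slice => x; rewrite big_ord1.
  transitivity (cf i (\sum_q u c q * (S (u q d') * x))).
    by rewrite (linear_sumE _ _ (cf_lin i)); apply: eq_bigr => q _; rewrite mul1r.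
  under eq_bigr => q _ do rewrite mulrA.
  rewrite -mulr_suml antipode_mcfr; case: (c == d'); rewrite ?mul1r ?mul0r //.
  exact: (lin0 (cf_lin i)).
by rewrite antipode2_slice_suml big_ord1.
Qed.

(** [f(S^2 y_3) f'(S y_2) y_1] in Sweedler notation. *)
Definition double_slice (f f' : H -> k) (y : H) : H := slice (fun b => f' (S b)) (comul (antipode2_slice f y)).

Lemma antipode_form_linear (f : H -> k) : linear (f : H -> k^o) -> linear (fun b => f (S b) : k^o).
Proof. by move=> lf; exact: (lin_comp S_lin lf). Qed.

Lemma double_slice_linear (f f' : H -> k) : linear (f : H -> k^o) -> linear (f' : H -> k^o) -> linear (double_slice f f').
Proof.
move=> lf lf'.
exact: (lin_comp (antipode2_slice_linear lf) (lin_comp (@comul_linear k H) (slice_linear (V := H) (antipode_form_linear lf')))).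
Qed.

Lemma double_slice_mcf (f f' : H -> k) a b : linear (f : H -> k^o) -> linear (f' : H -> k^o) ->
  double_slice f f' (u a b) = \sum_s (\sum_t f (S (S (u t b))) * f' (S (u s t))) *: u a s.
Proof.
move=> lf lf'; have ls := lin_comp (@comul_linear k H) (slice_linear (V := H) (antipode_form_linear lf')).
rewrite /double_slice antipode2_slice_mcf // -[LHS]/((slice (fun b => f' (S b)) \o @comul k H) _) (linear_sumE _ _ ls).
under [RHS]eq_bigr => s _ do rewrite scaler_suml.
rewrite exchange_big; apply: eq_bigr => t _; rewrite (linZ ls) [X in _ *: X]klift_mcf.
  by rewrite scaler_sumr; apply: eq_bigr => s _; rewrite scalerA.
exact/slice_bilin/antipode_form_linear.
Qed.

Lemma coord_mul l x y : \sum_i \sum_j cf l (e j * e i) * (cf j x * cf i y) = cf l (x * y).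
Proof.
rewrite [in RHS](cfE x) mulr_suml (linear_sumE _ _ (cf_lin l)) exchange_big.
apply: eq_bigr => j _ /=; rewrite -scalerAl (linZ (cf_lin l)).
rewrite [in RHS](cfE y) mulr_sumr (linear_sumE _ _ (cf_lin l)) scaler_sumr.
apply: eq_bigr => i _ /=; rewrite -scalerAr (linZ (cf_lin l)) -![_ *: _]/(_ * _).
by rewrite mulrC -mulrA.
Qed.

(** [coord_mul] recombines the two coordinate forms into one, applied to S^2(y_3) S(y_2) = S(y_2
    S(y_3)), which is a counit. *)
Lemma left_integral_total : \sum_i slice (fun b => cf i (S b)) (comul (left_integral (e i))) = 1.
Proof.
have lE i j := double_slice_linear (cf_lin j) (cf_lin i).
transitivity (\sum_l \sum_i \sum_j cf l (e j * e i) *: double_slice (cf j) (cf i) (e l)).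
  rewrite exchange_big; apply: eq_bigr => i _ /=; rewrite exchange_big /=.
  have ls := lin_comp (@comul_linear k H) (slice_linear (V := H) (antipode_form_linear (cf_lin i))).
  rewrite -[LHS]/((slice (fun b => cf i (S b)) \o @comul k H) _) (linear_sumE _ _ ls).
  apply: eq_bigr => j _; rewrite -[LHS]/(double_slice (cf j) (cf i) _) {1}(cfE (e j * e i)).
  by rewrite (linear_sumE _ _ (lE i j)); apply: eq_bigr => l _; rewrite (linZ (lE i j)).
rewrite [RHS](cfE 1); apply: eq_bigr => l _; move: (e l); apply: mcf_ext => [||a b].
- move=> c x y; rewrite scaler_sumr -big_split; apply: eq_bigr => i _ /=.
  rewrite scaler_sumr -big_split; apply: eq_bigr => j _ /=.
  by rewrite (lE i j) scalerDr !scalerA mulrC.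
- by move=> c x y; rewrite scalerDr !scalerA mulrC.
transitivity (\sum_s cf l (\sum_t S (S (u t b)) * S (u s t)) *: u a s).
  under eq_bigr => i _ do under eq_bigr => j _ do rewrite double_slice_mcf // scaler_sumr.
  under eq_bigr => i _ do rewrite exchange_big.
  rewrite exchange_big; apply: eq_bigr => s _ /=.
  under eq_bigr => i _ do under eq_bigr => j _ do rewrite scalerA.
  under eq_bigr => i _ do rewrite -scaler_suml.
  rewrite -scaler_suml; congr (_ *: _).
  rewrite (linear_sumE _ _ (cf_lin l)); under [RHS]eq_bigr => t _ do rewrite -coord_mul.
  rewrite [RHS]exchange_big; apply: eq_bigr => i _ /=.
  rewrite [RHS]exchange_big; apply: eq_bigr => j _ /=.
  exact: mulr_sumr.
have Ss s : \sum_t S (S (u t b)) * S (u s t) = S (s == b)%:R.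
  by rewrite -antipode_mcfr (linear_sumE _ _ S_lin); apply: eq_bigr => t _; rewrite antipodeM.
under eq_bigr => s _ do rewrite Ss.
rewrite (bigD1 b) //= eqxx antipode1 [X in _ + X]big1 ?addr0 // => s /negbTE ->.
by rewrite (lin0 S_lin) (lin0 (cf_lin l)) scale0r.
Qed.

End Integral.

(** * Generators of a module algebra over its invariants *)

Section Action.
Variables (A : algType k) (act : H -> A -> A).
Hypothesis actA : module_algebra act.

Let al := act_linearl actA.
Let ar := act_linearr actA.

Lemma act_mcfM l j a b : act (u l j) (a * b) = \sum_q act (u l q) a * act (u q j) b.
Proof.
rewrite (act_mul actA) klift_mcf //; split=> [y|x] c v w.
  by rewrite al mulrDl scalerAl.
by rewrite al mulrDr scalerAr.
Qed.

Lemma act_antipode_mcfM l j a b :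
  act (S (u j l)) (a * b) = \sum_q act (S (u q l)) a * act (S (u j q)) b.
Proof.
have bl : bilin (fun h1 h2 => act h1 a * act h2 b).
  split=> [y|x] c v w; first by rewrite al mulrDl scalerAl.
  by rewrite al mulrDr scalerAr.
rewrite (act_mul actA) comul_antipode_mcf (klift_sum _ _ bl).
by apply: eq_bigr => q _; rewrite klift_tens.
Qed.

Lemma act_nat (b : bool) a : act b%:R a = a *+ b.
Proof. by case: b; [rewrite (act_unit actA)|rewrite (lin0 (al a))]. Qed.

Lemma act_alg h c : act h c%:A = (c * counit h)%:A.
Proof. by rewrite (linZ (ar h)) (act_one actA) scalerA. Qed.

(** (h . a_s) b_s = h_1 . (a_s (S(h_2) . b_s)), since h_2 S(h_3) is a counit; the hypothesis then
    applies inside the action of h_1. *)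
Lemma antipode_pairs (f : H -> k) m (a b : 'I_m -> A) : linear (f : H -> k^o) ->
  (forall h, \sum_s a s * act h (b s) = (f h)%:A) ->
  forall h, \sum_s act h (a s) * b s = (f (S h))%:A.
Proof.
move=> lf ab; apply: mcf_ext => [||l j].
- move=> c x y; rewrite scaler_sumr -big_split; apply: eq_bigr => s _ /=.
  by rewrite al mulrDl scalerAl.
- by move=> c x y; rewrite (antipode_form_linear lf) scalerDl scalerA.
transitivity (\sum_q act (u l q) (\sum_s a s * act (S (u q j)) (b s))).
  under [RHS]eq_bigr => q _ do rewrite (linear_sumE _ _ (ar _)).
  rewrite exchange_big; apply: eq_bigr => s _ /=.
  under [RHS]eq_bigr => q _ do rewrite act_mcfM.
  rewrite exchange_big /=.
  under eq_bigr => p _ do under eq_bigr => q _ do rewrite -(act_comp actA).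
  under eq_bigr => p _ do rewrite -mulr_sumr -(linear_sumE _ _ (al _)) antipode_mcfr act_nat.
  rewrite (bigD1 j) //= eqxx big1 ?addr0 // => q /negbTE ->.
  by rewrite mulr0.
under eq_bigr => q _ do rewrite ab act_alg counit_mcf.
rewrite (bigD1 l) //= eqxx mulr1 big1 ?addr0 // => q.
by rewrite eq_sym => /negbTE ->; rewrite mulr0 scale0r.
Qed.

(** h . (x a_s) splits as (h_1 . x)(h_2 . a_s), and [antipode_pairs] evaluates the sum of (h_2 .
    a_s) b_s. *)
Lemma act_slice (f : H -> k) m (a b : 'I_m -> A) x : linear (f : H -> k^o) ->
  (forall h, \sum_s a s * act h (b s) = (f h)%:A) ->
  forall h, \sum_s act h (x * a s) * b s = act (slice (fun y => f (S y)) (comul h)) x.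
Proof.
move=> lf ab; have ab' := antipode_pairs lf ab; apply: mcf_ext => [||l j].
- move=> c y z; rewrite scaler_sumr -big_split; apply: eq_bigr => s _ /=.
  by rewrite al mulrDl scalerAl.
- exact: (lin_comp (@comul_linear k H) (lin_comp (slice_linear (V := H) (antipode_form_linear lf)) (al x))).
have -> : slice (fun y => f (S y)) (comul (u l j)) = \sum_q f (S (u q j)) *: u l q.
  exact/klift_mcf/slice_bilin/antipode_form_linear.
rewrite (linear_sumE _ _ (al x)).
transitivity (\sum_q act (u l q) x * (\sum_s act (u q j) (a s) * b s)).
  under [RHS]eq_bigr => q _ do rewrite mulr_sumr.
  rewrite exchange_big; apply: eq_bigr => s _ /=.
  by rewrite act_mcfM mulr_suml; apply: eq_bigr => q _; rewrite mulrA.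
by apply: eq_bigr => q _; rewrite ab' (linZ (al x)) -scalerAr mulr1.
Qed.

Hypothesis galois_pairs : forall f : H -> k, linear (f : H -> k^o) ->
  exists m (a b : 'I_m -> A), forall h, \sum_s a s * act h (b s) = (f h)%:A.

(** [act_slice], for the integral of [e i] and the pairs of [cf i], sums over [i] to the action of 1
    by [left_integral_total]. The coefficients [act (h s) (x * a s)] are invariant because the [h s]
    are left integrals. *)
Lemma galois_dual_bases : exists r (h : 'I_r -> H) (a b : 'I_r -> A),
  (forall s g, g * h s = counit g *: h s) /\
  (forall x, x = \sum_s act (h s) (x * a s) * b s).
Proof.
have gp i : exists p : {m : nat & ('I_m -> A) * ('I_m -> A)}%type, forall h,
    \sum_s (tagged p).1 s * act h ((tagged p).2 s) = (cf i h)%:A.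
  have [m [a [b ab]]] := galois_pairs (cf_lin i).
  by exists (existT _ m (a, b)).
have [p pE] := fin_all_exists gp.
pose T := {i : 'I_d.+1 & 'I_(tag (p i))}.
exists #|{: T}|, (fun s => left_integral (e (tag (enum_val s)))),
  (fun s => let: t := enum_val s in (tagged (p (tag t))).1 (tagged t)),
  (fun s => let: t := enum_val s in (tagged (p (tag t))).2 (tagged t)).
split=> [s g|x]; first exact: left_integralP.
rewrite -{1}(act_unit actA x) -left_integral_total (linear_sumE _ _ (al x)).
under eq_bigr => i _ do rewrite -(act_slice x (cf_lin i) (pE i)).
rewrite sig_big_dep /= (reindex (fun s : 'I_#|{: T}| => enum_val s)) //=.
exact: onW_bij (enum_val_bij _).
Qed.
End Action.

End TensorCoordinates.

(** * From Hopf-Galois actions to cocommutativity *)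

(** A preimage of [1 \ox F] under [can] is a finite sum of pure tensors; evaluating the second
    factor of its image at [h] gives the pairs. *)
Lemma hopf_galois_pairs (k : fieldType) (H : finHopfAlgType k) (A : algType k) (act : H -> A -> A)
    (f : H -> k) :
  module_algebra act -> hopf_galois act -> linear (f : H -> k^o) ->
  exists m (a b : 'I_m -> A), forall h, \sum_s a s * act h (b s) = (f h)%:A.
Proof.
move=> actA [g _ canK] lf; pose F : dual H := linfun (f : H -> k^o).
pose ev h := klift (fun (b : A) (f : dual H) => f h *: b).
have bev h : bilin (fun (b : A) (f : dual H) => f h *: b).
  split=> [f'|b] u v w; first by rewrite scalerDr !scalerA mulrC.
  by rewrite dualDE dualZE scalerDl scalerA.
have evM h b t : ev h ((b \ox 1) * t) = b * ev h t.
  move: t; apply: ktensor_ext.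
  - exact: (lin_comp (@ktensor_mul_linr _ _ _ _) (klift_linear (bev h))).
  - exact: (lin_comp (klift_linear (bev h)) (@mulr_lin _ _ _)).
  - by move=> m n /=; rewrite ktensM mul1r /ev !klift_tens // scalerAr.
have pairs (t : tensor_inv act) : exists m (a b : 'I_m -> A), forall h,
    \sum_s a s * act h (b s) = ev h (can t).
  have bal := can_balanced actA.
  move: t; apply: tensor_ind => [|t u [m [a [b ab]]] [m' [a' [b' ab']]]|a b].
  - exists 0%N, (fun=> 0), (fun=> 0) => h.
    have can0 : can (0 : tensor_inv act) = 0 by exact: (Defs.lift0 bal).
    by rewrite big_ord0 can0 /ev (lin0 (klift_linear (bev h))).
  - exists (m + m')%N, (fun s => match split s with inl i => a i | inr i => a' i end),
      (fun s => match split s with inl i => b i | inr i => b' i end) => h.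
    have canD : can (t + u) = can t + can u by exact: (liftD bal).
    have evD : ev h (can t + can u) = ev h (can t) + ev h (can u).
      exact: (linD (klift_linear (bev h))).
    rewrite canD evD -ab -ab' big_split_ord.
    congr (_ + _); apply: eq_bigr => s _; first by rewrite !split_lshift.
    by rewrite !split_rshift.
  - exists 1%N, (fun=> a), (fun=> b) => h.
    by rewrite big_ord1 -[tens _ _]/(tens a b : tensor_inv act) (can_tens actA) evM /ev coaction_eval.
have [m [a [b ab]]] := pairs (g (1 \ox F)).
exists m, a, b => h; rewrite ab canK /ev klift_tens //; congr (_ *: _).
by rewrite /dual_eval linfunE.
Qed.

Lemma weyl_algebra_iso (k : fieldType) n (A : algType k) (x y : 'I_n -> A) :
  is_weyl_algebra x y ->
  exists (eta : {lrmorphism A -> weyl k n}) (theta : {lrmorphism weyl k n -> A}),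
    cancel eta theta /\ cancel theta eta.
Proof.
move=> wA; have [relx rely relxy] := weyl_rel wA.
have [gx gy gxy] := weyl_rels_gen k n.
have gen : weyl_relations (@wx k n) (@wy k n).
  split=> i j; first by apply/eqP; rewrite subr_eq0; apply/eqP; apply: gx.
    by apply/eqP; rewrite subr_eq0; apply/eqP; apply: gy.
  by apply/eqP; rewrite subr_eq; apply/eqP; rewrite addrC; apply: gxy.
have rel : weyl_rels x y.
  split=> i j.
  - by apply/eqP; rewrite -subr_eq0 relx.
  - by apply/eqP; rewrite -subr_eq0 rely.
  - by apply/eqP; rewrite addrC -subr_eq relxy.
have [eta [ex ey]] := weyl_ext wA gen.
have [phi [px py pc]] := weyl_morphism (gam := GRing.in_alg A)
  (fun r t => etrans (mulr_algl r t) (esym (mulr_algr r t))) rel.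
have pZ : scalable phi.
  move=> c f; rewrite -[in LHS](mulr_algl c (f : weyl k n)).
  exact: etrans (rmorphM phi _ _) (etrans (congr1 ( *%R^~ (phi f)) (pc c)) (mulr_algl _ _)).
pose theta : {lrmorphism weyl k n -> A} := HB.pack (phi : weyl k n -> A) phi
  (GRing.isScalable.Build k (weyl k n) A *:%R phi pZ).
exists eta, theta; split.
  pose id' : {lrmorphism A -> A} := idfun.
  pose te : {lrmorphism A -> A} := theta \o eta.
  apply: (weyl_unique wA (f := te) (g := id')) => i.
    by rewrite -[LHS]/(phi (eta (x i))) ex px.
  by rewrite -[LHS]/(phi (eta (y i))) ey py.
pose id' : {rmorphism weyl k n -> weyl k n} := idfun.
pose et : {rmorphism weyl k n -> weyl k n} := eta \o phi.
apply: (eq_weyl_morphism (phi := et) (psi := id')) => [i|i|c].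
- by rewrite -[LHS]/(eta (phi (wx k i))) px ex.
- by rewrite -[LHS]/(eta (phi (wy k i))) py ey.
- rewrite -[LHS]/(eta (phi c%:A)) pc -[LHS]/(eta (c *: 1)) linearZ rmorph1.
  by [].
Qed.

(** * The action as matrix-valued ring morphisms *)

Section ActionMatrices.
Variables (k : fieldType) (H : hopfAlgType k) (d : nat).
Variables (e : 'I_d.+1 -> H) (cf : 'I_d.+1 -> H -> k).
Hypotheses (cf_lin : forall i, linear (cf i : H -> k^o)) (cfE : forall h, h = \sum_i cf i h *: e i).
Hypothesis cf_e : forall i j, cf i (e j) = (i == j)%:R.
Variables (A : algType k) (act : H -> A -> A).
Hypothesis actA : module_algebra act.
Local Notation u := (mcf e cf).

Let al := act_linearl actA.
Let ar := act_linearr actA.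

Lemma counit_antipode_mcf l j : counit (antipode (u l j)) = (l == j)%:R.
Proof.
pose X : 'M[k]_d.+1 := \matrix_(l, j) counit (antipode (u l j)).
suff : X = 1%:M by move/matrixP/(_ l j); rewrite !mxE.
have U1 : \matrix_(l, j) counit (u l j) = 1%:M :> 'M[k]_d.+1.
  by apply/matrixP => a b; rewrite !mxE (counit_mcf cf_lin cfE cf_e).
rewrite -[X]mulmx1 -{1}U1; apply/matrixP => a b; rewrite !mxE.
have lc : linear (@counit k H : H -> k^o) by exact: counit_scalar.
have := congr1 (@counit k H) (antipode_mcfl cf_lin cfE cf_e a b).
rewrite (linear_sumE _ _ lc) => e1; transitivity (counit ((a == b)%:R : H)); last first.
  by case: (a == b); [exact: (@counit_monoid k H).1|exact: (lin0 lc)].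
by rewrite -e1; apply: eq_bigr => q _; rewrite !mxE (@counit_monoid k H).2.
Qed.

Lemma action_morphism : exists rho : {rmorphism A -> 'M[A]_d.+1},
  forall a l j, rho a l j = act (u l j) a.
Proof.
pose r a : 'M[A]_d.+1 := \matrix_(l, j) act (u l j) a.
have rB : zmod_morphism r.
  by move=> a b; apply/matrixP => l j; rewrite !mxE -[- b]scaleN1r (linD (ar _)) (linZ (ar _)) scaleN1r.
have rM : monoid_morphism r.
  split=> [|a b]; apply/matrixP => l j; rewrite !mxE.
    by rewrite (act_one actA) (counit_mcf cf_lin cfE cf_e) scaler_nat.
  by rewrite (act_mcfM cf_lin cfE cf_e actA); apply: eq_bigr => q _; rewrite !mxE.
pose r' : {rmorphism A -> 'M[A]_d.+1} := HB.pack r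
  (GRing.isZmodMorphism.Build A 'M[A]_d.+1 r rB)
  (GRing.isMonoidMorphism.Build A 'M[A]_d.+1 r rM).
exists r' => a l j.
exact: mxE.
Qed.

(** The antipode reverses the comultiplication; the transposed indices of [u] restore the order of
    the matrix product. *)
Lemma antipode_action_morphism : exists sigma : {rmorphism A -> 'M[A]_d.+1},
  forall a l j, sigma a l j = act (antipode (u j l)) a.
Proof.
pose r a : 'M[A]_d.+1 := \matrix_(l, j) act (antipode (u j l)) a.
have rB : zmod_morphism r.
  by move=> a b; apply/matrixP => l j; rewrite !mxE -[- b]scaleN1r (linD (ar _)) (linZ (ar _)) scaleN1r.
have rM : monoid_morphism r.
  split=> [|a b]; apply/matrixP => l j; rewrite !mxE.
    by rewrite (act_one actA) counit_antipode_mcf eq_sym scaler_nat.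
  by rewrite (act_antipode_mcfM cf_lin cfE cf_e actA); apply: eq_bigr => q _; rewrite !mxE.
pose r' : {rmorphism A -> 'M[A]_d.+1} := HB.pack r
  (GRing.isZmodMorphism.Build A 'M[A]_d.+1 r rB)
  (GRing.isMonoidMorphism.Build A 'M[A]_d.+1 r rM).
exists r' => a l j.
exact: mxE.
Qed.
End ActionMatrices.

Section GaloisCommute.
Variables (k : fieldType) (char0 : [pchar k] =i pred0).
Variables (n : nat) (A : algType k) (x y : 'I_n -> A) (weylA : is_weyl_algebra x y).
Variables (H : finHopfAlgType k) (act : H -> A -> A).
Hypotheses (actA : module_algebra act) (galA : hopf_galois act).
Variables (d : nat) (e : 'I_d.+1 -> H) (cf : 'I_d.+1 -> H -> k).
Hypotheses (cf_lin : forall i, linear (cf i : H -> k^o)) (cfE : forall h, h = \sum_i cf i h *: e i).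
Hypothesis cf_e : forall i j, cf i (e j) = (i == j)%:R.
Local Notation u := (mcf e cf).
Local Notation W := (weyl k n).

Lemma galois_mcf_commute (f g : H -> k) l j : linear (f : H -> k^o) -> linear (g : H -> k^o) ->
  \sum_q f (u l q) * g (u q j) = \sum_q g (u l q) * f (u q j).
Proof.
move=> lf lg; have al := act_linearl actA.
have [eta [theta [etaK thetaK]]] := weyl_algebra_iso weylA.
have pairs F := fun lF => @hopf_galois_pairs k H A act F actA galA lF.
have [r [h [a [b [hI abE]]]]] := galois_dual_bases cf_lin cfE cf_e actA pairs.
have inv s (z : A) : Defs.invariant act (act (h s) z).
  by move=> g'; rewrite -(act_comp actA) hI (linZ (al z)).
have [rA rAE] := action_morphism cf_lin cfE cf_e actA.
have [sA sAE] := antipode_action_morphism cf_lin cfE cf_e actA.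
(* All forms must be represented through the same [b t]: the pairs of [F] are expanded in these
   generators, and the invariant coefficients leave the action. *)
have coefs (F : H -> k) : linear (F : H -> k^o) ->
    exists c : 'I_r -> A, forall h', (F h')%:A = \sum_t c t * act h' (b t).
  move=> lF; have [m [a' [b' ab']]] := pairs F lF.
  exists (fun t => \sum_s a' s * act (h t) (b' s * a t)) => h'; rewrite -ab'.
  under [RHS]eq_bigr => t _ do rewrite mulr_suml.
  rewrite exchange_big; apply: eq_bigr => s _ /=.
  rewrite [in LHS](abE (b' s)) (linear_sumE _ _ (act_linearr actA h')) mulr_sumr.
  by apply: eq_bigr => t _; rewrite (act_invl actA) // mulrA.
have [cM cME] := coefs f lf; have [cN cNE] := coefs g lg.
pose rho : {rmorphism W -> 'M[W]_d.+1} := map_mx eta \o rA \o theta.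
pose sigma : {rmorphism W -> 'M[W]_d.+1} := map_mx eta \o sA \o theta.
have rhoE z l' j' : rho z l' j' = eta (act (u l' j') (theta z)).
  by rewrite -rAE [LHS]mxE.
have sigmaE z l' j' : sigma z l' j' = eta (act (antipode (u j' l')) (theta z)).
  by rewrite -sAE [LHS]mxE.
have rho_inv (z : A) : Defs.invariant act z -> rho (eta z) = (eta z)%:M.
  move=> iz; apply/matrixP => l' j'; rewrite rhoE etaK iz (counit_mcf cf_lin cfE cf_e).
  rewrite [RHS]mxE linearZ; case: (l' == j'); first exact: scale1r.
  exact: scale0r.
have algE c : eta c%:A = c%:A :> W by rewrite linearZ rmorph1.
have algE' c : theta c%:A = c%:A by rewrite linearZ rmorph1.
have rhoZ c : rho c%:A = (c%:A)%:M.
  rewrite -[in LHS]algE rho_inv ?algE // => g'.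
  by rewrite act_alg // mulrC scalerA.
have sigmaZ c : sigma c%:A = (c%:A)%:M.
  apply/matrixP => l' j'; rewrite sigmaE algE' act_alg // counit_antipode_mcf //.
  rewrite algE [RHS]mxE eq_sym; case: (l' == j'); first by rewrite mulr1.
  by rewrite mulr0; exact: scale0r.
have inverse z l' j' : \sum_q sigma (rho z q j') q l' = z *+ (l' == j').
  transitivity (eta (\sum_q act (antipode (u l' q) * u q j') (theta z))).
    rewrite [RHS]rmorph_sum; apply: eq_bigr => q _.
    by rewrite sigmaE rhoE etaK (act_comp actA).
  rewrite -(linear_sumE _ _ (al _)) antipode_mcfl // act_nat //.
  by case: (l' == j'); [exact: thetaK | exact: rmorph0].
have basis z : z = \sum_s eta (act (h s) (theta z * a s)) * eta (b s).
  rewrite -{1}(thetaK z) {1}(abE (theta z)) [LHS]rmorph_sum; apply: eq_bigr => s _.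
  exact: rmorphM.
have coefE (F : H -> k) (c : 'I_r -> A) : (forall h', (F h')%:A = \sum_t c t * act h' (b t)) ->
    map_mx (GRing.in_alg W) (\matrix_(l', j') F (u l' j') : 'M_d.+1) =
    \sum_t (eta (c t))%:M * rho (eta (b t)).
  move=> cE; apply/matrixP => l' j'; rewrite summxE.
  transitivity ((F (u l' j'))%:A : W); first by rewrite [LHS]mxE mxE.
  rewrite -algE cE [LHS]rmorph_sum; apply: eq_bigr => t _.
  by rewrite scalar_mulE rhoE etaK; exact: rmorphM.
have dat : galois_datum rho sigma (fun s => eta (b s)) (fun s => eta (act (h s) (theta 1 * a s)))
    (fun i s t => eta (act (h t) (theta (eta (b s) * wx k i) * a t)))
    (fun i s t => eta (act (h t) (theta (eta (b s) * wy k i) * a t)))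
    (\matrix_(l', j') f (u l' j')) (\matrix_(l', j') g (u l' j'))
    (fun t => eta (cM t)) (fun t => eta (cN t)).
  split; first by [].
  - by split=> i; apply: inverse.
  - by split=> [s|i s t|i s t]; apply/rho_inv/inv.
  - by split=> [|i s|i s]; apply: basis.
  - by split; apply: coefE.
have /matrixP/(_ l j) := galois_datum_commute char0 dat.
rewrite !mxE; under eq_bigr => q _ do rewrite !mxE.
by under [in RHS]eq_bigr => q _ do rewrite !mxE.
Qed.
End GaloisCommute.

(** * Cocommutative Hopf algebras over algebraically closed fields *)

Section Eigenvectors.
Variable k : closedFieldType.

(** If all roots of the characteristic polynomial are zero, it is a power of the variable, so its
    coefficient carrying the trace vanishes. *)
Lemma trace_eigenvalue m (X : 'M[k]_m) : \tr X != 0 -> exists2 a, a != 0 & eigenvalue X a.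
Proof.
case: m X => [X|m X]; first by rewrite /mxtrace big_ord0 eqxx.
move=> tX; have [r rE] := closed_field_poly_normal (char_poly X).
rewrite (monicP (char_poly_monic X)) scale1r in rE.
case: (altP (@allP _ (pred1 0) r)) => [r0|/allPn[a ar a0]]; last first.
  exists a => //; by rewrite eigenvalue_root_char rE root_prod_XsubC.
have sr : size r = m.+1.
  by apply: succn_inj; rewrite -(size_char_poly X) rE size_prod_XsubC.
have eX : char_poly X = 'X^(m.+1).
  rewrite rE -sr big_seq (eq_bigr (fun=> 'X)) => [|z /r0/eqP ->]; last by rewrite subr0.
  by rewrite -big_seq big_const_seq count_predT iter_mulr_1.
have := char_poly_trace X (ltn0Sn m); rewrite eX coefXn /= ltn_eqF // => /eqP.
by rewrite eq_sym oppr_eq0 (negbTE tX).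
Qed.

Lemma common_eigenvector_in m (s : seq 'M[k]_m) (V : 'M[k]_m) :
  {in s &, forall A B, A *m B = B *m A} -> {in s, forall A, stablemx V A} -> V != 0 ->
  exists2 v : 'rV[k]_m, v != 0 & (v <= V)%MS /\ {in s, forall A, exists a, v *m A = a *: v}.
Proof.
elim: s V => [|A s IH] V sC sV V0.
  exists (nz_row V); first by rewrite nz_row_eq0.
  by split=> //; apply: nz_row_sub.
have AsV : stablemx V A by apply: sV; apply: mem_head.
have [a ra] : exists a, root (char_poly (conjmx (row_base V) A)) a.
  by apply/closed_rootP; rewrite size_char_poly eqSS mxrank_eq0.
have /eigenvalueP[w wA w0] : eigenvalue (conjmx (row_base V) A) a by rewrite eigenvalue_root_char.
pose v := w *m row_base V.
have vV : (v <= V)%MS by apply: submx_trans (submxMl _ _) _; rewrite eq_row_base.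
have v0 : v != 0 by rewrite /v mulmx_free_eq0 // row_base_free.
have vA : (v <= eigenspace A a)%MS.
  rewrite -sub_eigenspace_conjmx ?row_base_free ?stablemx_row_base //.
  exact/eigenspaceP.
have [B C Bs Cs|B Bs||v' v'0 [v'V v's]] := IH (V :&: eigenspace A a)%MS.
- by apply: (sC B C); rewrite inE ?Bs ?Cs orbT.
- rewrite sub_capmx; apply/andP; split.
    apply: submx_trans (submxMr _ (capmxSl _ _)) _.
    by apply: sV; rewrite inE Bs orbT.
  apply: submx_trans (submxMr _ (capmxSr _ _)) _.
  by apply: comm_mx_stable_eigenspace; apply: (sC A B); rewrite inE ?Bs ?eqxx ?orbT.
- by apply: contraNneq v0 => e; rewrite -submx0 -e sub_capmx vV.
move: v'V; rewrite sub_capmx => /andP[v'V /eigenspaceP v'A].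
exists v' => //; split=> // B; rewrite inE => /orP[/eqP ->|]; last exact: v's.
by exists a.
Qed.

Lemma common_eigenvector_neq0 m (I : finType) (L : I -> 'M[k]_m) (X : 'M[k]_m) :
  (forall i j, L i *m L j = L j *m L i) -> (forall i, X *m L i = L i *m X) -> \tr X != 0 ->
  exists (v : 'rV[k]_m) (a : k) (c : I -> k),
    [/\ v != 0, a != 0, v *m X = a *: v & forall i, v *m L i = c i *: v].
Proof.
move=> LC XC /trace_eigenvalue[a a0 aX].
have [? ? /codomP[i ->] /codomP[j ->]|? /codomP[i ->]||v v0 [vX vL]] :=
  @common_eigenvector_in m (codom L) (eigenspace X a).
- exact: LC.
- exact: comm_mx_stable_eigenspace.
- exact: aX.
have [c cE] := fin_all_exists (fun i => vL _ (codom_f L i)).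
by exists v, a, c; split=> //; apply/eigenspaceP.
Qed.
End Eigenvectors.

(** * The trace form of a cocommutative Hopf algebra *)

Section Cocommutative.
Variables (k : closedFieldType) (char0 : [pchar k] =i pred0) (H : hopfAlgType k) (d : nat).
Variables (e : 'I_d.+1 -> H) (cf : 'I_d.+1 -> H -> k).
Hypotheses (cf_lin : forall i, linear (cf i : H -> k^o)) (cfE : forall h, h = \sum_i cf i h *: e i).
Hypothesis cf_e : forall i j, cf i (e j) = (i == j)%:R.
Local Notation u := (mcf e cf).
Hypothesis comm : forall (f g : H -> k) l j, linear (f : H -> k^o) -> linear (g : H -> k^o) ->
  \sum_q f (u l q) * g (u q j) = \sum_q g (u l q) * f (u q j).
Local Notation S := (@antipode k H).
Let S_lin := @antipode_linear k H.
Let mull (x : H) : linear ( *%R^~ x).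
Proof. by move=> c y z; rewrite mulrDl scalerAl. Qed.

Lemma mcf_swap (V : lmodType k) (be : H -> H -> V) l j : bilin be ->
  \sum_q be (u l q) (u q j) = \sum_q be (u q j) (u l q).
Proof.
move=> bb; have E x y : be x y = \sum_a \sum_b (cf a x * cf b y) *: be (e a) (e b).
  rewrite [in LHS](cfE x) (linear_sumE _ _ (bb.1 y)); apply: eq_bigr => a _.
  rewrite (linZ (bb.1 y)) [in LHS](cfE y) (linear_sumE _ _ (bb.2 _)) scaler_sumr.
  by apply: eq_bigr => b _; rewrite (linZ (bb.2 _)) scalerA.
under eq_bigr => q _ do rewrite E; under [RHS]eq_bigr => q _ do rewrite E.
rewrite exchange_big [RHS]exchange_big; apply: eq_bigr => a _ /=.
rewrite exchange_big [RHS]exchange_big; apply: eq_bigr => b _ /=.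
rewrite -!scaler_suml comm //; congr (_ *: _).
by apply: eq_bigr => q _; rewrite mulrC.
Qed.

(** Both [U] and [U2] invert [U1]: after a swap, the product of [U2] and [U1] is [S] applied to the
    antipode law. *)
Lemma antipodeK h : S (S h) = h.
Proof.
move: h; apply: (mcf_ext cf_lin cfE) => //; first exact: (lin_comp S_lin S_lin).
pose U : 'M[H]_d.+1 := \matrix_(l, j) u l j.
pose U1 : 'M[H]_d.+1 := \matrix_(l, j) S (u l j).
pose U2 : 'M[H]_d.+1 := \matrix_(l, j) S (S (u l j)).
have U1U : U1 *m U = 1%:M.
  apply/matrixP => l j; rewrite !mxE -(antipode_mcfl cf_lin cfE cf_e).
  by apply: eq_bigr => q _; rewrite !mxE.
have U2U1 : U2 *m U1 = 1%:M.
  apply/matrixP => l j; rewrite [LHS]mxE [RHS]mxE.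
  under eq_bigr => q _ do rewrite !mxE.
  rewrite (mcf_swap (be := fun x y => S (S x) * S y)).
    transitivity (S (l == j)%:R); last first.
      by case: (l == j); [exact: antipode1|exact: (lin0 S_lin)].
    rewrite -(antipode_mcfr cf_lin cfE cf_e) (linear_sumE _ _ S_lin).
    by apply: eq_bigr => q _; rewrite (antipodeM cf_lin cfE cf_e).
  exact: (mul_lin_bilin (lin_comp S_lin S_lin) S_lin).
move=> l j; have : U2 = U by rewrite -[U2]mulmx1 -U1U mulmxA U2U1 mul1mx.
by move/matrixP/(_ l j); rewrite !mxE.
Qed.

(** The character of the regular comodule. As [S] is now an involution, it is the integral
    [left_integral] of 1. *)
Definition mcf_trace : H := \sum_j u j j.

Lemma mcf_trace_integral g : g * mcf_trace = counit g *: mcf_trace.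
Proof.
have -> : mcf_trace = left_integral e cf 1.
  apply: eq_bigr => j _; rewrite mulr1; apply: klift_eq => x y.
  by rewrite antipodeK.
exact: (left_integralP cf_lin cfE cf_e).
Qed.

Lemma mcf_trace_comul (V : lmodType k) (be : H -> H -> V) s b : bilin be ->
  \sum_r \sum_j \sum_q be (u s r * u j q) (u r b * u q j) =
  (\sum_j \sum_q be (u j q) (u q j)) *+ (s == b).
Proof.
move=> bb; have lb := lin_comp (@comul_linear k H) (klift_linear bb).
have e1 : (klift be \o comul) (u s b * mcf_trace) =
    \sum_r \sum_j \sum_q be (u s r * u j q) (u r b * u q j).
  rewrite mulr_sumr (linear_sumE _ _ lb) exchange_big; apply: eq_bigr => j _.
  exact: (klift_mcf2 cf_lin cfE cf_e).
rewrite -e1 mcf_trace_integral (counit_mcf cf_lin cfE cf_e) (linZ lb) scaler_nat.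
rewrite (linear_sumE _ _ lb); congr (_ *+ _); apply: eq_bigr => j _.
exact: (klift_mcf cf_lin cfE cf_e).
Qed.

(** With T = [mcf_trace]: f(S(y) T_1) T_2 = f(S(y_1) y_2 T_1) y_3 T_2 = f(T_1) y T_2, the first step
    since T is an integral. *)
Lemma mcf_trace_shift (f : H -> k) y : linear (f : H -> k^o) ->
  \sum_j \sum_q f (S y * u j q) *: u q j = y * \sum_j \sum_q f (u j q) *: u q j.
Proof.
move=> lf; have lfm z : linear (fun x => f (z * x) : k^o) by exact: (lin_comp (@mulr_lin k H z) lf).
have lfm' z : linear (fun x => f (S x * z) : k^o).
  exact: (lin_comp S_lin (lin_comp (mull z) lf)).
move: y; apply: (mcf_ext cf_lin cfE) => [c x y||a b].
- rewrite scaler_sumr -big_split; apply: eq_bigr => j _ /=.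
  rewrite scaler_sumr -big_split; apply: eq_bigr => q _ /=.
  by rewrite (lfm' (u j q)) scalerDl scalerA.
- exact: mull.
have bb s : bilin (fun x z => f (S (u a s) * x) *: z : H).
  split=> [z|x] c v w; last by rewrite scalerDr !scalerA mulrC.
  by rewrite (lfm (S (u a s))) scalerDl scalerA.
transitivity (\sum_s (\sum_j \sum_q f (S (u a s) * u j q) *: u q j) *+ (s == b)).
  rewrite -[LHS](sum_delta b (fun s => \sum_j \sum_q f (S (u a s) * u j q) *: u q j)).
  by apply: eq_bigr => s _; rewrite eq_sym.
under eq_bigr => s _ do rewrite -(mcf_trace_comul s b (bb s)).
rewrite exchange_big mulr_sumr.
transitivity (\sum_r (\sum_j \sum_q f (u j q) *: (u r b * u q j)) *+ (a == r)).
  apply: eq_bigr => r _; rewrite exchange_big -sumrMnl; apply: eq_bigr => j _ /=.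
  rewrite exchange_big -sumrMnl; apply: eq_bigr => q _ /=.
  rewrite -scaler_suml -[X in X *: _](linear_sumE (V := H) (W := k^o) _ _ lf).
  have -> : \sum_s S (u a s) * (u s r * u j q) = u j q *+ (a == r).
    under eq_bigr => s _ do rewrite mulrA.
    rewrite -mulr_suml (antipode_mcfl cf_lin cfE cf_e).
    by case: (a == r); rewrite ?mul1r ?mul0r.
  by case: (a == r); rewrite // mulr0n (lin0 lf) scale0r.
rewrite sum_delta; apply: eq_bigr => j _; rewrite mulr_sumr.
by apply: eq_bigr => q _; rewrite scalerAr.
Qed.

(** The sum over [j] and [q] is the trace of the product of [f] and [g] in the regular
    representation of the dual. For [f] in the radical, [mcf_trace_shift] gives f(z T_1) T_2 = 0 for
    all z; contraction with the antipode turns this into (d+1) f(y) = 0, and d+1 is invertible in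
    characteristic zero. *)
Lemma trace_form_nondegenerate (f : H -> k) : linear (f : H -> k^o) ->
  (forall g : H -> k, linear (g : H -> k^o) -> \sum_j \sum_q f (u j q) * g (u q j) = 0) ->
  forall y, f y = 0.
Proof.
move=> lf f0 y.
have T0 : \sum_j \sum_q f (u j q) *: u q j = 0.
  rewrite [LHS]cfE big1 // => i _; rewrite (linear_sumE _ _ (cf_lin i)).
  rewrite (_ : \sum_j _ = 0) ?scale0r // -[RHS](f0 _ (cf_lin i)); apply: eq_bigr => j _.
  by rewrite (linear_sumE _ _ (cf_lin i)); apply: eq_bigr => q _; rewrite (linZ (cf_lin i)).
have T1 z : \sum_j \sum_q f (z * u j q) *: u q j = 0.
  by rewrite -(antipodeK z) mcf_trace_shift // T0 mulr0.
have sw j : \sum_q S (u q j) * u j q = 1.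
  have := antipode_mcfl cf_lin cfE cf_e j j; rewrite eqxx (mcf_swap (be := fun x z => S x * z)) //.
  exact: (mul_lin_bilin S_lin (fun _ _ _ => erefl)).
have : f (y * \sum_j \sum_q S (u q j) * u j q) = 0.
  transitivity (\sum_b cf b (\sum_j \sum_q f (y * S (e b) * u j q) *: u q j)); last first.
    by rewrite big1 // => b _; rewrite T1 (lin0 (cf_lin b)).
  rewrite mulr_sumr (linear_sumE _ _ lf).
  under [RHS]eq_bigr => b _ do rewrite (linear_sumE _ _ (cf_lin b)).
  rewrite [RHS]exchange_big; apply: eq_bigr => j _; rewrite mulr_sumr (linear_sumE _ _ lf).
  under [RHS]eq_bigr => b _ do rewrite (linear_sumE _ _ (cf_lin b)).
  rewrite [RHS]exchange_big; apply: eq_bigr => q _ /=.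
  have -> : S (u q j) = \sum_b cf b (u q j) *: S (e b).
    rewrite [in LHS](cfE (u q j)) (linear_sumE _ _ S_lin); apply: eq_bigr => b _.
    by rewrite (linZ S_lin).
  rewrite mulr_suml mulr_sumr (linear_sumE _ _ lf); apply: eq_bigr => b _.
  rewrite -scalerAl -scalerAr mulrA (linZ lf) (linZ (cf_lin b)).
  exact: mulrC.
under eq_bigr => j _ do rewrite sw.
rewrite sumr_const card_ord mulr_natr -scaler_nat (linZ lf) => /eqP.
rewrite -[_ *: _]/(_ * _) mulf_eq0 => /orP[|/eqP //].
by rewrite ((pcharf0P k).1 char0).
Qed.

Lemma tensor_ext (t t' : ktensor H H) :
  (forall i j, cf i (slice (cf j) t) = cf i (slice (cf j) t')) -> t = t'.
Proof.
move=> tt'; rewrite (tensor_coord cf_lin cfE t) (tensor_coord cf_lin cfE t').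
apply: eq_bigr => j _; congr (_ \ox _).
by rewrite [LHS]cfE [RHS]cfE; apply: eq_bigr => i _; rewrite tt'.
Qed.

(* A joint eigenvector [v] of the matrices [(h(u_lj))] gives a multiplicative
   functional [h |-> h(g)] on the dual of [H], that is, a grouplike [g]; as [v]
   is taken in an eigenspace of [L f *m L f'] for a nonzero eigenvalue,
   [f g != 0]. *)
Lemma exists_grouplike (f : H -> k) : linear (f : H -> k^o) -> ~ (forall y, f y = 0) ->
  exists g, [/\ comul g = g \ox g, counit g = 1 & f g != 0].
Proof.
move=> lf f0.
have [f' lf' tr0] : exists2 f' : H -> k, linear (f' : H -> k^o) &
    \sum_j \sum_q f (u j q) * f' (u q j) != 0.
  apply: contrapT => h; apply: f0; apply: trace_form_nondegenerate => // g lg.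
  by apply: contrapT => /eqP g0; apply: h; exists g.
pose L (h : H -> k) : 'M[k]_d.+1 := \matrix_(l, j) h (u l j).
have LM h h' l j : (L h *m L h') l j = \sum_q h (u l q) * h' (u q j).
  by rewrite mxE; apply: eq_bigr => q _; rewrite !mxE.
have LC h h' : linear (h : H -> k^o) -> linear (h' : H -> k^o) -> L h *m L h' = L h' *m L h.
  by move=> lh lh'; apply/matrixP => l j; rewrite !LM comm.
have [|i|//|v [a [c [v0 a0 vX vc]]]] :=
    @common_eigenvector_neq0 k d.+1 _ (fun i => L (cf i)) (L f *m L f').
- by move=> i j; apply: LC.
- by rewrite -mulmxA (LC f') // mulmxA (LC f) // mulmxA.
- by rewrite /mxtrace (eq_bigr (fun j => \sum_q f (u j q) * f' (u q j))) // => j _; rewrite LM.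
pose g := \sum_i c i *: e i.
have vL h : linear (h : H -> k^o) -> v *m L h = h g *: v.
  move=> lh; have -> : L h = \sum_i h (e i) *: L (cf i).
    apply/matrixP => l j; rewrite summxE mxE {1}(cfE (u l j)) (linear_sumE _ _ lh).
    by apply: eq_bigr => i _; rewrite (linZ lh) !mxE; exact: mulrC.
  rewrite mulmx_sumr (linear_sumE _ _ lh) scaler_suml; apply: eq_bigr => i _.
  by rewrite -scalemxAr vc (linZ lh) scalerA mulrC.
have vI x y : x *: v = y *: v -> x = y.
  by move/eqP; rewrite -subr_eq0 -scalerBl scaler_eq0 (negbTE v0) orbF subr_eq0 => /eqP.
have cfg i : cf i g = c i by apply: vI; rewrite -vL // vc.
exists g; split.
- apply: tensor_ext => i j.
  have lh : linear ((fun x => cf i (slice (cf j) (comul x))) : H -> k^o).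
    exact: (lin_comp (@comul_linear k H) (lin_comp (slice_linear (V := H) (cf_lin j)) (cf_lin i))).
  rewrite slice_tens // (linZ (cf_lin i)) !cfg; apply: vI.
  rewrite -(vL (fun x => cf i (slice (cf j) (comul x)))) //.
  have -> : L (fun x => cf i (slice (cf j) (comul x))) = L (cf i) *m L (cf j).
    apply/matrixP => l q; rewrite LM mxE [slice _ _](klift_mcf cf_lin cfE cf_e).
      rewrite (linear_sumE _ _ (cf_lin i)); apply: eq_bigr => s _.
      by rewrite (linZ (cf_lin i)); exact: mulrC.
    exact: slice_bilin.
  by rewrite mulmxA vc -scalemxAl vc scalerA mulrC.
- apply: vI; rewrite -vL; last exact: counit_scalar.
  have -> : L (@counit k H) = 1%:M.
    by apply/matrixP => l j; rewrite !mxE (counit_mcf cf_lin cfE cf_e).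
  by rewrite mulmx1 scale1r.
- apply: contraNneq a0 => fg0; apply/eqP/vI.
  by rewrite -vX mulmxA vL // fg0 scale0r mul0mx.
Qed.
End Cocommutative.

(** * Grouplike elements and the group algebra *)

Section Grouplikes.
Variables (k : fieldType) (H : finHopfAlgType k).

Definition grouplike (g : H) : Prop := comul g = g \ox g /\ counit g = 1.

Lemma grouplike1 : grouplike 1.
Proof. by split; [rewrite (@comul_monoid k H).1|rewrite (@counit_monoid k H).1]. Qed.

Lemma grouplikeM g h : grouplike g -> grouplike h -> grouplike (g * h).
Proof.
move=> [cg eg] [ch eh]; split; first by rewrite (@comul_monoid k H).2 cg ch ktensM.
by rewrite (@counit_monoid k H).2 eg eh mulr1.
Qed.

Lemma grouplike_antipode g : grouplike g ->
  [/\ antipode g * g = 1, g * antipode g = 1 & grouplike (antipode g)].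
Proof.
move=> [cg eg]; have Sl := @antipode_linear k H; have il : linear (@id H) by [].
have l : antipode g * g = 1.
  by have := antipodeL g; rewrite cg klift_tens ?eg ?scale1r //; exact: (mul_lin_bilin Sl il).
have r : g * antipode g = 1.
  by have := antipodeR g; rewrite cg klift_tens ?eg ?scale1r //; exact: (mul_lin_bilin il Sl).
split=> //; split.
  have cl := congr1 comul l; rewrite (@comul_monoid k H).2 (@comul_monoid k H).1 in cl.
  by rewrite -[LHS]mulr1 ktensor_1E -{1}r -{1}r -ktensM -cg mulrA cl mul1r.
by have := congr1 (@counit k H) l; rewrite (@counit_monoid k H).2 eg mulr1 (@counit_monoid k H).1.
Qed.

(** Contract the second factor of [comul g = g \ox g] with a coordinate form [c j]: if [c j g] is
    nonzero, then [g] is the [j]-th element of [X]. *)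
Lemma grouplike_free (X : seq H) g : free X -> {in X, forall h, grouplike h} ->
  grouplike g -> g \in <<X>>%VS -> g \in X.
Proof.
move=> fX gX [cg eg] gs; pose c (i : 'I_(size X)) (h : H) : k := coord (in_tuple X) i h.
have cl i : linear (c i : H -> k^o) by move=> a x y; rewrite /c linearP.
have gE : g = \sum_i c i g *: X`_i by exact: (coord_span (X := in_tuple X) gs).
have cX (i j : 'I_(size X)) : c i X`_j = (i == j)%:R by rewrite /c coord_free // eq_sym.
have [/existsP[j cj]|/existsPn c0] := boolP [exists i, c i g != 0]; last first.
  have g0 : g = 0 by rewrite gE big1 // => i _; move: (c0 i); rewrite negbK => /eqP ->; rewrite scale0r.
  move: eg; rewrite g0; have := lin0 (@counit_scalar k H : linear (@counit k H : H -> k^o)).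
  by move=> -> /eqP; rewrite eq_sym oner_eq0.
suff e1 : c j g *: g = c j g *: X`_j by rewrite (scalerI cj e1) mem_nth.
have := congr1 (slice (c j)) cg; rewrite slice_tens // => <-.
have sl := slice_linear (V := H) (cl j).
rewrite {1}gE (linear_sumE _ _ (@comul_linear k H)) (linear_sumE _ _ sl) (bigD1 j) //= big1 ?addr0 => [|i ij].
  have [cX' _] := gX _ (mem_nth 0 (ltn_ord j)).
  by rewrite (linZ (@comul_linear k H)) (linZ sl) cX' slice_tens // cX eqxx scale1r.
have [cX' _] := gX _ (mem_nth 0 (ltn_ord i)).
rewrite (linZ (@comul_linear k H)) (linZ sl) cX' slice_tens // cX eq_sym (negbTE ij).
by rewrite scale0r scaler0.
Qed.

Hypothesis separated : forall f : H -> k, linear (f : H -> k^o) -> ~ (forall y, f y = 0) ->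
  exists2 g, grouplike g & f g != 0.

Lemma grouplike_basis : exists X : seq H,
  [/\ free X, (<<X>> = fullv)%VS & forall g, (g \in X) <-> grouplike g].
Proof.
pose P m := `[< exists X, [/\ free X, {in X, forall h, grouplike h} & size X = m] >].
have P0 : exists m, P m by exists 0%N; apply/asboolP; exists [::]; split=> //; apply: nil_free.
have Pub m : P m -> (m <= \dim {:H})%N.
  by move=> /asboolP[X [fX _ <-]]; rewrite -(eqP fX); apply/dimvS/subvf.
case: (ex_maxnP P0 Pub) => m /asboolP[X [fX gX sX]] mmax.
have spanX g : grouplike g -> g \in <<X>>%VS.
  move=> gg; apply: contraT => gs; have : P m.+1.
    apply/asboolP; exists (g :: X); split; rewrite ?free_cons ?gs //=; last by rewrite sX.
    by move=> h; rewrite inE => /orP[/eqP ->|/gX].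
  by move=> /mmax; rewrite ltnn.
exists X; split=> // [|g]; last first.
  by split=> [/gX //|gg]; apply: grouplike_free => //; apply: spanX.
apply/vspaceP => v; rewrite memvf; apply: contraT => vX.
(* A coordinate of [v - projv <<X>> v] is a form that vanishes on all grouplike elements; were it
   nonzero, [separated] would be violated. *)
pose p v := v - projv <<X>> v.
have pl : linear p by move=> a x y; rewrite /p linearP scalerBr opprD addrACA.
have pv : p v != 0.
  by apply: contra vX => /eqP/subr0_eq ->; apply: memv_proj.
have [i pvi] : exists i, coord (vbasis {:H}) i (p v) != 0.
  apply/existsP; apply: contraNT pv => /existsPn c0.
  rewrite (coord_vbasis (memvf (p v))) big1 ?eqxx // => i _.
  by move: (c0 i); rewrite negbK => /eqP ->; rewrite scale0r.
have [|/(_ v)|g gg] := separated (f := fun v => coord (vbasis {:H}) i (p v)).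
- by move=> a x y; rewrite pl linearP.
- by apply/eqP.
by rewrite /p (projv_id (spanX _ gg)) subrr linear0 eqxx.
Qed.

Lemma grouplike_group_algebra (I : hopfIdeal H) : (ideal_space I = 0)%VS ->
  exists (gT : finGroupType) (f : hopf_quot I -> groupAlg k gT), hopf_morphism f /\ bijective f.
Proof.
move=> I0; have [X [fX sX Xgl]] := grouplike_basis.
have gl (x : seq_sub X) : grouplike (val x) by apply/Xgl/valP.
have X1 : 1 \in X by apply/Xgl/grouplike1.
have XM (x y : seq_sub X) : val x * val y \in X by apply/Xgl/grouplikeM; apply: gl.
have XV (x : seq_sub X) : antipode (val x) \in X by apply/Xgl; case: (grouplike_antipode (gl x)).
pose one : seq_sub X := SeqSub X1.
pose mul x y : seq_sub X := SeqSub (XM x y).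
pose inv x : seq_sub X := SeqSub (XV x).
have mulA : associative mul by move=> x y z; apply/val_inj/mulrA.
have mul1 : left_id one mul by move=> x; apply/val_inj/mul1r.
have mulV : left_inverse one inv mul.
  by move=> x; apply: val_inj; case: (grouplike_antipode (gl x)).
pose gT : finGroupType := HB.pack (seq_sub X)
  (Finite_isGroup.Build (seq_sub X) mulA mul1 mulV).
pose v (x : gT) : H := val (x : seq_sub X).
pose F (h : H) : groupAlg k gT := \sum_(i < size X)
  coord (in_tuple X) i h *: galg_in k (SeqSub (mem_nth 0 (ltn_ord i)) : gT).
have Fl : linear F.
  move=> a x y; rewrite scaler_sumr -big_split; apply: eq_bigr => i _ /=.
  by rewrite linearP scalerDl scalerA.
have Fv x : F (v x) = galg_in k x.
  have [j vj] : exists j : 'I_(size X), X`_j = v x.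
    have ix : (index (v x) X < size X)%N by rewrite index_mem; apply: (valP (x : seq_sub X)).
    by exists (Ordinal ix); rewrite nth_index //; apply: (valP (x : seq_sub X)).
  rewrite -vj /F (bigD1 j) //= big1 ?addr0 => [|i ij]; rewrite (coord_free (X := in_tuple X)) //.
    by rewrite eqxx scale1r; congr galg_in; apply/val_inj/vj.
  by rewrite eq_sym (negbTE ij) scale0r.
have extX (V : lmodType k) (F1 F2 : H -> V) : linear F1 -> linear F2 ->
    (forall x, F1 (v x) = F2 (v x)) -> F1 =1 F2.
  move=> l1 l2 e12 h; have hs : h \in <<in_tuple X>>%VS by rewrite sX memvf.
  rewrite (coord_span hs) (linear_sumE _ _ l1) (linear_sumE _ _ l2); apply: eq_bigr => i _.
  rewrite (linZ l1) (linZ l2); congr (_ *: _).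
  exact: (e12 (SeqSub (mem_nth 0 (ltn_ord i)))).
pose G := galg_ext v.
have GF h : G (F h) = h.
  move: h; apply: (extX _) => // [|x]; first exact: (lin_comp Fl (galg_ext_linear v)).
  by rewrite Fv [LHS]galg_ext_in.
have FG a : F (G a) = a.
  move: a; apply: galg_extP => // [|x]; first exact: (lin_comp (galg_ext_linear v) Fl).
  by rewrite [G _]galg_ext_in Fv.
have mull (A : algType k) (x : A) : linear ( *%R^~ x) by move=> c y z; rewrite mulrDl scalerAl.
have FM a b : F (a * b) = F a * F b.
  move: a; apply: (extX _) => [||x].
  - exact: (lin_comp (mull _ b) Fl).
  - exact: (lin_comp Fl (mull _ (F b))).
  move: b; apply: (extX _) => [||y].
  - exact: (lin_comp (@mulr_lin k H _) Fl).
  - exact: (lin_comp Fl (@mulr_lin k (groupAlg k gT) _)).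
  by rewrite -[v x * v y]/(v (x * y)%g) !Fv galg_inM.
(* With a zero ideal the projection onto the quotient is bijective, so each Hopf axiom for the map
   reduces to [F], and by [extX] to grouplike elements. *)
have rpi h : quot_repr (quot_pi I h) = h.
  by have := quot_reprP I h; rewrite I0 memv0 subr_eq0 => /eqP.
exists gT, (F \o @quot_repr k H I); split; last first.
  exists (quot_pi I \o G) => [q|a] /=; first by rewrite GF quot_reprK.
  by rewrite rpi FG.
have fl : linear (F \o @quot_repr k H I) by exact: (lin_comp (@quot_repr_linear k H I) Fl).
have [pl pM pc pe pS] := quot_pi_hopf I.
have fpi h : (F \o @quot_repr k H I) (quot_pi I h) = F h by rewrite /= rpi.
split=> //.
- split=> [|p q]; first by rewrite -[1]/(quot_pi I 1) fpi -[LHS]/(F (v 1%g)) Fv.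
  by rewrite -[p * q]/(quot_pi I (quot_repr p * quot_repr q)) fpi FM.
- elim/quot_ind => h; rewrite fpi pc; move: h; apply: (extX _) => [||x].
  + exact: (lin_comp Fl (@comul_linear k (groupAlg k gT))).
  + exact: (lin_comp (@comul_linear k H) (lin_comp (tmap_linear pl pl) (tmap_linear fl fl))).
  by rewrite Fv [LHS]galg_comul_in (gl x).1 !tmap_tens // !fpi Fv.
- elim/quot_ind => h; rewrite fpi pe; move: h; apply: (extX k^o) => [||x].
  + have lc : linear (@counit k (groupAlg k gT) : groupAlg k gT -> k^o) by exact: counit_scalar.
    exact: (lin_comp Fl lc).
  + exact: counit_scalar.
  by rewrite Fv [LHS]galg_counit_in (gl x).2.
- elim/quot_ind => h; rewrite fpi pS fpi; move: h; apply: (extX _) => [||x].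
  + exact: (lin_comp Fl (@antipode_linear k (groupAlg k gT))).
  + exact: (lin_comp (@antipode_linear k H) Fl).
  by rewrite Fv [LHS]galg_antipode_in -[antipode (v x)]/(v x^-1%g) Fv.
Qed.

End Grouplikes.

Section ZeroIdeal.
Variables (k : fieldType) (H : finHopfAlgType k).

Lemma zero_hopf_ideal : exists I : hopfIdeal H, (ideal_space I = 0)%VS.
Proof.
have ml (a x : H) : x \in 0%VS -> a * x \in 0%VS.
  by rewrite !memv0 => /eqP ->; rewrite mulr0.
have mr (a x : H) : x \in 0%VS -> x * a \in 0%VS.
  by rewrite !memv0 => /eqP ->; rewrite mul0r.
have co (x : H) : x \in 0%VS -> exists s : seq (H * H),
    all (fun p => (p.1 \in 0%VS) || (p.2 \in 0%VS)) s /\ comul x = \sum_(p <- s) p.1 \ox p.2.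
  rewrite memv0 => /eqP ->; exists [::]; split=> //.
  by rewrite big_nil (lin0 (@comul_linear k H)).
have ce (x : H) : x \in 0%VS -> counit x = 0.
  by rewrite memv0 => /eqP ->; exact: (lin0 (@counit_scalar k H : linear (@counit k H : H -> k^o))).
have an (x : H) : x \in 0%VS -> antipode x \in 0%VS.
  by rewrite !memv0 => /eqP ->; rewrite (lin0 (@antipode_linear k H)).
by exists (HopfIdeal ml mr co ce an).
Qed.
End ZeroIdeal.

Theorem theorem4p2 (k : closedFieldType) (char0 : [pchar k] =i pred0)
    (n : nat) (A : algType k) (x y : 'I_n -> A) (weylA : is_weyl_algebra x y)
    (H : finHopfAlgType k) (act : H -> A -> A) (actA : module_algebra act)
    (galA : hopf_galois act) :
  factors_through_group act.
Proof.
have [I I0] := zero_hopf_ideal H; exists I; split.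
  by move=> h a; rewrite I0 memv0 => /eqP ->; exact: (lin0 (act_linearl actA a)).
apply: grouplike_group_algebra I0 => f lf f0.
have [d [e [cf [cf_lin cfE cf_e]]]] := dual_bases H.
have comm := galois_mcf_commute char0 weylA actA galA cf_lin cfE cf_e.
have [g [cg eg fg]] := exists_grouplike char0 cf_lin cfE cf_e comm lf f0.
by exists g.
Qed.
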